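(* Let $g$ be an integer that is neither $-1$ nor a perfect square (in particular $g\neq 0$). Let $h\ge 1$ be the largest integer such that $g$ is an $h$th power. Let $\Delta$ denote the discriminant of the quadratic field $\mathbb{Q}(\sqrt{g})$. Let $f\ge 1$ and $1\le a\le f$ with $(a,f)=1$. Let $b=\Delta/(f,\Delta)$ and put $$\gamma=\begin{cases}(-1)^{\frac{b-1}{2}}(f,\Delta) & \text{if } b \text{ is odd};\\ 1 & \text{otherwise}.\end{cases}$$ Put $$A(a,f,h)=\prod_{p\mid (a-1,f)}\Big(1-\frac{1}{p}\Big)\prod_{p\nmid f,\ p\mid h}\Big(1-\frac{1}{p-1}\Big)\prod_{p\nmid f,\ p\nmid h}\Big(1-\frac{1}{p(p-1)}\Big)$$ if $(a-1,f,h)=1$, and $A(a,f,h)=0$ otherwise (products over primes $p$). Then $$\delta(a,f,g)=\frac{A(a,f,h)}{\varphi(f)}\left(1+\Big(\frac{\gamma}{a}\Big)\frac{\mu(2|b|)}{\prod_{p\mid b,\ p\mid h}(p-2)\prod_{p\mid b,\ p\nmid h}(p^2-p-1)}\right).$$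
   Context: Throughout, $p$ denotes primes, $\mu$ is the Möbius function, $\varphi$ Euler's totient function, and $(x,y)$ the gcd. Put $\zeta_m=e^{2\pi i/m}$. For $(a,f)=1$, let $\sigma_a$ be the automorphism of $\mathbb{Q}(\zeta_f)$ with $\sigma_a(\zeta_f)=\zeta_f^a$. Let $c_a(n)=1$ if the restriction of $\sigma_a$ to $\mathbb{Q}(\zeta_f)\cap\mathbb{Q}(\zeta_n,g^{1/n})$ is the identity, and $c_a(n)=0$ otherwise. Define $$\delta(a,f,g)=\sum_{n=1}^{\infty}\frac{\mu(n)c_a(n)}{[\mathbb{Q}(\zeta_f,\zeta_n,g^{1/n}):\mathbb{Q}]}.$$ (By a result of Lenstra, under GRH $\delta(a,f,g)$ is the natural density of primes $p\equiv a \pmod f$ for which $g$ is a primitive root mod $p$.) $\big(\frac{\cdot}{\cdot}\big)$ denotes the Kronecker symbol: the extension of the Jacobi symbol to pairs of nonzero integers obtained by setting $\big(\frac{x}{-1}\big)=\mathrm{sign}(x)$, $\big(\frac{x}{2}\big)=\big(\frac{2}{x}\big)$ for $x$ odd, $\big(\frac{x}{2}\big)=0$ for $x$ even, and extending multiplicatively in the denominator. *)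

(* Defs.v *)
From HB Require Import structures.
From mathcomp Require Import all_boot all_order all_algebra all_field.
From mathcomp Require Import all_classical all_reals all_analysis.

Set Implicit Arguments.
Unset Strict Implicit.
Unset Printing Implicit Defensive.

Import Order.TTheory GRing.Theory Num.Theory.
Import numFieldNormedType.Exports.
Local Open Scope ring_scope.

(* The number field Q(s) generated by a list s of algebraic numbers: its      *)
(* embedding in algC maps the list Qgens s to s, and Q(s) is generated by it. *)
Definition Qadj (s : seq algC) : fieldExtType rat :=
  projT1 (num_field_exists s).

Definition Qgens (s : seq algC) : seq (Qadj s) :=
  s2val (projT2 (projT2 (num_field_exists s))).

(* m.-root (-1) has the least argument pi / m, so its square is e^(2 pi i/m). *)
Definition zeta (m : nat) : algC := (m.-root (-1)) ^+ 2.

(* Q(zeta_f, zeta_n, g^(1/n)). The n-th root is the principal one; as zeta_n  *)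
(* is present, the choice does not affect the fields below.                   *)
Definition kummer_gens (f n : nat) (g : int) : seq algC :=
  [:: zeta f; zeta n; n.-root g%:~R].

Definition kummer (f n : nat) (g : int) : fieldExtType rat :=
  Qadj (kummer_gens f n g).

Section KummerField.
Variables (f n : nat) (g : int).

Definition zeta_f_in : kummer f n g := (Qgens (kummer_gens f n g))`_0.
Definition zeta_n_in : kummer f n g := (Qgens (kummer_gens f n g))`_1.
Definition root_in : kummer f n g := (Qgens (kummer_gens f n g))`_2.

Definition cyclotomic_sub : {vspace kummer f n g} := <<1; zeta_f_in>>%VS.

Definition radical_sub : {vspace kummer f n g} :=
  <<1 & [:: zeta_n_in; root_in]>>%VS.

(* sigma, of which only the restriction to Q(zeta_f) is relevant, induces the *)
(* automorphism sigma_a of Q(zeta_f).                                         *)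
Definition is_sigma (a : nat) (sigma : 'End(kummer f n g)) : Prop :=
  kAut 1%VS cyclotomic_sub sigma /\ sigma zeta_f_in = zeta_f_in ^+ a.

Definition c_ (a : nat) : bool :=
  `[< exists2 sigma : 'End(kummer f n g), is_sigma a sigma &
        {in (cyclotomic_sub :&: radical_sub)%VS, forall x, sigma x = x} >].

End KummerField.

Definition mobius (n : nat) : int :=
  if (0 < n)%N && all (fun p => logn p n == 1%N) (primes n)
  then (-1) ^+ size (primes n) else 0.

Section Delta.
Variable R : realType.

Definition delta_term (a f : nat) (g : int) (n : nat) : R :=
  (mobius n)%:~R * (c_ f n g a)%:R / (\dim {:kummer f n g})%:R.

Definition delta_sum (a f : nat) (g : int) (N : nat) : R :=
  \sum_(1 <= n < N) delta_term a f g n.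

Definition delta (a f : nat) (g : int) : R := limn (delta_sum a f g).

End Delta.

Section Discriminant.
Variable K : fieldExtType rat.

Definition field_trace (x : K) : rat :=
  \tr (passmx.mxof (vbasis {:K}) (vbasis {:K}) (amull x)).

Definition integral_basis (w : (\dim {:K}).-tuple K) : Prop :=
  basis_of {:K} w /\
  forall x : K, integralOver (intr : int -> K) x <->
    exists c : 'I_(\dim {:K}) -> int, x = \sum_i tnth w i *~ c i.

Definition is_discriminant (D : int) : Prop :=
  exists2 w : (\dim {:K}).-tuple K, integral_basis w &
    D%:~R = \det (\matrix_(i, j) field_trace (tnth w i * tnth w j)).

End Discriminant.

Definition quad_field (g : int) : fieldExtType rat := Qadj [:: sqrtC g%:~R].

Definition legendre (x : int) (p : nat) : int :=
  if (p%:Z %| x)%Z then 0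
  else if [exists y : 'I_p, (x == y%:Z ^+ 2 %[mod p%:Z])%Z] then 1 else -1.

(* For odd m > 0 only. *)
Definition jacobi (x : int) (m : nat) : int :=
  \prod_(p <- primes m) legendre x p ^+ logn p m.

(* (2 / x) = (2 / |x|) because (2 / -1) = 1. *)
Definition kronecker2 (x : int) : int :=
  if (2 %| x)%Z then 0 else jacobi 2 `|x|%N.

(* For x, y != 0 only. *)
Definition kronecker (x y : int) : int :=
  (if y < 0 then sgz x else 1) *
  \prod_(p <- primes `|y|%N)
     (if p == 2%N then kronecker2 x else legendre x p) ^+ logn p `|y|%N.

Definition b_ (f : nat) (D : int) : int := (D %/ gcdz f%:Z D)%Z.

(* The exponent (b - 1) / 2 may be negative, whence the integer power. *)
Definition gamma_ (f : nat) (D : int) : int :=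
  if (2 %| b_ f D)%Z then 1
  else (-1) ^ ((b_ f D - 1) %/ 2)%Z * gcdz f%:Z D.

Section Artin.
Variable R : realType.

Definition euler_partial (f h N : nat) : R :=
  \prod_(0 <= p < N | [&& prime p, ~~ (p %| f)%N & ~~ (p %| h)%N])
    (1 - (p%:R * (p%:R - 1))^-1).

Definition A_ (a f h : nat) : R :=
  if gcdn (gcdn (a - 1) f) h == 1%N then
    (\prod_(p <- primes (gcdn (a - 1) f)) (1 - p%:R^-1)) *
    (\prod_(p <- primes h | ~~ (p %| f)%N) (1 - (p%:R - 1)^-1)) *
    limn (euler_partial f h)
  else 0.

Definition b_denom (b : int) (h : nat) : R :=
  (\prod_(p <- primes `|b|%N | (p %| h)%N) (p%:R - 2)) *
  (\prod_(p <- primes `|b|%N | ~~ (p %| h)%N) (p%:R ^+ 2 - p%:R - 1)).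

End Artin.

(* Main.v *)
(** Fix a squarefree n and put m = lcm(f, n). Over Q(zeta_m), Kummer theory gives
    Q(zeta_f, zeta_n, g^(1/n)) the degree n / ((n, h) e), where e = 2 if n is
    even and sqrt g lies in Q(zeta_m), and e = 1 otherwise: an odd-degree root
    of g lying in a cyclotomic field is rational up to a root of unity, and
    sqrt g lies in Q(zeta_m) iff Delta divides m. The latter, as well as the
    action sigma_a (sqrt gamma) = (gamma / a) sqrt gamma, follows from an
    explicit square root of each prime discriminant in Z[zeta_p] and from the
    Frobenius congruence modulo the primes dividing a. When e = 2, one has
    Delta = gamma b* with b* == 1 mod 4 and b* | n up to sign, so that sigma_a is
    trivial on the intersection iff a == 1 mod (f, n) and (gamma / a) = 1. Hence
    phi(f) times the n-th term of the series equals
      w(n) (1 + (gamma / a) [b odd and 2 b | n])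
    for a multiplicative function w supported on squarefree numbers, and both
    sums are evaluated as Euler products. *)

Require Import Defs.
From mathcomp Require Import all_boot all_order all_algebra all_field.
From mathcomp Require Import all_classical all_reals all_analysis.
From mathcomp Require Import cyclic zify ring lra.
Set Implicit Arguments.
Unset Strict Implicit.
Unset Printing Implicit Defensive.
Import Order.TTheory GRing.Theory Num.Theory.
Import numFieldNormedType.Exports.
Local Open Scope ring_scope.

(** * Elements of cyclotomic fields *)

(** All fields are compared inside [algC]: each one embeds there, and [Qn_aut_exists] supplies, for
    every exponent prime to m, a ring morphism of the whole of [algC] raising the m-th roots of
    unity to that exponent. No Galois group is formed; an element of a cyclotomic field is rational
    as soon as all these morphisms fix it, and their effect on a square root of an integer is a
    single sign. Two definitions are less explicit than their meaning. [zeta] rests on a principal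
    root known only through the maximality of its real part, so its primitivity needs a geometric
    argument. The discriminant comes with an arbitrary integral basis, so it has to be compared with
    that of the standard one. As g is not a square, h is odd, which keeps the odd roots of g apart
    from its square root. For the limits, finite Euler products are compared with partial sums of
    the series, the error being bounded by a tail of the series of absolute values. *)

Definition Qpoly_at (z x : algC) : Prop :=
  exists P : {poly rat}, x = (map_poly ratr P).[z].

(** Z[z] is kept apart from Q(z) because the Frobenius congruence needs integral coefficients. *)
Definition Zpoly_at (z x : algC) : Prop :=
  exists P : {poly int}, x = (map_poly intr P).[z].

Lemma Zpoly_Qpoly z x : Zpoly_at z x -> Qpoly_at z x.
Proof.
case=> P ->; exists (map_poly intr P); rewrite -map_poly_comp; congr (_.[_]).
by apply: eq_map_poly => k /=; rewrite ratr_int.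
Qed.

Lemma rmorph_Qpoly (nu : {rmorphism algC -> algC}) (P : {poly rat}) z :
  nu (map_poly ratr P).[z] = (map_poly ratr P).[nu z].
Proof.
rewrite -horner_map -map_poly_comp; congr (_.[_]).
by apply: eq_map_poly => k /=; rewrite fmorph_rat.
Qed.

Lemma rmorph_Qpoly_fix (nu : {rmorphism algC -> algC}) z x :
  Qpoly_at z x -> nu z = z -> nu x = x.
Proof. by case=> P -> nuz; rewrite rmorph_Qpoly nuz. Qed.

Lemma QpolyM z x y : Qpoly_at z x -> Qpoly_at z y -> Qpoly_at z (x * y).
Proof. by case=> P -> [S ->]; exists (P * S); rewrite rmorphM hornerM. Qed.

Lemma Qpoly_ratr z k : Qpoly_at z (ratr k).
Proof. by exists k%:P; rewrite map_polyC hornerC. Qed.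

Lemma Qpoly_exp z k : Qpoly_at z (z ^+ k).
Proof. by exists 'X^k; rewrite map_polyXn hornerXn. Qed.

Lemma Qpoly_trans z y x : Qpoly_at z y -> Qpoly_at y x -> Qpoly_at z x.
Proof.
case=> P -> [S ->]; exists (S \Po P).
by rewrite map_comp_poly horner_comp.
Qed.

Lemma ZpolyM z x y : Zpoly_at z x -> Zpoly_at z y -> Zpoly_at z (x * y).
Proof. by case=> P -> [S ->]; exists (P * S); rewrite rmorphM hornerM. Qed.

Lemma Zpoly_int z (k : int) : Zpoly_at z k%:~R.
Proof. by exists k%:P; rewrite map_polyC hornerC. Qed.

Lemma Zpoly_exp z k : Zpoly_at z (z ^+ k).
Proof. by exists 'X^k; rewrite map_polyXn hornerXn. Qed.

Lemma Zpoly_trans z y x : Zpoly_at z y -> Zpoly_at y x -> Zpoly_at z x.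
Proof.
case=> P -> [S ->]; exists (S \Po P).
by rewrite map_comp_poly horner_comp.
Qed.

Lemma Qpoly_unity m z x :
  m.-primitive_root z -> x ^+ m = 1 -> Qpoly_at z x.
Proof. by move=> pz /(prim_rootP pz)[i ->]; apply: Qpoly_exp. Qed.

(* A representative P of degree < phi(m) takes the value x at all phi(m)
   conjugates of z, hence is constant. *)
Lemma Qpoly_fixed_Crat m z x :
  m.-primitive_root z -> Qpoly_at z x ->
  (forall nu : {rmorphism algC -> algC}, nu x = x) -> x \in Crat.
Proof.
move=> pz [P0 Px0] fixx.
pose Phi : {poly rat} := map_poly intr 'Phi_m.
have PhiC : map_poly ratr Phi = cyclotomic z m.
  rewrite -(Cintr_Cyclotomic pz) -map_poly_comp.
  by apply: eq_map_poly => k /=; rewrite ratr_int.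
have sPhi : size Phi = (totient m).+1.
  by rewrite -(size_map_poly (ratr : rat -> algC)) PhiC size_cyclotomic.
pose P := P0 %% Phi.
have sP : (size P <= totient m)%N.
  by rewrite -ltnS -sPhi ltn_modp -size_poly_eq0 sPhi.
have Px : x = (map_poly ratr P).[z].
  rewrite Px0 {1}(divp_eq P0 Phi) rmorphD rmorphM /= !hornerE PhiC.
  by rewrite (rootP (_ : root (cyclotomic z m) z)) ?mulr0 ?add0r // root_cyclotomic.
have : map_poly ratr P - x%:P = 0.
  apply: contraTeq (leqnn (totient m)) => nz; rewrite -ltnNge.
  have -> : (totient m).+1 = size (cyclotomic z m) by rewrite size_cyclotomic.
  suff dv : cyclotomic z m %| map_poly ratr P - x%:P.
    apply: leq_trans (dvdp_leq nz dv) _.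
    apply: leq_trans (size_polyD _ _) _; rewrite geq_max size_map_poly sP /=.
    rewrite size_polyN; apply: leq_trans (size_polyC_leq1 _) _.
    by rewrite totient_gt0 (prim_order_gt0 pz).
  rewrite /cyclotomic -big_filter.
  rewrite -(big_map (fun k : 'I_m => z ^+ k) xpredT (fun y => 'X - y%:P)).
  apply: uniq_roots_dvdp; last first.
    rewrite uniq_rootsE map_inj_in_uniq ?filter_uniq ?index_enum_uniq //.
    move=> i j _ _ /eqP; rewrite (eq_prim_root_expr pz) !modn_small // => /eqP.
    exact: val_inj.
  apply/allP=> y /mapP[k]; rewrite mem_filter => /andP[cop _] ->.
  have [nu nuP] := Qn_aut_exists cop.
  rewrite /root !hornerE -(fixx nu) {1}Px rmorph_Qpoly nuP ?subrr //.
  exact: prim_expr_order pz.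
move/eqP; rewrite subr_eq0 => /eqP PE.
have := congr1 (fun p : {poly algC} => p`_0) PE.
by rewrite coef_map coefC /= => <-; rewrite Crat_rat.
Qed.

(** The quotient is a real number of absolute value 1, and -1 is not a q-th root of 1 for odd q. *)
Lemma real_expr_odd_inj (q : nat) (x y : algC) :
  odd q -> x \is Num.real -> y \is Num.real -> x ^+ q = y ^+ q -> x = y.
Proof.
move=> oq xR yR E; have q0 : (0 < q)%N by case: (q) oq.
have [y0|y0] := eqVneq y 0.
  by move: E; rewrite y0 expr0n eqn0Ngt q0 /= => /eqP; rewrite expf_eq0 q0 => /eqP.
pose w := x / y; have wR : w \is Num.real by rewrite realM ?realV.
have wq : w ^+ q = 1 by rewrite expr_div_n E divff // expf_neq0.
have nw : `|w| = 1.
  by apply/eqP; rewrite -(pexpr_eq1 q0 (normr_ge0 _)) -normrX wq normr1.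
have /orP[/eqP w1|/eqP w1] : (w == 1) || (w == -1).
- by have := wR; rewrite realE => /orP[/ger0_norm|/ler0_norm]; rewrite nw => ->; rewrite ?opprK eqxx ?orbT.
- by rewrite -[x](divfK y0) -/w w1 mul1r.
by move: wq; rewrite w1 -signr_odd oq expr1 => /eqP; rewrite -subr_eq0 -opprD oppr_eq0 (pnatr_eq0 _ 2).
Qed.

Lemma conj_prim_root m (z : algC) : (0 < m)%N -> z ^+ m = 1 -> z^* = z^-1.
Proof.
move=> m0 zm; have nz : `|z| = 1.
  by apply/eqP; rewrite -(pexpr_eq1 m0 (normr_ge0 _)) -normrX zm normr1.
by rewrite invC_norm nz expr1n invr1 mul1r.
Qed.

Lemma Aint_root_int q y (g : int) :
  (0 < q)%N -> y ^+ q = g%:~R -> y \in Aint.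
Proof.
move=> q0 yq; apply: (@root_monic_Aint ('X^q - g%:~R%:P)).
- by rewrite /root !hornerE yq subrr.
- by rewrite monicXnsubC.
apply/polyOverP=> i; rewrite coefB coefC coefXn rpredB ?rpred_nat //.
by case: ifP => _; rewrite ?rpred_int ?rpred0.
Qed.

(* The real q-th root of g lies in the abelian field Q(z); its conjugates are
   again real, hence equal to it. *)
Lemma odd_root_cyclotomic_int m z q y (g : int) :
  m.-primitive_root z -> odd q -> (q %| m)%N ->
  Qpoly_at z y -> y ^+ q = g%:~R -> exists x : int, g = x ^+ q.
Proof.
move=> pz oq qm Qy yq; have q0 : (0 < q)%N by case: (q) oq.
have m0 := prim_order_gt0 pz.
have [g0|g0] := eqVneq g 0; first by exists 0; rewrite g0 expr0n eqn0Ngt q0.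
(* For negative g the principal q-th root is not real in general, hence the explicit sign. *)
pose y0 : algC := (-1) ^+ (g < 0)%R * q.-root `|g|%:~R.
have y0R : y0 \is Num.real.
  by rewrite realM ?rpredX ?realN ?real1 // ger0_real // rootC_ge0 // ler0z.
have y0q : y0 ^+ q = g%:~R.
  rewrite exprMn rootCK // -exprM mulnC exprM -signr_odd oq expr1.
  by rewrite [in RHS](intEsign g) rmorphM rmorph_sign /= abszE.
have wq : (y0 / y) ^+ q = 1 by rewrite expr_div_n y0q yq divff // intr_eq0.
have Qy0 : Qpoly_at z y0.
  have ynz : y != 0 by apply/eqP => E; move: yq; rewrite E expr0n eqn0Ngt q0 => /esym/eqP; rewrite intr_eq0 (negPf g0).
  rewrite -(divfK ynz y0); apply: QpolyM => //; apply: (Qpoly_unity pz).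
  by case/dvdnP: qm => k ->; rewrite mulnC exprM wq expr1n.
have fixy (nu : {rmorphism algC -> algC}) : nu y0 = y0.
  apply: (@real_expr_odd_inj q) => //; last first.
    by rewrite -rmorphXn y0q rmorph_int.
  have zm : nu z ^+ m = 1 by rewrite -rmorphXn (prim_expr_order pz) rmorph1.
  (* Conjugation inverts roots of unity, so it commutes with [nu] on Q(z). *)
  rewrite CrealE; case: Qy0 => P E; apply/eqP.
  have cP (x : algC) : ((map_poly ratr P).[x])^* = (map_poly ratr P).[x^*].
    exact: (rmorph_Qpoly Num.conj).
  rewrite {1}E rmorph_Qpoly cP (conj_prim_root m0 zm) -fmorphV.
  by rewrite -(conj_prim_root m0 (prim_expr_order pz)) -rmorph_Qpoly -cP -E (CrealP y0R).
have y0Q : y0 \in Crat := Qpoly_fixed_Crat pz Qy0 fixy.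
have y0A : y0 \in Aint := Aint_root_int q0 y0q.
have /intrP[x xE] := Cint_rat_Aint y0Q y0A.
by exists x; apply/eqP; rewrite -(eqr_int algC) -y0q xE rmorphXn.
Qed.

(** * Primitivity of zeta *)

(** The double angle formulas, with the real part written as a decrement of [a] so that it compares
    directly with [a]. *)
Lemma rotation_rect (K : comPzRingType) (i a b c s : K) :
  i ^+ 2 = -1 -> c ^+ 2 + s ^+ 2 = 1 ->
  (a + i * b) * (c + i * s) ^+ 2 =
  a - 2 * (s ^+ 2 * a + c * s * b) + i * (a * (2 * c * s) + b * (c ^+ 2 - s ^+ 2)).
Proof.
move=> i2 cs.
have -> : (a + i * b) * (c + i * s) ^+ 2 =
  a - 2 * (s ^+ 2 * a + c * s * b) + i * (a * (2 * c * s) + b * (c ^+ 2 - s ^+ 2))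
  + a * (c ^+ 2 + s ^+ 2 - 1)
  + (i ^+ 2 + 1) * (a * s ^+ 2 + 2 * b * c * s + i * b * s ^+ 2) by ring.
by rewrite i2 cs subrr mulr0 addr0 addNr mul0r addr0.
Qed.

(** This is sin(y + x) sin(y - x) = cos(x)^2 - cos(y)^2, multiplied by s^2, for a = cos x, b = sin
    x, c = cos y, s = sin y. *)
Lemma rotation_prod (K : comPzRingType) (a b c s : K) :
  a ^+ 2 + b ^+ 2 = 1 -> c ^+ 2 + s ^+ 2 = 1 ->
  s ^+ 2 * (a ^+ 2 - c ^+ 2) =
  (s ^+ 2 * a + c * s * b) * (s ^+ 2 * a - c * s * b).
Proof.
move=> ab cs.
have -> : (s ^+ 2 * a + c * s * b) * (s ^+ 2 * a - c * s * b) =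
  s ^+ 2 * (a ^+ 2 - c ^+ 2) + s ^+ 2 *
   ((c ^+ 2 + s ^+ 2 - 1) * a ^+ 2 - c ^+ 2 * (a ^+ 2 + b ^+ 2 - 1)) by ring.
by rewrite ab cs !subrr mul0r mulr0 subrr mulr0 addr0.
Qed.

(** The principal root is maximal only among roots in the upper half plane; conjugation, which fixes
    -1, brings the others there. *)
Lemma Re_rootCN1_max n (x : algC) :
  (1 < n)%N -> x ^+ n = -1 -> 'Re x <= 'Re (n.-root (-1 : algC)).
Proof.
move=> n1 xn; have n0 := ltnW n1.
have := Creal_Im x; rewrite realE => /orP[ge|le].
  exact: rootC_Re_max.
rewrite -[X in X <= _]Re_conj; apply: rootC_Re_max => //.
  by rewrite -rmorphXn xn rmorphN1.
by rewrite Im_conj oppr_ge0.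
Qed.

(* Rotating x by y ^+ 2 or its inverse would increase the real part if the
   angle of x were larger than that of y. *)
Lemma Re_rotation_max (x y : algC) :
  `|x| = 1 -> `|y| = 1 -> 'Im y != 0 ->
  'Re (x * y ^+ 2) <= 'Re x -> 'Re (x * y ^- 2) <= 'Re x -> 'Re y <= 'Re x.
Proof.
move=> nx ny s0.
have := Crect x; have := Crect y; move: s0.
have : 'Im y \is Num.real := Creal_Im y; have : 'Re y \is Num.real := Creal_Re y.
have : 'Im x \is Num.real := Creal_Im x; have : 'Re x \is Num.real := Creal_Re x.
have := normC2_Re_Im x; have := normC2_Re_Im y; rewrite nx ny expr1n.
move: ('Re x) ('Im x) ('Re y) ('Im y) => a b c s cs ab aR bR cR sR s0 yE xE.
have i2 : 'i ^+ 2 = -1 :> algC by rewrite sqrCi.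
have ycE : y^-1 = c - 'i * s.
  by rewrite invC_norm ny expr1n invr1 mul1r yE conjC_rect.
have -> : 'Re (x * y ^+ 2) = a - 2 * (s ^+ 2 * a + c * s * b).
  have -> : x * y ^+ 2 = (a - 2 * (s ^+ 2 * a + c * s * b)) + 'i * (a * (2 * c * s) + b * (c ^+ 2 - s ^+ 2)).
    by rewrite xE yE rotation_rect.
  by rewrite Re_rect // ?(realD, realM, realN, realX, realB, real1, realn).
have -> : 'Re (x * y ^- 2) = a - 2 * (s ^+ 2 * a - c * s * b).
  have -> : x * y ^- 2 = (a - 2 * (s ^+ 2 * a - c * s * b)) + 'i * (- a * (2 * c * s) + b * (c ^+ 2 - s ^+ 2)).
    rewrite -exprVn ycE xE -(mulrN 'i s) rotation_rect ?sqrrN //.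
    by rewrite !mulrN !mulNr.
  by rewrite Re_rect // ?(realD, realM, realN, realX, realB, real1, realn).
rewrite !gerBl !pmulr_rge0 ?ltr0n // => ge1 ge2.
have s2 : 0 < s ^+ 2 by rewrite lt0r sqrf_eq0 s0 -real_normK // exprn_ge0.
(* The sum of the two inequalities gives the sign of [a]; their product gives a^2 >= c^2. *)
have a0 : 0 <= a.
  have := addr_ge0 ge1 ge2; rewrite addrACA subrr addr0 -mulr2n.
  by rewrite -mulr_natr pmulr_lge0 ?ltr0n // pmulr_rge0.
have : 0 <= s ^+ 2 * (a ^+ 2 - c ^+ 2).
  have -> : s ^+ 2 * (a ^+ 2 - c ^+ 2) = (s ^+ 2 * a + c * s * b) * (s ^+ 2 * a - c * s * b) by apply: rotation_prod.
  exact: mulr_ge0.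
rewrite pmulr_rge0 // subr_ge0 -(real_normK cR) ler_pXn2r ?nnegrE // => le.
exact: le_trans (real_ler_norm cR) le.
Qed.

(** Let w be a primitive n-th root of unity and y the principal root of -1. Among the n-th roots w
    y^(2k+1) of -1, one of largest real part has the real part of y, hence equals y or its inverse.
    So w is a power of y^2 up to inversion, and y^2 has order n. *)
Lemma zeta_prim n : (0 < n)%N -> n.-primitive_root (zeta n).
Proof.
move=> n0; have [n1|n1] := leqP n 1.
  have -> : n = 1%N by apply/eqP; rewrite eqn_leq n1.
  by rewrite /zeta root1C sqrrN expr1n; apply/andP; split => //; apply/forallP => i; rewrite (ord1 i) unity_rootE expr1n eqxx.
rewrite /zeta; set y := n.-root _.
have yn : y ^+ n = -1 by rewrite rootCK.
have ny : `|y| = 1.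
  by apply/eqP; rewrite -(pexpr_eq1 n0 (normr_ge0 _)) -normrX yn normrN1.
have y0 : y != 0 by rewrite -normr_eq0 ny oner_eq0.
have [w pw] := C_prim_root_exists n0.
have wn := prim_expr_order pw.
have norm_root x : x ^+ n = -1 -> `|x| = 1.
  by move=> xn; apply/eqP; rewrite -(pexpr_eq1 n0 (normr_ge0 _)) -normrX xn normrN1.
have y2n : (y ^+ 2) ^+ n = 1 by rewrite exprAC yn sqrrN expr1n.
have [d pd dn] := prim_order_exists n0 y2n.
suff [k wk] : exists k, w * y ^+ 2 ^+ k = 1.
  have : (n %| d)%N.
    rewrite (prim_order_dvd pw); apply/eqP.
    have := congr1 (fun t => t ^+ d) wk.
    by rewrite exprMn (exprAC _ k d) (prim_expr_order pd) !expr1n mulr1.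
  by move=> nd; have <- : d = n by apply/eqP; rewrite eqn_dvd dn nd.
pose x k := w * y * y ^+ 2 ^+ k.
have xn k : x k ^+ n = -1 by rewrite /x exprMn [(w * y) ^+ n]exprMn wn yn mul1r (exprAC _ k n) y2n expr1n mulr1.
have xmod k : x (k %% n)%N = x k.
  by rewrite /x {2}(divn_eq k n) exprD (mulnC (k %/ n)%N) (exprM (y ^+ 2) n) y2n expr1n mul1r.
have [i _ imax] : extremum_spec >=%R xpredT (fun i : 'I_n => 'Re (x i)) [arg max_(i > Ordinal n0 | xpredT i) 'Re (x i)]%O.
  by apply: real_arg_maxP => // i _; apply: Creal_Re.
have kmax k : 'Re (x k) <= 'Re (x i).
  by rewrite -(xmod k); apply: (imax (Ordinal (ltn_pmod k n0))).
have xnx k : `|x k| = 1 by apply: norm_root.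
have reIm (t : algC) : `|t| = 1 -> 'Im t = 0 -> 'Re t ^+ 2 = 1.
  by move=> nt t0; have := normC2_Re_Im t; rewrite nt expr1n t0 expr0n addr0.
have ReE : 'Re (x i) = 'Re y.
  apply/eqP; rewrite eq_le Re_rootCN1_max //=.
  (* The rotation argument degenerates for real y; then y = -1, whose real part is minimal on the
     unit circle. *)
  have [s0|s0] := eqVneq ('Im y) 0.
    have /eqP : 'Re y ^+ 2 = 1 by apply: reIm.
    rewrite sqrf_eq1 => /orP[/eqP r1|/eqP ->].
      move: yn; rewrite (Crect y) s0 r1 mulr0 addr0 expr1n => /eqP.
      by rewrite -subr_eq0 opprK (pnatr_eq0 _ 2).
    have : `|'Re (x i)| <= 1.
      rewrite -(@ler_pXn2r _ 2) ?nnegrE ?normr_ge0 ?ler01 // expr1n.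
      rewrite (real_normK (Creal_Re _)) -(expr1n _ 2) -[X in _ <= X ^+ 2](xnx i).
      by rewrite normC2_Re_Im lerDl -(real_normK (Creal_Im _)) exprn_ge0.
    by rewrite (real_ler_norml _ (Creal_Re _)) => /andP[].
  apply: Re_rotation_max => //.
    have -> : x i * y ^+ 2 = x i.+1 by rewrite /x [y ^+ 2 ^+ i.+1]exprSr [RHS]mulrA.
    exact: kmax.
  have -> : x i * y ^- 2 = x (i + n.-1)%N.
    rewrite /x exprD -!mulrA; congr (_ * (_ * (_ * _))).
    by apply: (mulfI (expf_neq0 2 y0)); rewrite mulfV ?expf_neq0 // -exprS prednK.
  exact: kmax.
have ImE : 'Im (x i) ^+ 2 = 'Im y ^+ 2.
  have := normC2_Re_Im (x i); rewrite xnx -ny normC2_Re_Im ReE.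
  by move/addrI.
have /orP[/eqP E|/eqP E] : ('Im (x i) == 'Im y) || ('Im (x i) == - 'Im y).
  by rewrite -eqf_sqr ImE.
  exists i; apply: (mulIf y0); rewrite mul1r.
  by rewrite mulrAC -/(x i) (Crect (x i)) E ReE -Crect.
exists i.+1; have : x i * y = 1.
  have -> : x i = y^-1.
    rewrite invC_norm ny expr1n invr1 mul1r (Crect (x i)) E ReE mulrN.
    by rewrite -conjC_rect ?Creal_Re ?Creal_Im // -Crect.
  by rewrite mulVf.
rewrite /x [y ^+ 2 ^+ i.+1]exprSr => <-; move: (y ^+ 2 ^+ i) => t.
by rewrite expr2 !mulrA; congr (_ * _); rewrite mulrAC.
Qed.

(** * Legendre symbols and square roots of prime discriminants *)

Lemma Fp_prim_root p : prime p -> exists t : 'F_p, (p.-1).-primitive_root t.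
Proof.
move=> pp; have p1 := prime_gt1 pp.
pose rs := enum [pred x : 'F_p | x != 0].
have srs : size rs = p.-1.
  have := cardC1 (0 : 'F_p); rewrite card_Fp // => <-.
  by rewrite /rs -cardE; apply: eq_card => x.
have /hasP[t _ pt] : has (p.-1).-primitive_root rs; last by exists t.
apply: has_prim_root; rewrite ?srs ?enum_uniq //.
  by rewrite -ltnS prednK // ltnW.
apply/allP => x; rewrite mem_enum inE => x0; rewrite unity_rootE.
apply/eqP/(mulfI x0); rewrite mulr1 -exprS prednK ?prime_gt0 //.
by have := expf_card x; rewrite card_Fp.
Qed.

Lemma Fp_prim_power p (t : 'F_p) (x : int) :
  prime p -> (p.-1).-primitive_root t -> ~~ (p%:Z %| x)%Z ->
  exists k, x%:~R = t ^+ k.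
Proof.
move=> pp pt px; have p1 := prime_gt1 pp.
have x0 : (x%:~R : 'F_p) != 0 by rewrite -(dvdz_pcharf (pchar_Fp pp)).
have x1 : (x%:~R : 'F_p) ^+ p.-1 = 1.
  apply/(mulfI x0); rewrite mulr1 -exprS prednK ?prime_gt0 //.
  by have := expf_card (x%:~R : 'F_p); rewrite card_Fp.
by have [i ->] := prim_rootP pt x1; exists i.
Qed.

(** Since p - 1 is even, a discrete logarithm has a well defined parity, and it is even exactly for
    squares. *)
Lemma legendre_prim_root p (t : 'F_p) (x : int) k :
  prime p -> odd p -> (p.-1).-primitive_root t -> x%:~R = t ^+ k ->
  legendre x p = (-1) ^+ k.
Proof.
move=> pp op pt xE; have p1 := prime_gt1 pp.
have t0 : t != 0 by rewrite (prim_root_eq0 pt) -lt0n -ltnS prednK // ltnW.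
have np : ~~ (p%:Z %| x)%Z by rewrite (dvdz_pcharf (pchar_Fp pp)) xE expf_neq0.
have modE (u v : int) : (u == v %[mod p%:Z])%Z = (u%:~R == v%:~R :> 'F_p).
  by rewrite eqz_mod_dvd (dvdz_pcharf (pchar_Fp pp)) rmorphB subr_eq0.
rewrite /legendre (negPf np) -signr_odd; case: existsP => [[y]|nex].
  rewrite modE xE rmorphXn /= => /eqP E.
  have py : ~~ (p%:Z %| y%:Z)%Z.
    rewrite (dvdz_pcharf (pchar_Fp pp)); apply: contraTneq isT => y0.
    by move/eqP: E; rewrite y0 expr0n (negPf (expf_neq0 _ t0)).
  have [j yE] := Fp_prim_power pp pt py.
  move/eqP: E; rewrite yE -exprM (eq_prim_root_expr pt) => /eqP E.
  have e2 : (2 %| p.-1)%N by rewrite dvdn2 -subn1 oddB ?op // prime_gt0.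
  have : k = j * 2 %[mod 2] by rewrite -(modn_dvdm k e2) E modn_dvdm.
  by rewrite modnMl modn2 => ->.
case ok: (odd k) => //; case: nex.
have yp : (t ^+ k./2 < p)%N by have := ltn_ord (t ^+ k./2); rewrite [X in (_ < X)%N]Fp_cast.
exists (Ordinal yp); rewrite modE rmorphXn /= xE.
by rewrite -{1}(odd_double_half k) ok add0n -muln2 exprM -{1}(natr_Zp (t ^+ k./2)).
Qed.

Lemma legendre_sign p (x : int) :
  ~~ (p%:Z %| x)%Z -> legendre x p = 1 \/ legendre x p = -1.
Proof. by rewrite /legendre => /negPf->; case: ifP; [left | right]. Qed.

Lemma Euler_criterion p (x : int) :
  prime p -> odd p -> ~~ (p%:Z %| x)%Z ->
  (x ^+ (p.-1)./2 == legendre x p %[mod p%:Z])%Z.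
Proof.
move=> pp op px; have [t pt] := Fp_prim_root pp; have p1 := prime_gt1 pp.
have [k xE] := Fp_prim_power pp pt px.
rewrite (legendre_prim_root pp op pt xE).
rewrite eqz_mod_dvd (dvdz_pcharf (pchar_Fp pp)) rmorphB !rmorphXn /= rmorphN1 subr_eq0.
have hE : ((p.-1)./2 * 2 = p.-1)%N.
  by rewrite muln2 -[RHS]odd_double_half -subn1 oddB ?op // prime_gt0.
(* The square of this power is 1, and primitivity of t prevents the power itself from being 1. *)
suff -> : -1 = t ^+ (p.-1)./2 by rewrite xE -!exprM mulnC.
have : (t ^+ (p.-1)./2) ^+ 2 == 1 by rewrite -exprM hE (prim_expr_order pt).
rewrite sqrf_eq1 => /orP[|/eqP->//]; rewrite -(prim_order_dvd pt) => /dvdn_leq le.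
have p2 := odd_prime_gt2 op pp.
have h0 : (0 < (p.-1)./2)%N by lia.
by have := le h0; lia.
Qed.

(** * Squarefree numbers and the sign-normalized M* *)

Definition sqfree (n : nat) := forall p, prime p -> ~~ (p * p %| n)%N.

(** For odd M this is M* = (-1)^((M-1)/2) M, the one of M and -M that is 1 modulo 4; for an odd
    prime it is the prime discriminant. *)
Definition star (M : nat) : int := if (M %% 4 == 1)%N then M%:Z else - M%:Z.

Lemma sqfree_gt0 n : sqfree n -> (0 < n)%N.
Proof. by case: n => // /(_ 2%N isT). Qed.

Lemma sqfree_dvd m n : (m %| n)%N -> sqfree n -> sqfree m.
Proof. by move=> mn sn p pp; apply: contra (sn p pp) => /dvdn_trans->. Qed.

Lemma sqfree_coprime m n : sqfree (m * n) -> coprime m n.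
Proof.
move=> s; have := sqfree_gt0 s; rewrite muln_gt0 => /andP[m0 n0].
apply: contraT => ncop; have g1 : (1 < gcdn m n)%N.
  by rewrite ltn_neqAle eq_sym ncop gcdn_gt0 m0.
have pp := pdiv_prime g1; have := s _ pp; rewrite dvdn_mul //.
  exact: dvdn_trans (pdiv_dvd _) (dvdn_gcdl _ _).
exact: dvdn_trans (pdiv_dvd _) (dvdn_gcdr _ _).
Qed.

Lemma prime_mul_ind (P : nat -> Prop) :
  P 1%N ->
  (forall p n, prime p -> (0 < n)%N -> P n -> P (p * n)%N) ->
  forall n, (0 < n)%N -> P n.
Proof.
move=> P1 PM n; have [m] := ubnP n; elim: m n => // m IH n nm n0.
have [n1|n1] := leqP n 1; first by have -> : n = 1%N by apply/eqP; rewrite eqn_leq n1.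
have pp := pdiv_prime n1; have nE : n = (pdiv n * (n %/ pdiv n))%N by rewrite mulnC divnK ?pdiv_dvd.
have q0 : (0 < n %/ pdiv n)%N by rewrite divn_gt0 ?pdiv_gt0 // pdiv_leq.
rewrite nE; apply: PM => //; apply: IH => //.
by apply: (@leq_trans n); rewrite ?ltn_Pdiv ?prime_gt1.
Qed.

Lemma starM m n : odd m -> odd n -> star (m * n) = star m * star n.
Proof.
move=> om on; rewrite /star -modnMm.
have hm : (m %% 4 = 1 \/ m %% 4 = 3)%N by lia.
have hn : (n %% 4 = 1 \/ n %% 4 = 3)%N by lia.
by case: hm => ->; case: hn => ->; rewrite /= PoszM ?mulrNN ?mulrN ?mulNr.
Qed.

(** All three products are taken over a common range, in which a prime absent from a factor has
    exponent 0; the exponents then add up. *)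
Lemma prod_primes_logn (K : comNzRingType) (F : nat -> K) m n :
  (0 < m)%N -> (0 < n)%N ->
  \prod_(p <- primes (m * n)) F p ^+ logn p (m * n) =
  (\prod_(p <- primes m) F p ^+ logn p m) * (\prod_(p <- primes n) F p ^+ logn p n).
Proof.
move=> m0 n0.
have W k : (0 < k)%N -> (k <= m * n)%N -> \prod_(p <- primes k) F p ^+ logn p k =
    \prod_(0 <= p < (m * n).+1) F p ^+ logn p k.
  move=> k0 kN.
  rewrite [RHS](bigID (fun p => p \in primes k)) /= [X in _ * X]big1 ?mulr1; last first.
    move=> p np; have -> : logn p k = 0%N; last by rewrite expr0.
    by apply/eqP; rewrite -leqn0 leqNgt logn_gt0.
  rewrite -[RHS]big_filter; apply: perm_big; apply: uniq_perm.
  - exact: primes_uniq.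
  - by rewrite filter_uniq // iota_uniq.
  move=> p; rewrite mem_filter mem_index_iota /=.
  case pk : (p \in primes k) => //=; symmetry.
  move: pk; rewrite mem_primes k0 /= => /andP[_ /dvdn_leq] /(_ k0) pk.
  by rewrite ltnS (leq_trans pk kN).
rewrite !W ?muln_gt0 ?m0 ?n0 ?leq_pmulr ?leq_pmull // -big_split /=.
apply: eq_bigr => p _; rewrite -exprD.
by rewrite lognM.
Qed.

(** For p = 2k + 1, the number k + 1 is the inverse of 2 modulo p, so the i-th factor of S is
    z^(i/2) - z^(-i/2), with square -(1 - z^i)(1 - z^(-i)). The product over i <= k meets each
    nontrivial root of unity once, whence S^2 = (-1)^k p. *)
Lemma sqrt_star_prime p (z : algC) :
  prime p -> odd p -> p.-primitive_root z ->
  exists2 S, Zpoly_at z S & S ^+ 2 = (star p)%:~R.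
Proof.
move=> pp op pz; pose k := p./2.
have pE : p = (2 * k).+1 by rewrite -[p]odd_double_half op -muln2 mulnC.
have zp := prim_expr_order pz.
pose S : algC := \prod_(1 <= i < k.+1) (z ^+ (k.+1 * i) - z ^+ (k * i)).
exists S.
  exists (\prod_(1 <= i < k.+1) ('X^(k.+1 * i) - 'X^(k * i))).
  rewrite rmorph_prod horner_prod; apply: eq_bigr => i _.
  by rewrite rmorphB /= !map_polyXn hornerD hornerN !hornerXn.
(* Both factorizations of (X^p - 1) / (X - 1) are evaluated at 1. *)
have prodE : \prod_(1 <= i < p) (1 - z ^+ i) = p%:R.
  have := factor_Xn_sub_1 pz; rewrite big_ltn ?prime_gt0 // expr0 subrX1.
  have X1 : 'X - 1%:P != 0 :> {poly algC} by rewrite polyXsubC_eq0.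
  move/(mulfI X1)/(congr1 (fun P => P.[1])); rewrite horner_prod horner_sum.
  rewrite (eq_bigr (fun i => 1 - z ^+ i)) => [->|i _]; last by rewrite !hornerE.
  rewrite (eq_bigr (fun=> 1)) => [|i _]; last by rewrite hornerXn expr1n.
  by rewrite sumr_const card_ord.
have sq i : (0 < i < k.+1)%N -> (z ^+ (k.+1 * i) - z ^+ (k * i)) ^+ 2 =
     - ((1 - z ^+ i) * (1 - z ^+ (p - i))).
  move=> /andP[i0 ik]; have ip : (i <= p)%N by rewrite pE; lia.
  have e1 : z ^+ (k.+1 * i) ^+ 2 = z ^+ i.
    rewrite -exprM; have -> : (k.+1 * i * 2 = p * i + i)%N by rewrite pE; lia.
    by rewrite exprD exprM zp expr1n mul1r.
  have e2 : z ^+ (k * i) ^+ 2 = z ^+ (p - i).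
    rewrite -exprM; have -> : (k * i * 2 = p * i.-1 + (p - i))%N by rewrite pE; nia.
    by rewrite exprD exprM zp expr1n mul1r.
  have e3 : z ^+ (k.+1 * i) * z ^+ (k * i) = 1.
    rewrite -exprD; have -> : (k.+1 * i + k * i = p * i)%N by rewrite pE; nia.
    by rewrite exprM zp expr1n.
  have e4 : z ^+ i * z ^+ (p - i) = 1 by rewrite -exprD subnKC.
  rewrite sqrrB e1 e2 e3 mulrBl mul1r mulrBr mulr1 e4.
  by ring.
have prod2 : \prod_(1 <= i < k.+1) ((1 - z ^+ i) * (1 - z ^+ (p - i))) = p%:R.
  rewrite -prodE big_split /= [RHS](@big_cat_nat _ _ _ k.+1) //=; last by rewrite pE; lia.
  congr (_ * _); rewrite big_add1 /= big_nat_rev /= -[X in _ = \prod_(X <= _ < _) _]add0n big_addn.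
  have -> : (p - k.+1 = k)%N by rewrite pE; lia.
  by apply: eq_big_nat => i /andP[_ ik]; congr (1 - z ^+ _); rewrite pE; lia.
rewrite -prodrXl (eq_big_nat _ _ sq).
rewrite (eq_bigr (fun i => -1 * ((1 - z ^+ i) * (1 - z ^+ (p - i))))); last first.
  by move=> i _; rewrite mulN1r.
rewrite big_split /= prod2 prodr_const_nat subn1 /= -signr_odd /star.
(* The sign (-1)^k is the one in [star p]. *)
have -> : (p %% 4 == 1)%N = ~~ odd k by rewrite pE; lia.
by case: (odd k); rewrite /= ?expr1 ?expr0 ?mulN1r ?mul1r // mulrNz.
Qed.

(** * Action of automorphisms on square roots of integers *)

Definition acts_as (nu : {rmorphism algC -> algC}) (m u : nat) : Prop :=
  forall x, x ^+ m = 1 -> nu x = x ^+ u.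

Lemma acts_as_dvd nu m d u : (d %| m)%N -> acts_as nu m u -> acts_as nu d u.
Proof. by move=> /dvdnP[k ->] H x xd; apply: H; rewrite mulnC exprM xd expr1n. Qed.

Lemma acts_as_mod nu m u v : u = v %[mod m] -> acts_as nu m u -> acts_as nu m v.
Proof.
move=> E H x xm; rewrite (H _ xm).
by rewrite -(expr_mod u xm) E (expr_mod v xm).
Qed.

Lemma acts_as_exists nu m : (0 < m)%N -> exists2 u, coprime u m & acts_as nu m u.
Proof.
move=> m0; have [z pz] := C_prim_root_exists m0.
have pnz : m.-primitive_root (nu z) by rewrite fmorph_primitive_root.
have [u nuz] := prim_rootP pz (prim_expr_order pnz).
exists u => [|x /(prim_rootP pz)[i ->]]; last by rewrite rmorphXn nuz -!exprM mulnC.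
by rewrite -(prim_root_exp_coprime _ pz) -nuz.
Qed.

(** The eigenvalue does not depend on which of the two square roots is taken, so an unspecified root
    may be replaced by a product of explicit ones. *)
Lemma act_sqrt (nu : {rmorphism algC -> algC}) (e S T : algC) :
  S ^+ 2 = T ^+ 2 -> nu T = e * T -> nu S = e * S.
Proof.
move=> /eqP; rewrite eqf_sqr => /orP[/eqP->//|/eqP->] H.
by rewrite rmorphN H mulrN.
Qed.

Lemma sqrt_int_act (nu : {rmorphism algC -> algC}) S (D : int) :
  S ^+ 2 = D%:~R -> nu S = S \/ nu S = - S.
Proof.
move=> SD; have /eqP : nu S ^+ 2 = S ^+ 2 by rewrite -rmorphXn SD rmorph_int.
by rewrite eqf_sqr => /orP[/eqP|/eqP]; [left | right].
Qed.

Lemma Zpoly_sqrt z (S T : algC) : S ^+ 2 = T ^+ 2 -> Zpoly_at z T -> Zpoly_at z S.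
Proof.
move=> /eqP; rewrite eqf_sqr => /orP[/eqP->//|/eqP->] H.
by rewrite -mulN1r; apply: ZpolyM => //; apply: (Zpoly_int z (-1)).
Qed.

Lemma dvdn_prim_exp d k (z : algC) :
  (0 < d)%N -> (d * k).-primitive_root z -> d.-primitive_root (z ^+ k).
Proof.
move=> d0 pz; have := dvdn_prim_root pz (dvdn_mulr k (dvdnn d)).
by rewrite mulKn.
Qed.

Lemma sqrt_star M z (S : algC) :
  odd M -> sqfree M -> M.-primitive_root z -> S ^+ 2 = (star M)%:~R -> Zpoly_at z S.
Proof.
move=> oM sM pz SE.
suff [T ZT TE] : exists2 T, Zpoly_at z T & T ^+ 2 = (star M)%:~R.
  by apply: Zpoly_sqrt ZT; rewrite TE.
have M0 := sqfree_gt0 sM; clear S SE; move: M M0 oM sM z pz; apply: prime_mul_ind => [|p n pp n0 IH].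
  by move=> _ _ z _; exists 1; [exact: (Zpoly_int z 1) | rewrite expr1n].
rewrite oddM => /andP[op on] s z pz.
have [|T ZT TE] := sqrt_star_prime pp op (_ : p.-primitive_root (z ^+ n)).
  by apply: dvdn_prim_exp; rewrite ?prime_gt0.
have [||U ZU UE] := IH on _ (z ^+ p).
- by apply: sqfree_dvd s; apply: dvdn_mull.
- by apply: dvdn_prim_exp; rewrite // mulnC.
exists (T * U); last by rewrite exprMn TE UE starM // rmorphM.
by apply: ZpolyM; [apply: Zpoly_trans ZT | apply: Zpoly_trans ZU]; apply: Zpoly_exp.
Qed.

(** A rational root would be an integer, whose square has even p-adic valuation, while that of
    [star p] is 1. *)
Lemma sqrt_star_prime_irrational p (S : algC) :
  prime p -> S ^+ 2 = (star p)%:~R -> S \notin Crat.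
Proof.
move=> pp SE; apply/negP => SQ.
have /intrP[x xE] := Cint_rat_Aint SQ (Aint_root_int (isT : (0 < 2)%N) SE).
have : x ^+ 2 = star p by apply/eqP; rewrite -(eqr_int algC) -SE xE rmorphXn.
move/(congr1 absz); rewrite abszX /star.
have -> : `|if (p %% 4 == 1)%N then p%:Z else - p%:Z|%N = p by case: ifP; rewrite ?abszN absz_nat.
move/(congr1 (logn p)); rewrite lognX (logn_prime p pp) eqxx.
by move/(congr1 odd); rewrite oddM.
Qed.

Lemma sqfree_prime p : prime p -> sqfree p.
Proof.
move=> pp q pq; apply/negP => qp.
have qE : q = p by apply/eqP; rewrite -dvdn_prime2 // (dvdn_trans _ qp) ?dvdn_mulr.
by have := dvdn_leq (prime_gt0 pp) qp; rewrite qE; have := prime_gt1 pp; nia.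
Qed.

(** Let t generate the units modulo p. If z -> z^t fixed S, so would all its iterates, and S would
    be rational; hence it negates S. For u = t^k the sign is therefore (-1)^k, the Legendre symbol
    of u. *)
Lemma legendre_act p u nu (S : algC) :
  prime p -> odd p -> coprime u p -> acts_as nu p u -> S ^+ 2 = (star p)%:~R ->
  nu S = (legendre u%:Z p)%:~R * S.
Proof.
move=> pp op cop act SE; have p0 := prime_gt0 pp.
have sp := sqfree_prime pp.
have [z pz] := C_prim_root_exists p0.
have [P PE] := Zpoly_Qpoly (sqrt_star op sp pz SE).
have zp := prim_expr_order pz.
have [t pt] := Fp_prim_root pp.
pose T : nat := t.
have TE : T%:R = t by rewrite natr_Zp.
have actE mu v : acts_as mu p v -> mu S = (map_poly ratr P).[z ^+ v].
  by move=> H; rewrite PE rmorph_Qpoly (H _ zp).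
have powE v : coprime v p -> exists k, v%:R = t ^+ k /\ z ^+ v = z ^+ (T ^ k).
  move=> cv; have [|k kE] := Fp_prim_power pp pt (_ : ~~ (p%:Z %| v%:Z)%Z).
    by rewrite /dvdz /= -prime_coprime // coprime_sym.
  exists k; split => //; apply/eqP; rewrite (eq_prim_root_expr pz).
  have := congr1 val (kE : v%:R = _); rewrite -TE -natrX /=.
  by rewrite -!(val_Fp_nat pp) => /eqP.
have cT : coprime T p.
  rewrite coprime_sym prime_coprime //; apply/negP => dT.
  have : t == 0 by rewrite -TE -(dvdn_pcharf (pchar_Fp pp)).
  by rewrite (prim_root_eq0 pt); have := prime_gt1 pp; lia.
have [nut nutP] := Qn_aut_exists cT.
(* Used with e = 1 to refute that [nut] fixes S, and then with e = -1. *)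
have itS (e : algC) k : nut e = e -> nut S = e * S -> (map_poly ratr P).[z ^+ (T ^ k)] = e ^+ k * S.
  move=> nute nutS; elim: k => [|k IH]; first by rewrite expn0 expr1 mul1r -PE.
  have -> : z ^+ (T ^ k.+1) = nut (z ^+ (T ^ k)) by rewrite rmorphXn nutP // -exprM expnS.
  by rewrite -rmorph_Qpoly IH rmorphM rmorphXn nute nutS exprSr mulrA.
have nutS : nut S = -1 * S.
  case: (sqrt_int_act nut SE) => [nutS|->]; last by rewrite mulN1r.
  have : S \in Crat; last by rewrite (negPf (sqrt_star_prime_irrational pp SE)).
  apply: (Qpoly_fixed_Crat pz); first by exists P.
  move=> mu; have [v cv actv] := acts_as_exists mu p0.
  have [k [_ zE]] := powE v cv.
  by rewrite (actE _ _ actv) zE (itS 1 k) ?rmorph1 ?mul1r // expr1n mul1r.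
have [k [uE zE]] := powE u cop.
rewrite (@legendre_prim_root p t u%:Z k pp op pt uE) (actE _ _ act) zE (itS _ _ (rmorphN1 _) nutS).
by rewrite rmorph_sign.
Qed.

Lemma jacobiM x p n : prime p -> (0 < n)%N ->
  jacobi x (p * n) = legendre x p * jacobi x n.
Proof.
move=> pp n0; rewrite /jacobi prod_primes_logn ?(prime_gt0 pp) //.
by rewrite (primes_prime pp) big_seq1 (logn_prime p pp) eqxx expr1.
Qed.

Lemma sqrtC_exists (D : int) : exists S : algC, S ^+ 2 = D%:~R.
Proof. by exists (sqrtC D%:~R); rewrite sqrtCK. Qed.

Lemma jacobi_act M u nu (S : algC) :
  odd M -> sqfree M -> coprime u M -> acts_as nu M u -> S ^+ 2 = (star M)%:~R ->
  nu S = (jacobi u%:Z M)%:~R * S.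
Proof.
move=> oM sM; have M0 := sqfree_gt0 sM; move: M M0 oM sM S.
apply: prime_mul_ind => [|p n pp n0 IH].
  move=> _ _ S _ _ S1; apply: (@act_sqrt _ _ _ 1); first by rewrite S1 expr1n.
  by rewrite rmorph1 /jacobi /= big_nil mulr1.
rewrite oddM => /andP[op on] s S; rewrite coprimeMr => /andP[cp cn] act SE.
have [T TE] := sqrtC_exists (star p); have [U UE] := sqrtC_exists (star n).
apply: (@act_sqrt _ _ _ (T * U)).
  by rewrite exprMn TE UE SE starM // rmorphM.
rewrite rmorphM (legendre_act pp op cp _ TE) ?(IH on _ U cn _ UE).
- by rewrite jacobiM // rmorphM /= mulrACA.
- by apply: sqfree_dvd s; apply: dvdn_mull.
- by apply: acts_as_dvd act; apply: dvdn_mull.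
by apply: acts_as_dvd act; apply: dvdn_mulr.
Qed.

(** * The Frobenius congruence modulo a prime *)

Lemma eqAmod_Frobenius q (x y : algC) : prime q -> x \in Aint -> y \in Aint ->
  ((x + y) ^+ q == x ^+ q + y ^+ q %[mod q])%A.
Proof.
move=> pq Ax Ay; rewrite exprDn big_ord_recl.
case: q pq => [|q] pq //; rewrite big_ord_recr /= subn0 expr0 mulr1 bin0 mulr1n.
rewrite /bump /= add1n subnn expr0 mul1r binn mulr1n.
rewrite /eqAmod opprD addrACA subrr add0r addrK.
rewrite rpred_sum // => i _; rewrite add1n.
have /dvdnP[c ->] : (q.+1 %| 'C(q.+1, i.+1))%N by apply: prime_dvd_bin; rewrite //= ltnS ltn_ord.
rewrite mulrnA -mulr_natl -[_ \in _]/(q.+1%:R %| _)%A -eqAmod0.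
by apply: eqAmodMr0; rewrite rpredMn // rpredM ?rpredX.
Qed.

Lemma eqAmod_int_Fermat q (c : int) : prime q ->
  ((c%:~R : algC) ^+ q == c%:~R %[mod q])%A.
Proof.
move=> pq; have : (q%:Z %| c ^+ q - c)%Z.
  rewrite (dvdz_pcharf (pchar_Fp pq)) rmorphB rmorphXn /= subr_eq0.
  by have := expf_card (c%:~R : 'F_q); rewrite card_Fp // => ->.
case/dvdzP=> k kE; rewrite /eqAmod -rmorphXn -rmorphB /= kE rmorphM /=.
by rewrite -eqAmod0 eqAmodMl0 // Aint_int.
Qed.

Lemma Zpoly_Frobenius q z (P : {poly int}) : prime q -> z \in Aint ->
  ((map_poly intr P).[z] ^+ q == (map_poly intr P).[z ^+ q] %[mod q])%A.
Proof.
move=> pq Az; elim/poly_ind: P => [|P c IH].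
  by rewrite rmorph0 !horner0 expr0n eqn0Ngt prime_gt0.
have AP : (map_poly intr P).[z] \in Aint.
  rewrite horner_coef rpred_sum // => i _.
  by rewrite coef_map rpredM ?rpredX ?Aint_int.
rewrite rmorphD rmorphM /= map_polyX map_polyC /= !hornerE.
have := eqAmod_Frobenius pq (_ : (map_poly intr P).[z] * z \in Aint) (Aint_int c).
move/(_ (rpredM AP Az))/eqAmod_trans; apply.
apply: eqAmodD (eqAmod_int_Fermat c pq); rewrite exprMn.
by apply: eqAmodMr; rewrite ?rpredX.
Qed.

Lemma dvdA_int (q : nat) (k : int) : (q%:R %| (k%:~R : algC))%A -> (q%:Z %| k)%Z.
Proof.
rewrite unfold_in; case: eqP => [_|/eqP q0].
  by rewrite intr_eq0 => /eqP->.
have kQ : (k%:~R / q%:R : algC) \in Crat by rewrite rpred_div ?rpred_int ?rpred_nat.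
move=> /(Cint_rat_Aint kQ)/intrP[m mE]; apply/dvdzP; exists m.
by apply/eqP; rewrite -(eqr_int algC) rmorphM /= -mE divfK.
Qed.

(** Modulo q, nu S is congruent to S^q = D^((q-1)/2) S, hence by Euler's criterion to (D / q) S. As
    nu S = S or -S, a wrong sign would make q divide 2 D. *)
Lemma legendre_Frobenius q z (nu : {rmorphism algC -> algC}) S (D : int) :
  prime q -> odd q -> ~~ (q%:Z %| D)%Z -> z \in Aint -> Zpoly_at z S ->
  S ^+ 2 = D%:~R -> nu z = z ^+ q -> nu S = (legendre D q)%:~R * S.
Proof.
move=> pq oq qD Az [P PE] SE nuz.
have AS : S \in Aint by apply: (Aint_root_int (isT : (0 < 2)%N) SE).
have nuSE : nu S = (map_poly intr P).[z ^+ q].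
  rewrite PE -horner_map -map_poly_comp nuz; congr (_.[_]).
  by apply: eq_map_poly => k /=; rewrite rmorph_int.
have := Zpoly_Frobenius P pq Az; rewrite -PE -nuSE.
have qE : q = ((q.-1)./2 * 2).+1 by have := odd_prime_gt2 oq pq; lia.
have -> : S ^+ q = (D ^+ (q.-1)./2)%:~R * S.
  by rewrite {1}qE exprSr mulnC exprM SE rmorphXn.
move=> mod1.
have mod2 : ((D ^+ (q.-1)./2)%:~R * S == (legendre D q)%:~R * S %[mod q])%A.
  apply: eqAmodMr => //; have := Euler_criterion pq oq qD.
  rewrite eqz_mod_dvd => /dvdzP[k kE]; rewrite /eqAmod -rmorphB /= kE rmorphM /=.
  by rewrite -eqAmod0 eqAmodMl0 // Aint_int.
move: mod1; rewrite eqAmod_sym => /eqAmod_trans/(_ mod2) modS.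
have [e eE nuS] : exists2 e : int, (e = 1 \/ e = -1) & nu S = e%:~R * S.
  by case: (sqrt_int_act nu SE) => ->; [exists 1 | exists (-1)]; rewrite ?mul1r ?mulN1r; auto.
rewrite nuS; congr (_%:~R * _); apply/eqP/negPn/negP => ne.
(* Multiplying the congruence by S turns it into one between integers. *)
have : (q%:Z %| (e - legendre D q) * D)%Z.
  apply: dvdA_int; rewrite rmorphM rmorphB /= -SE expr2 mulrA.
  by have := eqAmodMr AS modS; rewrite nuS /eqAmod -!mulrBl.
rewrite !dvdzE abszM Euclid_dvdM // -!dvdzE (negPf qD) orbF.
have : `|(e - legendre D q)%R|%N = 2%N.
  by move: ne; case: (legendre_sign qD) => ->; case: eE => ->.
rewrite dvdzE => -> /dvdn_leq; have := odd_prime_gt2 oq pq; lia.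
Qed.

Lemma ZpolyD z x y : Zpoly_at z x -> Zpoly_at z y -> Zpoly_at z (x + y).
Proof. by case=> P -> [S ->]; exists (P + S); rewrite rmorphD hornerD. Qed.

(** * Fundamental discriminants *)

(** Fundamental discriminants, including 1, as a 2-part c times the product M* of the discriminants
    of the odd primes dividing M. *)
Definition fund_disc (D : int) : Prop :=
  exists c M, [/\ c \in [:: 1; -4; 8; -8], odd M, sqfree M & D = c * star M].

Lemma absz_star M : `|star M|%N = M.
Proof. by rewrite /star; case: ifP; rewrite ?abszN absz_nat. Qed.

(* The exponent 3 for c = -4, or 5 for c = +-8, is the one that moves the
   square root of c while fixing the roots of unity of order |c| / 2. *)
Definition two_exp (c : int) : nat := if c == -4 then 3 else 5.

Lemma sqrt_two_disc (c : int) (S z : algC) :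
  c \in [:: -4; 8; -8] -> `|c|%N.-primitive_root z -> S ^+ 2 = c%:~R ->
  Zpoly_at z S /\
  forall nu : {rmorphism algC -> algC}, nu z = z ^+ two_exp c -> nu S = - S.
Proof.
move=> cin pz SE.
suff [T ZT [TE actT]] : exists2 T : algC, Zpoly_at z T &
    T ^+ 2 = c%:~R /\
    forall nu : {rmorphism algC -> algC}, nu z = z ^+ two_exp c -> nu T = - T.
  split; first by apply: Zpoly_sqrt ZT; rewrite TE.
  move=> nu nuz; rewrite -mulN1r; apply: act_sqrt (_ : S ^+ 2 = T ^+ 2) _; rewrite ?TE //.
  by rewrite actT // mulN1r.
have half k : (k + k).-primitive_root z -> z ^+ k = -1.
  move=> pk; have k0 : (0 < k)%N by have := prim_order_gt0 pk; lia.
  have : (z ^+ k) ^+ 2 == 1 by rewrite -exprM muln2 -addnn (prim_expr_order pk).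
  rewrite sqrf_eq1 => /orP[|/eqP//].
  by rewrite -(prim_order_dvd pk) => /dvdn_leq; lia.
move: cin pz; rewrite !inE => /or3P[] /eqP-> pz.
- have z2 := half 2%N pz.
  (* Here z is a square root of -1, and z^3 = -z. *)
  exists (2 * z); first by apply: ZpolyM; [apply: (Zpoly_int z 2) | apply: (Zpoly_exp z 1)].
  split; first by rewrite exprMn z2 mulrN1 -natrX.
  by move=> nu nuz; rewrite rmorphM rmorph_nat nuz exprS z2 mulrN1 mulrN.
- have z4 := half 4%N pz.
  (* For an eighth root of unity z, the sum of z and its inverse z^7 squares to 2; z^5 = -z reverses
     its sign. *)
  exists (2 * (z + z ^+ 7)).
    by apply: ZpolyM (Zpoly_int z 2) (ZpolyD (Zpoly_exp z 1) (Zpoly_exp z 7)).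
  have z7 : z ^+ 7 = - z ^+ 3 by rewrite (exprD z 4 3) z4 mulN1r.
  split.
    have -> : (2 * (z + z ^+ 7)) ^+ 2 = 4 * (z ^+ 2 - 2 * z ^+ 4 + z ^+ 4 * z ^+ 2) by rewrite z7; ring.
    by rewrite z4; ring.
  move=> nu nuz; rewrite z7 !rmorphM rmorph_nat rmorphD rmorphN rmorphXn nuz.
  have -> : z ^+ two_exp 8 = - z by rewrite (exprD z 4 1) z4 mulN1r.
  by ring.
have z4 := half 4%N pz.
(* Here z + z^3 squares to 2 z^4 = -2, because z^6 = -z^2. *)
exists (2 * (z + z ^+ 3)).
  by apply: ZpolyM (Zpoly_int z 2) (ZpolyD (Zpoly_exp z 1) (Zpoly_exp z 3)).
split.
  have -> : (2 * (z + z ^+ 3)) ^+ 2 = 4 * (z ^+ 2 + 2 * z ^+ 4 + z ^+ 4 * z ^+ 2) by ring.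
  by rewrite z4; ring.
move=> nu nuz; rewrite !rmorphM rmorph_nat rmorphD rmorphXn nuz.
have -> : z ^+ two_exp (-8) = - z by rewrite (exprD z 4 1) z4 mulN1r.
by ring.
Qed.

Lemma two_disc_cases (c : int) : c \in [:: 1; -4; 8; -8] ->
  c = 1 \/ c \in [:: -4; 8; -8].
Proof. by rewrite inE => /orP[/eqP|]; auto. Qed.

Lemma coprime_two_disc (c : int) M : c \in [:: 1; -4; 8; -8] -> odd M -> coprime `|c|%N M.
Proof.
move=> cin oM; have c2 : coprime 2 M by rewrite coprime2n.
move: cin; rewrite !inE => /or4P[] /eqP->; rewrite ?coprime1n //=.
- by rewrite (coprimeXl 2 c2 : coprime 4 M).
- by rewrite (coprimeXl 3 c2 : coprime 8 M).
by rewrite (coprimeXl 3 c2 : coprime 8 M).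
Qed.

Lemma fund_disc_sqrt D z (S : algC) : fund_disc D -> `|D|%N.-primitive_root z ->
  S ^+ 2 = D%:~R -> Zpoly_at z S.
Proof.
move=> [c [M [cin oM sM DE]]]; rewrite DE abszM absz_star => pz SE.
have M0 := sqfree_gt0 sM.
have c0 : (0 < `|c|)%N by move: cin; rewrite !inE => /or4P[] /eqP->.
have [T TE] := sqrtC_exists c; have [U UE] := sqrtC_exists (star M).
apply: Zpoly_sqrt (_ : S ^+ 2 = (T * U) ^+ 2) _.
  by rewrite exprMn TE UE SE rmorphM.
apply: ZpolyM.
  apply: Zpoly_trans (Zpoly_exp z M) _.
  have pzM : `|c|%N.-primitive_root (z ^+ M) by apply: dvdn_prim_exp.
  case: (two_disc_cases cin) => [c1|cin']; last by case: (sqrt_two_disc cin' pzM TE).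
  apply: Zpoly_sqrt (Zpoly_int _ 1); by rewrite TE c1 expr1n.
apply: Zpoly_trans (Zpoly_exp z `|c|%N) _.
by apply: sqrt_star UE => //; apply: dvdn_prim_exp; rewrite // mulnC.
Qed.

Lemma kroneckerM D p n : prime p -> (0 < n)%N ->
  kronecker D (p * n)%N%:Z =
  (if p == 2%N then kronecker2 D else legendre D p) * kronecker D n%:Z.
Proof.
move=> pp n0; rewrite /kronecker !absz_nat /= !mul1r prod_primes_logn ?(prime_gt0 pp) //.
by rewrite (primes_prime pp) big_seq1 (logn_prime p pp) eqxx expr1.
Qed.

(** Both sides are multiplicative in a, so a prime exponent p suffices. For odd p the Frobenius
    congruence gives (D / p). For p = 2 the discriminant is odd, and the action computed through the
    primes of D gives (2 / |D|), which is how (D / 2) is defined. *)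
Lemma kronecker_act D a nu (S : algC) :
  fund_disc D -> (0 < a)%N -> coprime a `|D|%N -> acts_as nu `|D|%N a ->
  S ^+ 2 = D%:~R -> nu S = (kronecker D a%:Z)%:~R * S.
Proof.
move=> fD a0 cop act SE.
have D0 : (0 < `|D|)%N.
  case: fD => c [M [cin _ /sqfree_gt0 M0 ->]]; rewrite abszM absz_star muln_gt0 M0 andbT.
  by move: cin; rewrite !inE => /or4P[] /eqP->.
have [z pz] := C_prim_root_exists D0; have zD := prim_expr_order pz.
have ZS := fund_disc_sqrt fD pz SE.
have [P PE] := Zpoly_Qpoly ZS.
(* What remains concerns the value of P at z^a, without [nu], and so lends itself to induction on
   a. *)
rewrite PE rmorph_Qpoly (act _ zD) -PE; clear act.
move: a a0 cop; apply: prime_mul_ind => [|p n pp n0 IH].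
  by rewrite expr1 -PE /kronecker /= big_nil !mul1r.
rewrite coprimeMl => /andP[cp cn].
have [mu actmu] := Qn_aut_exists cp.
(* Since z^(pn) is the image of z^n under [mu], the signs for p and n multiply. *)
rewrite mulnC exprM -(actmu (z ^+ n)); last by rewrite exprAC zD expr1n.
rewrite -rmorph_Qpoly IH // rmorphM rmorph_int mulnC kroneckerM //.
rewrite [X in _ = X * _]intrM -[RHS]mulrA [RHS]mulrCA; congr (_ * _).
case: eqP => [p2|/eqP pn2].
  rewrite p2 in cp actmu; case: (fD) => c [M [cin oM sM DE]].
  have c1 : c = 1.
    case: (two_disc_cases cin) => // cin'; move: cp; rewrite DE abszM absz_star.
    by rewrite coprimeMr; move: cin'; rewrite !inE => /or3P[] /eqP->.
  have DE' : D = star M by rewrite DE c1 mul1r.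
  have -> : kronecker2 D = jacobi 2 M.
    rewrite /kronecker2 DE' absz_star; case: ifP => //.
    by rewrite dvdzE absz_star dvdn2 oM.
  rewrite DE' absz_star in cp actmu SE.
  by apply: (@jacobi_act M 2).
have op : odd p by case: (even_prime pp) => // /eqP; rewrite (negPf pn2).
apply: (@legendre_Frobenius p z) => //.
- by rewrite dvdzE /= -prime_coprime.
- exact: Aint_prim_root pz.
exact: actmu.
Qed.

Lemma act_by_crt m n u : coprime m n -> coprime u m ->
  exists nu v, [/\ acts_as nu (m * n) v, v = u %[mod m] & v = 1 %[mod n]].
Proof.
move=> cmn cu; pose v := chinese m n u 1.
have vm : v = u %[mod m] by apply: chinese_modl.
have vn : v = 1 %[mod n] by apply: chinese_modr.
have cv : coprime v (m * n).
  rewrite coprimeMr -coprime_modl vm coprime_modl cu /=.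
  by rewrite -coprime_modl vn coprime_modl coprime1n.
by have [nu act] := Qn_aut_exists cv; exists nu, v.
Qed.

Lemma sqfree_dvdn M m : sqfree M ->
  (forall p, prime p -> (p %| M)%N -> (p %| m)%N) -> (M %| m)%N.
Proof.
move=> sM; have M0 := sqfree_gt0 sM; move: M M0 sM.
apply: prime_mul_ind => [_ _|p n pp n0 IH s H]; first exact: dvd1n.
rewrite Gauss_dvd ?sqfree_coprime // H ?dvdn_mulr //=; apply: IH.
  by apply: sqfree_dvd s; apply: dvdn_mull.
by move=> q pq qn; apply: H => //; apply: dvdn_mull.
Qed.

(** If c or a prime of M fails to divide m, there is an automorphism fixing z that negates the
    square root of exactly one factor of D, hence S; but S lies in Q(z). *)
Lemma fund_disc_conductor D m z (S : algC) :
  fund_disc D -> m.-primitive_root z -> S ^+ 2 = D%:~R -> Qpoly_at z S ->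
  (`|D| %| m)%N.
Proof.
move=> [c [M [cin oM sM DE]]] pz SE QS; have m0 := prim_order_gt0 pz.
have M0 := sqfree_gt0 sM; have ccM := coprime_two_disc cin oM.
have c0 : (0 < `|c|)%N by move: cin; rewrite !inE => /or4P[] /eqP->.
have D0 : D != 0 by rewrite DE -absz_gt0 abszM absz_star muln_gt0 c0.
have S0 : S != 0.
  by rewrite -sqrf_eq0 SE intr_eq0.
have moved (T U : algC) (nu : {rmorphism algC -> algC}) : S ^+ 2 = (T * U) ^+ 2 ->
    nu z = z -> nu T = - T -> nu U = U -> False.
  move=> SE' nuz nuT nuU; have nuS : nu S = -1 * S.
    by apply: act_sqrt SE' _; rewrite rmorphM nuT nuU mulN1r mulNr.
  move/eqP: (rmorph_Qpoly_fix QS nuz); rewrite nuS mulN1r.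
  by rewrite eq_sym -addr_eq0 -mulr2n mulrn_eq0 (negPf S0).
have fixes (nu : {rmorphism algC -> algC}) k (w T : algC) :
    k.-primitive_root w -> Zpoly_at w T -> acts_as nu k 1 -> nu T = T.
  move=> pw ZT act; apply: rmorph_Qpoly_fix (Zpoly_Qpoly ZT) _.
  by rewrite (act _ (prim_expr_order pw)) expr1.
rewrite DE abszM absz_star Gauss_dvd //; apply/andP; split.
  case: (two_disc_cases cin) => [->|cin']; first exact: dvd1n.
  apply/negPn/negP => ncm.
  have [T TE] := sqrtC_exists c; have [U UE] := sqrtC_exists (star M).
  have [w pw] := C_prim_root_exists c0; have [w' pw'] := C_prim_root_exists M0.
  have [ZT actT] := sqrt_two_disc cin' pw TE.
  (* The automorphism is to be trivial on the odd part of the m-th roots of unity and on the M-th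
     ones, which contain the square root of M*. *)
  pose n := (m`_2^' * M)%N.
  have cn : coprime `|c|%N n.
    rewrite coprime_two_disc // oddM oM andbT -coprime2n.
    by rewrite (@pnat_coprime 2%N) ?part_pnat.
  have cu : coprime (two_exp c) `|c|%N.
    by move: cin'; rewrite !inE => /or3P[] /eqP->.
  have [nu [v [act v1 v2]]] := act_by_crt cn cu.
  apply: (moved T U nu).
  - by rewrite SE exprMn TE UE DE rmorphM.
  - have mE := partnC 2%N m0; rewrite p_part in mE.
    (* As |c| is a power of 2 not dividing m, the 2-part of m divides |c| / 2, modulo which
       [two_exp c] is 1. *)
    have mc : (m %| (`|c| %/ 2) * m`_2^')%N.
      rewrite -{1}mE dvdn_pmul2r ?part_gt0 //.
      move: ncm cin'; rewrite !inE => ncm /or3P[] /eqP cE; rewrite cE in ncm *.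
      - by move: ncm; rewrite (@pfactor_dvdn 2 2 m isT m0 : (4 %| m)%N = _) // -ltnNge => /(@dvdn_exp2l 2 _ 1).
      - by move: ncm; rewrite (@pfactor_dvdn 2 3 m isT m0 : (8 %| m)%N = _) // -ltnNge => /(@dvdn_exp2l 2 _ 2).
      by move: ncm; rewrite (@pfactor_dvdn 2 3 m isT m0 : (8 %| m)%N = _) // -ltnNge => /(@dvdn_exp2l 2 _ 2).
    have c2 : (`|c| %/ 2 %| `|c|)%N by move: cin'; rewrite !inE => /or3P[] /eqP->.
    have zK : z ^+ (`|c| * n) = 1.
      apply/eqP; rewrite -(prim_order_dvd pz); apply: dvdn_trans mc _.
      by apply: dvdn_mul => //; apply: dvdn_mulr.
    rewrite (act _ zK) -[RHS]expr1; apply/eqP; rewrite (eq_prim_root_expr pz).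
    apply/eqP; suff : (v == 1 %[mod (`|c| %/ 2) * m`_2^'])%N by move/eqP => E; rewrite -(modn_dvdm v mc) E modn_dvdm.
    rewrite chinese_remainder; last first.
      by apply: coprime_dvdl c2 _; apply: coprime_dvdr cn; apply: dvdn_mulr.
    rewrite -(modn_dvdm v c2) v1 modn_dvdm // -(modn_dvdm v (dvdn_mulr M (dvdnn m`_2^')%N)) v2.
    rewrite modn_dvdm ?dvdn_mulr // eqxx andbT.
    by move: cin'; rewrite !inE => /or3P[] /eqP->.
  - apply: actT; apply: (acts_as_mod v1 (acts_as_dvd _ act)); rewrite ?dvdn_mulr //.
    exact: prim_expr_order pw.
  apply: (fixes nu M w') => //; first exact: sqrt_star UE.
  have act2 : acts_as nu n 1 by apply: acts_as_mod v2 (acts_as_dvd _ act); rewrite dvdn_mull.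
  by apply: acts_as_dvd act2; rewrite dvdn_mull.
apply: sqfree_dvdn => // p pp pM; apply/negPn/negP => npm.
have op : odd p by apply: dvdn_odd pM oM.
have ME : M = (p * (M %/ p))%N by rewrite mulnC divnK.
set N := (M %/ p)%N in ME.
have oN : odd N by move: oM; rewrite ME oddM => /andP[].
have sN : sqfree N by apply: sqfree_dvd sM; rewrite ME dvdn_mull.
have N0 := sqfree_gt0 sN.
have [T TE] := sqrtC_exists (star p); have [U UE] := sqrtC_exists (c * star N).
have [w pw] := C_prim_root_exists (prime_gt0 pp).
have fN : fund_disc (c * star N) by exists c, N.
have cN0 : (0 < `|c| * N)%N by rewrite muln_gt0 c0.
have [w' pw'] := C_prim_root_exists cN0.
have ZT := sqrt_star op (sqfree_prime pp) pw TE.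
(* Irrationality yields some automorphism negating T; only its exponent modulo p is kept, and the
   others are made trivial by the Chinese remainder theorem. *)
have [nu0 nu0T] : exists nu : {rmorphism algC -> algC}, nu T = - T.
  apply: contrapT => nex; have := sqrt_star_prime_irrational pp TE; case/negP.
  apply: (Qpoly_fixed_Crat pw (Zpoly_Qpoly ZT)) => nu.
  by case: (sqrt_int_act nu TE) => // E; case: nex; exists nu.
have [u cu act0] := acts_as_exists nu0 (prime_gt0 pp).
have cpn : coprime p (m * (`|c| * N)).
  rewrite !coprimeMr prime_coprime // npm /=.
  rewrite coprime_sym coprime_two_disc //=.
  by apply: sqfree_coprime; rewrite -ME.
have [nu [v [act v1 v2]]] := act_by_crt cpn cu.
have act1 : acts_as nu p u by apply: acts_as_mod v1 (acts_as_dvd _ act); rewrite dvdn_mulr.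
have act2 : acts_as nu (m * (`|c| * N)) 1.
  by apply: acts_as_mod v2 (acts_as_dvd _ act); rewrite dvdn_mull.
apply: (moved T U nu).
- rewrite SE exprMn TE UE DE ME starM // !rmorphM /=.
  by rewrite mulrCA.
- rewrite (_ : nu z = z ^+ 1) ?expr1 //; apply: act2.
  by rewrite exprM (prim_expr_order pz) expr1n.
- have [P PE] := Zpoly_Qpoly ZT; rewrite -nu0T PE !rmorph_Qpoly.
  by rewrite act1 ?act0 // (prim_expr_order pw).
apply: (fixes nu (`|c| * N)%N w') => //.
  by apply: (fund_disc_sqrt fN) => //; rewrite abszM absz_star.
by apply: acts_as_dvd act2; apply: dvdn_mull.
Qed.

(** * The discriminant of a quadratic field *)

Lemma not_sqfreeP n : ~ sqfree n -> exists2 p, prime p & (p * p %| n)%N.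
Proof.
move=> ns; apply: contrapT => H; apply: ns => p pp; apply/negP => d.
by apply: H; exists p.
Qed.

Lemma int_sqfree_part (g : int) : g != 0 ->
  exists m s : int, [/\ s != 0, g = m * s ^+ 2 & sqfree `|m|%N].
Proof.
have [n] := ubnP `|g|%N; elim: n g => // n IH g gn g0.
have [sq|/not_sqfreeP[p pp d]] := pselect (sqfree `|g|%N).
  by exists g, 1; rewrite expr1n mulr1.
have /dvdzP[k kE] : ((p%:Z) ^+ 2 %| g)%Z by rewrite dvdzE abszX absz_nat expnS expn1.
have k0 : k != 0 by apply: contraNneq g0 => k0; rewrite kE k0 mul0r.
have p1 := prime_gt1 pp.
have [|m [s [s0 E sm]]] := IH k _ k0.
  move: gn; rewrite kE abszM abszX absz_nat => gn.
  have k0' : (0 < `|k|)%N by rewrite absz_gt0.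
  by rewrite ltnS in gn; apply: (leq_trans _ gn); rewrite ltn_Pmulr //; nia.
exists m, (s * p%:Z); split => //; first by rewrite mulf_neq0 // eqz_nat -lt0n prime_gt0.
by rewrite kE E; ring.
Qed.

Lemma sqfree_mul_sqr (m k D : int) : sqfree `|m|%N -> m = k ^+ 2 * D -> k ^+ 2 = 1.
Proof.
move=> sm mE; have [k1|k1] := leqP `|k|%N 1.
  have : k != 0 by apply: contraTneq (sqfree_gt0 sm) => k0; rewrite mE k0 mul0r.
  by case: k k1 {mE} => [[|[|]]|[|]].
have := sm _ (pdiv_prime k1); rewrite mE abszM abszX expnS expn1 dvdn_mulr //.
by rewrite dvdn_mul ?pdiv_dvd.
Qed.

Definition field_disc (m : int) : int := if (m == 1 %[mod 4])%Z then m else 4 * m.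

Lemma fund_field_disc (m : int) : sqfree `|m|%N -> fund_disc (field_disc m).
Proof.
move=> sm; have := sqfree_gt0 sm; rewrite absz_gt0 => m0.
have n4 := sm 2%N isT.
have [om|em] := boolP (odd `|m|%N).
  exists (if (m == 1 %[mod 4])%Z then 1 else -4), `|m|%N; split => //; first by case: ifP.
  by rewrite /field_disc /star; case: ifP; case: ifP; lia.
have mE : `|m|%N = (2 * `|m|./2)%N by lia.
(* The sign of c combines that of m with the one introduced by [star]. *)
exists (8 * sgz m * (if (`|m|./2 %% 4 == 1)%N then 1 else -1)), `|m|./2; split.
- by case: ifP => _; case: (sgzP m) m0.
- by apply: contraT => e; move: n4; rewrite mE; lia.
- by apply: sqfree_dvd sm; rewrite {2}mE dvdn_mull.
rewrite /field_disc /star.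
by case: ifP; case: ifP; case: (sgzP m) m0 => //; lia.
Qed.

(** An off-diagonal entry of M^2 is y (x + t) = 0, and y = 0 would give m = x^2. The size is a
    variable because the dimension of the field reduces to 2 only by a proof. *)
Lemma mx2_trace0 (F : fieldType) d (M : 'M[F]_d) (m : F) :
  d = 2%N -> M *m M = m%:M -> (forall x, x ^+ 2 != m) -> \tr M = 0.
Proof.
move=> d2; move: M; rewrite d2 => M ME nsq.
pose i1 : 'I_2 := lift ord0 ord0.
have := congr1 (fun A : 'M[F]_2 => A ord0 i1) ME.
have := congr1 (fun A : 'M[F]_2 => A ord0 ord0) ME.
rewrite /mxtrace !mxE !big_ord_recl !big_ord0 !addr0 -/i1 /= mulr1n mulr0n.
move: (M ord0 ord0) (M ord0 i1) (M i1 ord0) (M i1 i1) => x y z t E1 /eqP E2.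
have : y * (x + t) == 0 by rewrite mulrDr (mulrC y x).
rewrite mulf_eq0 => /orP[/eqP y0|/eqP//].
by move: (nsq x); rewrite -E1 y0 mul0r addr0 expr2 eqxx.
Qed.

Lemma det_mx2 (F : comPzRingType) (A : 'M[F]_2) (i1 := lift ord0 ord0 : 'I_2) :
  \det A = A ord0 ord0 * A i1 i1 - A ord0 i1 * A i1 ord0.
Proof.
rewrite (expand_det_row _ ord0) !big_ord_recl big_ord0 addr0 /cofactor !det_mx11 !mxE.
have -> : lift ord0 0 = i1 by apply: val_inj.
have -> : lift (lift ord0 ord0) 0 = ord0 :> 'I_2 by apply: val_inj.
by rewrite /= -/i1 expr0 expr1 mul1r mulN1r mulrN.
Qed.

Lemma sqr_rat_int (x : rat) (m : int) : x ^+ 2 = m%:~R -> exists k : int, m = k ^+ 2.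
Proof.
move=> xm; have : (ratr x : algC) \in Aint.
  by apply: (@Aint_root_int 2 _ m) => //; rewrite -rmorphXn xm /= ratr_int.
move/(Cint_rat_Aint (Crat_rat x))/intrP=> [k kE]; exists k; apply/eqP.
have xk : x = k%:~R by apply: (fmorph_inj (ratr : {rmorphism rat -> algC})); rewrite /= kE ratr_int.
by rewrite -(eqr_int rat) rmorphXn -xm xk.
Qed.

Section QuadraticField.
Variables (K : fieldExtType rat) (iota : {rmorphism K -> algC}).
Variables (eta : K) (m : int).
Hypotheses (eta2 : eta ^+ 2 = m%:~R) (genK : <<1; eta>>%VS = fullv).
Hypothesis m_nsq : ~ exists k : int, m = k ^+ 2.

Let crd (a b : rat) : K := a%:A + b%:A * eta.

Lemma in_alg_int (k : int) : k%:~R%:A = k%:~R :> K.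
Proof. exact: (rmorph_int (GRing.in_alg K)). Qed.

Lemma in_algM (a b : rat) : (a * b)%:A = a%:A * b%:A :> K.
Proof. by rewrite mulr_algl scalerA. Qed.

Lemma quad_not_rat : eta \notin 1%VS.
Proof.
apply/negP => /vlineP[k kE]; apply: m_nsq; apply: (@sqr_rat_int k).
apply: (fmorph_inj (GRing.in_alg K)).
by rewrite rmorphXn /= -kE eta2 in_alg_int.
Qed.

Lemma quad_crd x : exists a b, x = crd a b.
Proof.
have : x \in <<1; eta>>%VS by rewrite genK memvf.
case/Fadjoin1_polyP => p ->; elim/poly_ind: p => [|p c [a [b IH]]].
  by exists 0, 0; rewrite rmorph0 horner0 /crd !scale0r mul0r addr0.
exists (b * m%:~R + c), a.
rewrite rmorphD rmorphM /= map_polyX map_polyC !hornerE IH /= /crd.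
rewrite scalerDl -scalerA in_alg_int -eta2 -[b *: eta ^+ 2]mulr_algl.
by move: (a%:A) (b%:A) (c%:A) => A B C; ring.
Qed.

Lemma quad_crd_inj a b a' b' : crd a b = crd a' b' -> a = a' /\ b = b'.
Proof.
move=> E; have [bb|bb] := eqVneq b b'.
  by move: E; rewrite /crd bb => /addIr/(fmorph_inj (GRing.in_alg K)).
case/negP: quad_not_rat; apply/vlineP; exists ((a' - a) / (b - b')).
have := fmorph_div (GRing.in_alg K) (a' - a) (b - b'); rewrite /= => ->.
rewrite !scalerBl.
have nz : b%:A - b'%:A != 0 :> K by rewrite -scalerBl scaler_eq0 oner_eq0 orbF subr_eq0.
apply: (mulIf nz); rewrite divfK //.
have -> : a'%:A = a%:A + b%:A * eta - b'%:A * eta :> K.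
  by rewrite -/(crd a b) E /crd addrK.
by move: (a%:A) (b%:A) (b'%:A) => A B C; ring.
Qed.

Lemma quad_dim : \dim {:K} = 2%N.
Proof.
rewrite -genK dim_Fadjoin dimv1 muln1.
have : (adjoin_degree 1 eta != 1)%N by rewrite adjoin_deg_eq1 quad_not_rat.
have : (adjoin_degree 1 eta <= 2)%N.
  rewrite -ltnS -size_minPoly.
  have P0 : 'X^2 - m%:~R%:P != 0 :> {poly K} by rewrite monic_neq0 ?monicXnsubC.
  have -> : 3%N = size ('X^2 - m%:~R%:P : {poly K}) by rewrite size_XnsubC.
  apply: dvdp_leq => //; apply: minPoly_dvdp.
    by rewrite rpredB ?rpredX ?polyOverX // polyOverC rpred_int.
  by rewrite /root !hornerE eta2 subrr.
have : (0 < adjoin_degree 1 eta)%N by [].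
by case: (adjoin_degree 1 eta) => [|[|[|]]].
Qed.

(** The basis [vbasis] is not explicit, so the trace of [eta] is deduced from the fact that its
    multiplication matrix squares to the scalar m. *)
Lemma quad_trace a b : field_trace (crd a b) = 2 * a.
Proof.
rewrite /field_trace; set e := vbasis {:K}.
have be : basis_of fullv e := vbasisP _.
have -> : crd a b = a *: 1 + b *: eta by rewrite /crd mulr_algl.
have -> : amull (a *: 1 + b *: eta) = a *: \1%VF + b *: amull eta.
  by apply/lfunP => x; rewrite !lfunE /= !lfunE /= !lfunE /= mulrDl -!scalerAl mul1r.
have mZ k u : passmx.mxof e e (k *: u) = k *: passmx.mxof e e u.
  rewrite -[k *: u]addr0 passmx.mxof_linear.
  have /eqP m0 : passmx.mxof e e 0 == 0 by rewrite passmx.mxof_eq0.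
  by rewrite m0 addr0.
rewrite passmx.mxof_linear mZ passmx.mxof1 ?(basis_free be) //.
rewrite mxtraceD !mxtraceZ mxtrace1 (@mx2_trace0 _ _ _ m%:~R quad_dim).
- by rewrite mulr0 addr0 quad_dim mulrC.
- rewrite -passmx.mxof_comp //.
  have -> : (amull eta \o amull eta)%VF = m%:~R *: \1%VF.
    apply/lfunP => x; rewrite !lfunE /= !lfunE /= mulrA -expr2 eta2.
    by rewrite -mulr_algl in_alg_int.
  by rewrite mZ passmx.mxof1 ?(basis_free be) // scalemx1.
by move=> x; apply/eqP => /sqr_rat_int.
Qed.

Lemma Aint_ratr_int (q : rat) : (ratr q : algC) \in Aint -> exists k : int, q = k%:~R.
Proof.
move/(Cint_rat_Aint (Crat_rat q))/intrP=> [k kE]; exists k.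
by apply: (fmorph_inj (ratr : {rmorphism rat -> algC})); rewrite /= kE ratr_int.
Qed.

Lemma iota_crd a b : iota (crd a b) = ratr a + ratr b * iota eta.
Proof. by rewrite rmorphD rmorphM !rmorphZ_num rmorph1 !mulr1. Qed.

Hypothesis m_sqf : sqfree `|m|%N.

Lemma iota_eta2 : iota eta ^+ 2 = m%:~R.
Proof. by rewrite -rmorphXn eta2 rmorph_int. Qed.

(** A multiple of [iota eta] squares to a fundamental discriminant and so lies in a cyclotomic
    field; if every automorphism fixed it, m would be a rational square. *)
Lemma quad_conjugation : exists nu : {rmorphism algC -> algC}, nu (iota eta) = - iota eta.
Proof.
apply: contrapT => nex; apply: m_nsq.
have fixS (nu : {rmorphism algC -> algC}) : nu (iota eta) = iota eta.
  by case: (sqrt_int_act nu iota_eta2) => // E; case: nex; exists nu.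
have fD := fund_field_disc m_sqf.
have [k k0 kE] : exists2 k : int, k != 0 & (k%:~R * iota eta) ^+ 2 = (field_disc m)%:~R.
  rewrite /field_disc; case: ifP => _; [exists 1 | exists 2] => //.
    by rewrite mul1r iota_eta2.
  by rewrite exprMn iota_eta2 -rmorphXn -rmorphM.
have D0 : (0 < `|field_disc m|)%N.
  have m0 : m != 0 by rewrite -absz_gt0 sqfree_gt0.
  by rewrite absz_gt0 /field_disc; case: ifP => // _; rewrite mulf_neq0.
have [z pz] := C_prim_root_exists D0.
have SQ : k%:~R * iota eta \in Crat.
  apply: (Qpoly_fixed_Crat pz (Zpoly_Qpoly (fund_disc_sqrt fD pz kE))) => nu.
  by rewrite rmorphM rmorph_int fixS.
have /CratP[x xE] : iota eta \in Crat.
  rewrite -[iota eta](mulKf (_ : k%:~R != 0)) ?intr_eq0 //.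
  by rewrite rpredM // rpredV rpred_int.
apply: (@sqr_rat_int x); apply: (fmorph_inj (ratr : {rmorphism rat -> algC})).
by rewrite rmorphXn /= -xE iota_eta2 ratr_int.
Qed.

(** This is the second element of the standard integral basis; 4 m y^2 is the discriminant of the
    basis 1, x + y eta. *)
Lemma quad_omega : exists x y : rat,
  integralOver (intr : int -> K) (crd x y) /\ 4 * m%:~R * y ^+ 2 = (field_disc m)%:~R.
Proof.
rewrite /field_disc; case: ifP => [/eqP m4|_].
  exists (1 / 2), (1 / 2); split; last by field.
  have [k mE] : exists k : int, m = 4 * k + 1 by exists (m %/ 4)%Z; lia.
  (* The polynomial of (1 + eta) / 2 when m = 4 k + 1. *)
  exists ('X^2 - 'X - k%:P).
    rewrite monicE -addrA lead_coefDl ?lead_coefXn // size_polyXn.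
    rewrite -opprD size_polyN; apply: leq_ltn_trans (size_polyD _ _) _.
    by rewrite size_polyX gtn_max /= ltnS (leq_trans (size_polyC_leq1 _)).
  rewrite /root !rmorphB /= map_polyXn map_polyX map_polyC /= !hornerE.
  have h2 : 2 * ((1 / 2 : rat)%:A) = 1 :> K.
    have -> : 2 = (2 : rat)%:A :> K by exact: esym (in_alg_int (Posz 2)).
    by rewrite -(rmorphM (GRing.in_alg K)) /= (_ : 2 * (1 / 2) = 1) ?scale1r //; field.
  have k4 : 4 != 0 :> K.
    have -> : 4 = (4 : rat)%:A :> K by exact: esym (in_alg_int (Posz 4)).
    by rewrite scaler_eq0 oner_eq0.
  have kE : 4 * k%:~R = eta ^+ 2 - 1 :> K by rewrite eta2 mE rmorphD rmorphM /= addrK.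
  apply/eqP; apply: (mulfI k4); rewrite mulr0 /crd.
  move: h2 kE; move: ((1 / 2)%:A) (k%:~R : K) => H k' h2 kE.
  have -> : 4 * ((H + H * eta) ^+ 2 - (H + H * eta) - k') =
    (2 * H * (1 + eta)) ^+ 2 - 2 * (2 * H) * (1 + eta) - 4 * k' by ring.
  by rewrite h2 kE; ring.
exists 0, 1; split; last by rewrite expr1n mulr1 rmorphM.
exists ('X^2 - m%:P); first by rewrite monicXnsubC.
rewrite /root rmorphB /= map_polyXn map_polyC /= !hornerE /crd.
by rewrite scale0r scale1r add0r mul1r eta2 subrr.
Qed.

Lemma integral_Aint x : integralOver (intr : int -> K) x -> iota x \in Aint.
Proof.
case=> p mp rp; apply: (@root_monic_Aint (map_poly intr p)).
- move: rp; rewrite -(fmorph_root iota) -map_poly_comp.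
  by rewrite (eq_map_poly (_ : iota \o intr =1 intr)) // => k; rewrite /= rmorph_int.
- by rewrite monic_map.
by apply/polyOverP => i; rewrite coef_map rpred_int.
Qed.

(** Expressing 1 and the element of [quad_omega] in the given basis yields [field_disc m] = k^2 D
    with k an integral determinant. Squarefreeness of m excludes odd primes from k; an even k would
    make D equal to m, against Stickelberger's congruence. *)
Lemma quad_discriminant D : is_discriminant K D -> D = field_disc m.
Proof.
case=> w [bw intw] DE.
have [w0 [w1 [I0 I1 gen DE']]] : exists w0 w1 : K,
   [/\ integralOver (intr : int -> K) w0, integralOver (intr : int -> K) w1,
     (forall x, integralOver (intr : int -> K) x -> exists c0 c1 : int, x = w0 *~ c0 + w1 *~ c1) &
     D%:~R = field_trace (w0 * w0) * field_trace (w1 * w1) - field_trace (w0 * w1) * field_trace (w1 * w0)].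
  move: w {bw} intw DE; rewrite quad_dim => w intw DE.
  pose i1 : 'I_2 := lift ord0 ord0.
  have gen c : \sum_i tnth w i *~ c i = tnth w ord0 *~ c ord0 + tnth w i1 *~ c i1.
    by rewrite !big_ord_recl big_ord0 addr0.
  exists (tnth w ord0), (tnth w i1); split.
  - by apply/intw; exists (fun i => (i == ord0)%:Z); rewrite gen /= addr0.
  - by apply/intw; exists (fun i => (i == i1)%:Z); rewrite gen /= add0r.
  - by move=> x /intw[c ->]; exists (c ord0), (c i1); rewrite gen.
  by rewrite DE det_mx2 !mxE.
have [nu nuS] := quad_conjugation.
have [a0 [b0 E0]] := quad_crd w0; have [a1 [b1 E1]] := quad_crd w1.
have mulcrd a b a' b' : crd a b * crd a' b' = crd (a * a' + m%:~R * (b * b')) (a * b' + a' * b).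
  rewrite /crd !scalerDl !in_algM in_alg_int -eta2.
  by move: (a%:A) (b%:A) (a'%:A) (b'%:A) => A B A' B'; ring.
have tr a b a' b' : field_trace (crd a b * crd a' b') = 2 * (a * a' + m%:~R * (b * b')).
  by rewrite mulcrd quad_trace.
have DQ : D%:~R = 4 * m%:~R * (a0 * b1 - a1 * b0) ^+ 2 :> rat.
  by rewrite DE' E0 E1 !tr; ring.
have A0 := integral_Aint I0; have A1 := integral_Aint I1.
have nuE a b : nu (iota (crd a b)) = ratr a - ratr b * iota eta.
  by rewrite iota_crd rmorphD [nu (_ * iota eta)]rmorphM !fmorph_rat nuS mulrN.
have B0 : nu (iota w0) \in Aint by rewrite Aint_aut.
have B1 : nu (iota w1) \in Aint by rewrite Aint_aut.
have S2 := iota_eta2.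
(* T is the trace of w0 times the conjugate of w1, and D is the square of w0 w1' - w0' w1, that is
   T^2 minus four times the two norms. *)
have [T TE] : exists T : int, 2 * (a0 * a1 - m%:~R * (b0 * b1)) = T%:~R.
  apply: Aint_ratr_int.
  have -> : ratr (2 * (a0 * a1 - m%:~R * (b0 * b1))) =
      iota w0 * nu (iota w1) + nu (iota w0) * iota w1.
    rewrite E0 E1 !nuE !iota_crd !(rmorphM, rmorphB, rmorph_nat) /= ratr_int -S2.
    by move: (ratr a0) (ratr b0) (ratr a1) (ratr b1) (iota eta) => x y z t u; ring.
  by rewrite rpredD ?rpredM.
have NE a b : iota (crd a b) \in Aint -> exists N : int, a ^+ 2 - m%:~R * b ^+ 2 = N%:~R.
  move=> AX; apply: Aint_ratr_int.
  have -> : ratr (a ^+ 2 - m%:~R * b ^+ 2) = iota (crd a b) * nu (iota (crd a b)).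
    rewrite nuE iota_crd !(rmorphM, rmorphB, rmorphXn) /= ratr_int -S2.
    by move: (ratr a) (ratr b) (iota eta) => x y u; ring.
  by rewrite rpredM // Aint_aut.
have [N0 N0E] : exists N : int, a0 ^+ 2 - m%:~R * b0 ^+ 2 = N%:~R by apply: NE; rewrite -E0.
have [N1 N1E] : exists N : int, a1 ^+ 2 - m%:~R * b1 ^+ 2 = N%:~R by apply: NE; rewrite -E1.
have D4 : D = T ^+ 2 - 4 * (N0 * N1).
  apply/eqP; rewrite -(eqr_int rat) DQ rmorphB rmorphXn !rmorphM /= -TE -N0E -N1E.
  by apply/eqP; ring.
have [x [y [Iw yE]]] := quad_omega.
have [c0 [c1 cE]] := gen 1 (integral1 _).
have [d0 [d1 dE]] := gen _ Iw.
have lin (e0 e1 : int) : w0 *~ e0 + w1 *~ e1 = crd (e0%:~R * a0 + e1%:~R * a1) (e0%:~R * b0 + e1%:~R * b1).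
  rewrite E0 E1 -!(mulrzl (crd _ _)) /crd !scalerDl !in_algM !in_alg_int.
  by move: (a0%:A) (b0%:A) (a1%:A) (b1%:A) (e0%:~R : K) (e1%:~R : K) => A B A' B' e e'; ring.
have c1E : 1 = crd 1 0 by rewrite /crd scale0r mul0r addr0 scale1r.
move: cE dE; rewrite !lin c1E => /quad_crd_inj[cE1 cE2] /quad_crd_inj[dE1 dE2].
have kE : field_disc m = (c0 * d1 - c1 * d0) ^+ 2 * D.
  apply/eqP; rewrite -(eqr_int rat) -yE rmorphM rmorphXn rmorphB !rmorphM /= DQ.
  have -> : y = (c0%:~R * d1%:~R - c1%:~R * d0%:~R) * (a0 * b1 - a1 * b0).
    have -> : (c0%:~R * d1%:~R - c1%:~R * d0%:~R) * (a0 * b1 - a1 * b0) =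
      (c0%:~R * a0 + c1%:~R * a1) * (d0%:~R * b0 + d1%:~R * b1) -
      (c0%:~R * b0 + c1%:~R * b1) * (d0%:~R * a0 + d1%:~R * a1) by ring.
    by rewrite -cE1 -cE2 -dE2 mul1r mul0r subr0.
  by apply/eqP; ring.
move: (c0 * d1 - c1 * d0) kE => k; rewrite /field_disc; case: ifP => [_|m4] kE.
  by have k1 := sqfree_mul_sqr m_sqf kE; rewrite kE k1 mul1r.
have [k2|k2] := boolP (2 %| k)%Z.
  case/dvdzP: k2 => l lE; have mE : m = l ^+ 2 * D.
    have : 4 * m = 4 * (l ^+ 2 * D) by rewrite kE lE; ring.
    by move/(mulfI (isT : 4 != 0 :> int)).
  have l1 := sqfree_mul_sqr m_sqf mE; move: mE; rewrite l1 mul1r => mE.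
  have n4 := m_sqf (isT : prime 2).
  (* Squares are 0 or 1 modulo 4, hence so is D = m; but m is neither, being squarefree and not 1
     modulo 4. *)
  have [u uE] : exists u : int, T ^+ 2 = 4 * u \/ T ^+ 2 = 4 * u + 1.
    have [t [tE|tE]] : exists t : int, T = 2 * t \/ T = 2 * t + 1.
    - by exists (T %/ 2)%Z; lia.
    - by exists (t ^+ 2); left; rewrite tE; ring.
    by exists (t ^+ 2 + t); right; rewrite tE; ring.
  by exfalso; move: (N0 * N1) D4 => N D4; rewrite mE in n4 m4; move: (T ^+ 2) uE D4 => T2; lia.
suff k1 : k ^+ 2 = 1 by rewrite kE k1 mul1r.
have [k1|k1] := leqP `|k|%N 1.
  by case: k k1 k2 {kE} => [[|[|]]|[|]].
have pp := pdiv_prime k1; set p := pdiv _ in pp.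
have pk : (p %| `|k|)%N by apply: pdiv_dvd.
have : (p * p %| 4 * `|m|)%N.
  have -> : (4 * `|m| = `|k| * `|k| * `|D|)%N by rewrite -!abszM -expr2 -kE abszM.
  by rewrite dvdn_mulr // dvdn_mul.
have op : odd p.
  case: (even_prime pp) => // p2; move: k2.
  by move: pk; rewrite p2 => pk; rewrite dvdzE -[`|2|%N]/2%N pk.
rewrite Gauss_dvdr ?(negPf (m_sqf pp)) //.
have c2 : coprime p 2 by rewrite coprimen2.
by rewrite coprimeMl andbb (coprimeXr 2 c2 : coprime p 4).
Qed.

End QuadraticField.

(** The proof retains nothing else of [Delta]: its shape, and its class modulo squares. *)
Lemma quad_field_disc (g Delta : int) :
  ~ (exists x : int, g = x ^+ 2) -> is_discriminant (quad_field g) Delta ->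
  fund_disc Delta /\
  exists s t : int, [/\ s != 0, t != 0 & g * s ^+ 2 = Delta * t ^+ 2].
Proof.
move=> gns; have g0 : g != 0 by apply/eqP => g0; apply: gns; exists 0; rewrite g0 expr0n.
have [m [s [s0 gE sm]]] := int_sqfree_part g0.
have mns : ~ exists k : int, m = k ^+ 2.
  by case=> k kE; apply: gns; exists (k * s); rewrite gE kE exprMn.
rewrite /quad_field /Qadj; case: num_field_exists => K [iota [th0 thE genK]] /= Dd.
case: th0 thE genK => [|th [|? ?]] //= [thE]; rewrite adjoin_seq1 => genK.
pose eta : K := th / s%:~R.
have sK : s%:~R != 0 :> K by rewrite -(fmorph_eq0 iota) rmorph_int intr_eq0.
have th2 : th ^+ 2 = g%:~R.
  by apply: (fmorph_inj iota); rewrite rmorphXn thE sqrtCK rmorph_int.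
have eta2 : eta ^+ 2 = m%:~R.
  by rewrite expr_div_n th2 gE rmorphM rmorphXn /= mulfK // expf_neq0.
have genE : <<1; eta>>%VS = fullv.
  apply/eqP; rewrite eqEsubv subvf -genK; apply/FadjoinP; split; first exact: sub1v.
  have -> : th = s%:~R * eta by rewrite mulrC divfK.
  by rewrite rpredM ?memv_adjoin // rpred_int.
have -> : Delta = field_disc m := quad_discriminant iota eta2 genE mns sm Dd.
split; first exact: fund_field_disc.
rewrite /field_disc; case: ifP => _.
  by exists 1, s; split => //; rewrite expr1n mulr1 gE.
by exists 2, s; split => //; rewrite gE; ring.
Qed.

(** * Kummer extensions of cyclotomic fields *)

Lemma rat_root_int q (x : rat) (m : int) : (0 < q)%N -> x ^+ q = m%:~R ->
  exists k : int, x = k%:~R.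
Proof.
move=> q0 xm; apply: Aint_ratr_int; apply: (@Aint_root_int q _ m) => //.
by rewrite -rmorphXn xm /= ratr_int.
Qed.

(* With u q = v h + 1, the rational number w = y ^ u / x ^ v satisfies w ^ q = y,
   hence is an integer and g = w ^ (q h). *)
Lemma int_power_dvd (g : int) h q : g != 0 -> (0 < h)%N ->
  (exists x : int, g = x ^+ h) ->
  (forall k : nat, (exists x : int, g = x ^+ k) -> (k <= h)%N) ->
  prime q -> (exists x : int, g = x ^+ q) -> (q %| h)%N.
Proof.
move=> g0 h0 [y yE] hmax pq [x xE]; apply/negPn/negP => nqh.
have cqh : coprime q h by rewrite prime_coprime.
have x0 : x != 0 by apply: contraNneq g0 => x0; rewrite xE x0 expr0n eqn0Ngt prime_gt0.
have [u v uvE _] := egcdnP h (prime_gt0 pq); rewrite (eqP cqh) in uvE.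
pose w : rat := y%:~R ^+ u / x%:~R ^+ v.
have xr0 : x%:~R != 0 :> rat by rewrite intr_eq0.
have wq : w ^+ q = y%:~R.
  rewrite /w expr_div_n -!exprM uvE exprD expr1 (mulnC v h) (mulnC v q) !exprM.
  have -> : y%:~R ^+ h = x%:~R ^+ q :> rat by rewrite -!rmorphXn /= -yE -xE.
  by rewrite mulrAC divff ?mul1r // !expf_neq0.
have [k kE] := rat_root_int (prime_gt0 pq) wq.
have : (q * h <= h)%N.
  apply: hmax; exists k; rewrite yE exprM; congr (_ ^+ h).
  by apply/eqP; rewrite -(eqr_int rat) rmorphXn /= -kE wq.
by have := prime_gt1 pq; nia.
Qed.

Lemma crt_gcd f n a : (0 < f)%N -> (0 < n)%N -> (0 < a)%N -> coprime a f ->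
  (gcdn f n %| a.-1)%N ->
  exists u, [/\ coprime u (lcmn f n), u = a %[mod f] & u = 1 %[mod n]].
Proof.
move=> f0 n0 a0 caf /dvdnP[c cE].
have [x y xyE _] := egcdnP n f0.
(* From x f = y n + gcd, modulo f the number n y is -gcd; the factor f - 1 stands for -1, and c gcd
   = a - 1. *)
pose u := (1 + n * (y * f.-1 * c))%N.
have un : u = 1 %[mod n] by rewrite /u addnC (mulnC n) modnMDl.
have uf : u = a %[mod f].
  apply/eqP; rewrite -(eqn_modDr (gcdn f n * f.-1 * c)).
  have -> : (u + gcdn f n * f.-1 * c = (x * f.-1 * c) * f + 1)%N.
    have -> : (x * f.-1 * c * f = (x * f) * (f.-1 * c))%N by ring.
    by rewrite xyE /u; ring.
  have -> : (a + gcdn f n * f.-1 * c = (gcdn f n * c) * f + 1)%N.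
    have -> : (gcdn f n * c * f = gcdn f n * c * f.-1 + gcdn f n * c)%N by rewrite -mulnSr prednK.
    by rewrite -{1}(prednK a0) cE; ring.
  by rewrite !modnMDl.
exists u; split => //.
apply: (@coprime_dvdr _ (f * n)); first by rewrite -(muln_lcm_gcd f n) dvdn_mulr.
rewrite coprimeMr -coprime_modl uf coprime_modl caf /=.
by rewrite -coprime_modl un coprime_modl coprime1n.
Qed.

(** * Cyclotomic subfields of an abstract number field *)

Section Field.
Variables (L : fieldExtType rat) (iota : {rmorphism L -> algC}).

Lemma Fadjoin1_Qpoly z x : (x \in <<1; z>>%VS) <-> Qpoly_at (iota z) (iota x).
Proof.
have E (p : {poly rat}) : iota (map_poly (GRing.in_alg L) p).[z] = (map_poly ratr p).[iota z].
  rewrite -horner_map -map_poly_comp; congr (_.[_]).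
  by apply: eq_map_poly => k /=; rewrite rmorphZ_num rmorph1 mulr1.
split=> [/Fadjoin1_polyP[p ->]|[p pE]]; first by exists p.
by apply/Fadjoin1_polyP; exists p; apply: (fmorph_inj iota); rewrite E.
Qed.

Lemma Qpoly_iota z x : Qpoly_at (iota z) x -> exists2 y, y \in <<1; z>>%VS & iota y = x.
Proof.
case=> p ->; exists (map_poly (GRing.in_alg L) p).[z].
  by apply/Fadjoin1_polyP; exists p.
rewrite -horner_map -map_poly_comp; congr (_.[_]).
by apply: eq_map_poly => k /=; rewrite rmorphZ_num rmorph1 mulr1.
Qed.

(** Write both roots as powers Z^i and Z^j of a primitive m-th root, m being the lcm. Bezout reaches
    Z^gcd(i,j). A common divisor d of i, j and m makes both orders divide m / d, which forces d =
    1. *)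
Lemma prim_lcm f n (zf zn : L) : f.-primitive_root zf -> n.-primitive_root zn ->
  exists z : L, (lcmn f n).-primitive_root z.
Proof.
move=> pf pn; have f0 := prim_order_gt0 pf; have n0 := prim_order_gt0 pn.
set m := lcmn f n; have m0 : (0 < m)%N by rewrite lcmn_gt0 f0.
have [Z pZ] := C_prim_root_exists m0; have Zm := prim_expr_order pZ.
have fm : (f %| m)%N := dvdn_lcml f n; have nm : (n %| m)%N := dvdn_lcmr f n.
have ex d (z : L) : (d %| m)%N -> d.-primitive_root z -> exists2 i, (0 < i)%N & iota z = Z ^+ i.
  move=> dm pz; have zm : iota z ^+ m = 1.
    by case/dvdnP: dm => k ->; rewrite mulnC exprM -rmorphXn (prim_expr_order pz) rmorph1 expr1n.
  (* Adding m makes the exponent positive, as [egcdnP] requires. *)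
  have [i iE] := prim_rootP pZ zm; exists (i + m)%N; first by rewrite addn_gt0 m0 orbT.
  by rewrite exprD Zm mulr1.
have [i i0 iE] := ex f zf fm pf; have [j j0 jE] := ex n zn nm pn.
have [u v uvE _] := egcdnP j i0.
have zn0 : zn != 0 by rewrite (prim_root_eq0 pn) -lt0n.
have cop : coprime (gcdn i j) m.
  set d := gcdn (gcdn i j) m; rewrite /coprime -/d.
  have dm : (d %| m)%N by apply: dvdn_gcdr.
  have d0 : (0 < d)%N by rewrite gcdn_gt0 m0 orbT.
  have di : (d %| i)%N by apply: dvdn_trans (dvdn_gcdl _ _) (dvdn_gcdl _ _).
  have dj : (d %| j)%N by apply: dvdn_trans (dvdn_gcdl _ _) (dvdn_gcdr _ _).
  have aux k (z : L) i' : k.-primitive_root z -> iota z = Z ^+ i' -> (d %| i')%N -> (k %| m %/ d)%N.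
    move=> pz zE di'; rewrite (prim_order_dvd pz) -(fmorph_eq1 iota) rmorphXn zE.
    case/dvdnP: di' => l ->; rewrite -exprM -mulnA (mulnC d) divnK // mulnC exprM Zm.
    by rewrite expr1n.
  have : (m %| m %/ d)%N by rewrite dvdn_lcm (aux _ _ _ pf iE di) (aux _ _ _ pn jE dj).
  move/dvdn_leq; rewrite divn_gt0 // (dvdn_leq m0 dm) => /(_ isT).
  by case: (d) d0 => [|[|d']] // _; rewrite leqNgt ltn_Pdiv.
exists (zf ^+ u / zn ^+ v); rewrite -(fmorph_primitive_root iota).
have -> : iota (zf ^+ u / zn ^+ v) = Z ^+ (gcdn i j); last by rewrite prim_root_exp_coprime.
rewrite fmorph_div !rmorphXn iE jE -!exprM; apply: (canLR (mulfK _)).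
  by rewrite expf_neq0 // (prim_root_eq0 pZ) -lt0n.
by rewrite -exprD mulnC uvE addnC mulnC.
Qed.

Lemma dim_cyclotomic m (z : L) : m.-primitive_root z -> adjoin_degree 1 z = totient m.
Proof.
move=> pz; have pZ : m.-primitive_root (iota z) by rewrite fmorph_primitive_root.
have [q [qE mq] dvq] := minCpolyP (iota z).
have sq : size q = (totient m).+1.
  rewrite -(size_map_poly (ratr : {rmorphism rat -> algC})) /= -qE.
  by rewrite (minCpoly_cyclotomic pZ) size_cyclotomic.
have E (p : {poly rat}) : root (map_poly (GRing.in_alg L) p) z = root (map_poly ratr p) (iota z).
  rewrite -(fmorph_root iota) -map_poly_comp; congr (root _ _).
  by apply: eq_map_poly => k /=; rewrite rmorphZ_num rmorph1 mulr1.
apply/eqP; rewrite -eqSS -size_minPoly -sq eqn_leq; apply/andP; split.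
  rewrite -(size_map_poly (GRing.in_alg L) q); apply: dvdp_leq.
    by rewrite map_poly_eq0 monic_neq0.
  apply: minPoly_dvdp; first by apply/polyOver1P; exists q.
  by rewrite E dvq.
have /polyOver1P[p pE] := minPolyOver 1 z.
rewrite pE size_map_poly; apply: dvdp_leq.
  by rewrite -(map_poly_eq0 (GRing.in_alg L)) -pE monic_neq0 ?monic_minPoly.
by rewrite -dvq -E -pE root_minPoly.
Qed.
End Field.

Definition kum_eps (f n : nat) (D : int) : nat :=
  if (2 %| n)%N && (`|D| %| lcmn f n)%N then 2 else 1.

(** For squarefree n, the largest divisor k of n such that the k-th root r^(n/k) of g lies in
    Q(zeta_m). *)
Definition kum_index (f n h : nat) (D : int) : nat := (gcdn n h * kum_eps f n D)%N.

Section Kummer.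
Variables (L : fieldExtType rat) (emb : {rmorphism L -> algC}).
Variables (f n h : nat) (zf zn r z : L) (g D : int).
Hypotheses (pf : f.-primitive_root zf) (pn : n.-primitive_root zn).
Hypotheses (rn : r ^+ n = g%:~R) (genL : <<1 & [:: zf; zn; r]>>%VS = fullv).
Hypotheses (sn : sqfree n) (g0 : g != 0) (h0 : (0 < h)%N) (oh : odd h).
Hypotheses (hpow : exists x : int, g = x ^+ h).
Hypotheses (hmax : forall k : nat, (exists x : int, g = x ^+ k) -> (k <= h)%N).
Hypotheses (fD : fund_disc D).
Hypotheses (gD : exists s t : int, [/\ s != 0, t != 0 & g * s ^+ 2 = D * t ^+ 2]).
Local Notation m := (lcmn f n).
Hypothesis pz : m.-primitive_root z.
Local Notation F := <<1; z>>%AS.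
Local Notation d := (gcdn n h).
Local Notation Dn := (kum_index f n h D).

Let n0 : (0 < n)%N. Proof. exact: prim_order_gt0 pn. Qed.
Let pZ : m.-primitive_root (emb z). Proof. by rewrite fmorph_primitive_root. Qed.
Let r0 : r != 0.
Proof.
apply/eqP => r0; move/eqP: rn; rewrite r0 expr0n eqn0Ngt n0 eq_sym /=.
by rewrite -(fmorph_eq0 emb) rmorph_int intr_eq0 (negPf g0).
Qed.
Let d_gt0 : (0 < d)%N. Proof. by rewrite gcdn_gt0 n0. Qed.
Let od : odd d. Proof. exact: dvdn_odd (dvdn_gcdr _ _) oh. Qed.

Lemma unity_in_F x k : (k %| m)%N -> x ^+ k = 1 -> x \in F.
Proof.
move=> /dvdnP[l mE] xk; have xm : x ^+ m = 1 by rewrite mE mulnC exprM xk expr1n.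
by have [i ->] := prim_rootP pz xm; rewrite rpredX // memv_adjoin.
Qed.

Lemma emb_radical q : (q %| n)%N -> emb (r ^+ (n %/ q)) ^+ q = g%:~R.
Proof. by move=> qn; rewrite -rmorphXn -exprM divnK // rn rmorph_int. Qed.

Lemma emb_sqrt : (2 %| n)%N ->
  exists S c, [/\ S ^+ 2 = D%:~R :> algC, c != 0 & emb (r ^+ (n %/ 2)) = S * ratr c].
Proof.
move=> n2; have [s [t [s0 t0 stE]]] := gD.
have sC : s%:~R != 0 :> algC by rewrite intr_eq0.
have tC : t%:~R != 0 :> algC by rewrite intr_eq0.
exists (emb (r ^+ (n %/ 2)) * (s%:~R / t%:~R)), (t%:~R / s%:~R); split.
- rewrite exprMn emb_radical // expr_div_n mulrA -!rmorphXn -rmorphM /= stE.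
  by rewrite intrM mulfK // intr_eq0 expf_neq0.
- by rewrite mulf_neq0 ?invr_eq0 ?intr_eq0.
by rewrite fmorph_div /= !ratr_int -mulrA mulf_div [s%:~R * _]mulrC divff ?mulr1 // mulf_neq0.
Qed.

(** As n is squarefree, one prime q of k at a time suffices: q = 2 puts the square root of D into
    Q(zeta_m), which is governed by the conductor, and odd q makes g a q-th power. *)
Lemma radical_index_dvd k : (k %| n)%N -> r ^+ (n %/ k) \in F -> (k %| Dn)%N.
Proof.
move=> kn rk; apply: sqfree_dvdn; first exact: sqfree_dvd kn sn.
move=> q pq qk; have qn := dvdn_trans qk kn.
have rq : r ^+ (n %/ q) \in F.
  have -> : (n %/ q = n %/ k * (k %/ q))%N by rewrite muln_divA // divnK.
  by rewrite exprM rpredX.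
have Qr := (Fadjoin1_Qpoly emb z _).1 rq.
rewrite /kum_index; case: (even_prime pq) => [q2|oq].
  rewrite q2 in qn rq Qr *; rewrite /kum_eps qn /=.
  have [S [c [SD c0 SE]]] := emb_sqrt qn.
  rewrite (fund_disc_conductor fD pZ SD) ?dvdn_mull //.
  have -> : S = emb (r ^+ (n %/ 2)) * ratr c^-1.
    by rewrite SE fmorphV mulfK // fmorph_eq0.
  by apply: QpolyM => //; apply: Qpoly_ratr.
apply: dvdn_mulr; rewrite dvdn_gcd qn /=.
have qm : (q %| m)%N by apply: dvdn_trans qn (dvdn_lcmr _ _).
apply: (int_power_dvd g0 h0 hpow hmax pq).
exact: (odd_root_cyclotomic_int pZ oq qm Qr (emb_radical qn)).
Qed.

Lemma kum_index_dvd : (Dn %| n)%N.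
Proof.
rewrite /kum_index /kum_eps; case: ifP => [/andP[n2 _]|_]; last by rewrite muln1 dvdn_gcdl.
by rewrite Gauss_dvd ?coprimen2 // dvdn_gcdl.
Qed.

(** When g = y^h, both r^(n/d) and y^(h/d) are d-th roots of g. *)
Lemma radical_gcd : exists (y : int) w, w ^+ d = 1 /\ r ^+ (n %/ d) = y%:~R * w.
Proof.
have [y yE] := hpow; exists (y ^+ (h %/ d)).
have y0 : y != 0 by apply: contraNneq g0 => y0; rewrite yE y0 expr0n eqn0Ngt h0.
have yL : (y ^+ (h %/ d))%:~R != 0 :> L.
  by rewrite -(fmorph_eq0 emb) rmorph_int intr_eq0 expf_neq0.
exists (r ^+ (n %/ d) / (y ^+ (h %/ d))%:~R); split; last by rewrite mulrC divfK.
rewrite expr_div_n -exprM divnK ?dvdn_gcdl // rn -rmorphXn -exprM divnK ?dvdn_gcdr //.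
by rewrite -yE divff // -(fmorph_eq0 emb) rmorph_int intr_eq0.
Qed.

(** Since d is odd, 1/(2d) = 1/2 - ((d-1)/2)/d: a root of order 2d is obtained from one of order 2
    and one of order d. *)
Lemma radical_half : kum_eps f n D = 2%N ->
  r ^+ (n %/ Dn) = r ^+ (n %/ 2) / (r ^+ (n %/ d)) ^+ d./2.
Proof.
move=> e2; have := kum_index_dvd; rewrite /kum_index e2.
move: d d_gt0 od => e e0 oe /dvdnP[k kE].
have eE : e = (e./2 * 2).+1 by have := odd_double_half e; rewrite oe -muln2 => {1}<-.
have -> : (n %/ (e * 2) = k)%N by rewrite kE mulnK // muln_gt0 e0.
have -> : (n %/ 2 = k * e)%N by rewrite kE mulnA mulnK.
have -> : (n %/ e = k * 2)%N by rewrite kE (mulnC e) mulnA mulnK.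
apply: (canRL (mulfK _)); first by rewrite !expf_neq0.
rewrite -exprM -exprD; congr (_ ^+ _).
by rewrite {2}eE; lia.
Qed.

Lemma radical_in_F : r ^+ (n %/ Dn) \in F.
Proof.
have rd : r ^+ (n %/ d) \in F.
  have [y [w [wd ->]]] := radical_gcd; rewrite rpredM ?rpred_int // (@unity_in_F _ d) //.
  by apply: dvdn_trans (dvdn_gcdl _ _) (dvdn_lcmr _ _).
have [e2|e1] := eqVneq (kum_eps f n D) 2%N; last first.
  rewrite /kum_index; have -> : kum_eps f n D = 1%N; last by rewrite muln1.
  by move: e1; rewrite /kum_eps; case: ifP.
rewrite radical_half //; apply: rpred_div; last exact: rpredX.
have /andP[n2 Dm] : (2 %| n)%N && (`|D| %| m)%N by move: e2; rewrite /kum_eps; case: ifP.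
have [S [c [SD c0 SE]]] := emb_sqrt n2.
apply/(Fadjoin1_Qpoly emb); rewrite SE; apply: QpolyM (Qpoly_ratr _ _).
have D_gt0 : (0 < `|D|)%N by case/dvdnP: Dm (prim_order_gt0 pZ) => k ->; rewrite muln_gt0 => /andP[].
have pD : `|D|%N.-primitive_root (emb z ^+ (m %/ `|D|)) := dvdn_prim_root pZ Dm.
exact: Qpoly_trans (Qpoly_exp _ _) (Zpoly_Qpoly (fund_disc_sqrt fD pD SD)).
Qed.

Let zn_in_F : zn \in F.
Proof. by apply: (@unity_in_F _ n); rewrite ?dvdn_lcmr ?(prim_expr_order pn). Qed.

(** The minimal polynomial divides the product of the X - zn^i r, so its constant term is r to the
    degree, times a root of unity in F up to sign. *)
Lemma radical_degree_in_F : r ^+ adjoin_degree F r \in F.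
Proof.
pose rs := mkseq (fun i => zn ^+ i * r) n.
have zn0 : zn != 0 by rewrite (prim_root_eq0 pn) -lt0n.
have rsE : 'X^n - g%:~R%:P = \prod_(w <- rs) ('X - w%:P).
  have -> : 'X^n - g%:~R%:P = lead_coef ('X^n - g%:~R%:P : {poly L}) *: \prod_(w <- rs) ('X - w%:P).
    apply: all_roots_prod_XsubC; rewrite ?size_XnsubC ?size_mkseq //.
      apply/allP => w /mapP[i _ ->]; rewrite /root !hornerE exprMn rn exprAC.
      by rewrite (prim_expr_order pn) expr1n mul1r subrr.
    rewrite uniq_rootsE; apply/(mkseq_uniqP _ _) => i j /= ii jj.
    move/(mulIf r0)/eqP; rewrite (eq_prim_root_expr pn) !modn_small //.
    exact: eqP.
  by rewrite (monicP (monicXnsubC _ n0)) scale1r.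
have dv : minPoly F r %| \prod_(w <- rs) ('X - w%:P).
  rewrite -rsE; apply: minPoly_dvdp; last by rewrite /root !hornerE rn subrr.
  by rewrite rpredB ?rpredX ?polyOverX // polyOverC rpred_int.
have [b bE] := dvdp_prod_XsubC dv; set s := mask b rs in bE.
have mE : minPoly F r = \prod_(w <- s) ('X - w%:P).
  by apply/eqP; rewrite -eqp_monic ?monic_minPoly ?monic_prod_XsubC.
have -> : adjoin_degree F r = size s.
  by apply/eqP; rewrite -eqSS -size_minPoly mE size_prod_XsubC.
have [w [wF w0 wE]] : exists w, [/\ w \in F, w != 0 & \prod_(x <- s) (0 - x) = w * r ^+ size s].
  have : all (mem rs) s by apply/allP => x; apply: mem_mask.
  elim: s {bE mE} => [|x s IH] /=; first by exists 1; rewrite rpred1 oner_neq0 big_nil mulr1.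
  move=> /andP[/mapP[i _ ->] /IH[w [wF w0 wE]]].
  exists (- zn ^+ i * w); split.
  - by rewrite rpredM ?rpredN ?rpredX.
  - by rewrite mulf_neq0 // oppr_eq0 expf_neq0.
  by rewrite big_cons wE exprS; ring.
have PF : (minPoly F r).[0] \in F.
  by rewrite horner_coef0; apply/polyOverP; apply: minPolyOver.
move: PF; rewrite mE horner_prod.
under eq_bigr do rewrite !hornerE.
rewrite -(eq_bigr _ (fun x _ => add0r _)) wE => PF.
have -> : r ^+ size s = w^-1 * (w * r ^+ size s) by rewrite mulKf.
by rewrite rpredM ?rpredV.
Qed.

(** Let k be the degree and N = n / Dn. As r^k and r^n lie in F, so does r^gcd(k,n); by the choice
    of Dn, N then divides gcd(k,n), so N <= k. Conversely r is a root of X^N - r^N over F. *)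
Lemma minPoly_radical :
  minPoly F r = 'X^(n %/ Dn) - (r ^+ (n %/ Dn))%:P /\ adjoin_degree F r = (n %/ Dn)%N.
Proof.
set N := (n %/ Dn)%N; set k := adjoin_degree F r.
have Dn0 : (0 < Dn)%N by apply: dvdn_gt0 n0 kum_index_dvd.
have N0 : (0 < N)%N by rewrite divn_gt0 // dvdn_leq // kum_index_dvd.
have dv : minPoly F r %| 'X^N - (r ^+ N)%:P.
  apply: minPoly_dvdp; last by rewrite /root !hornerE subrr.
  by rewrite rpredB ?rpredX ?polyOverX // polyOverC radical_in_F.
have k0 : (0 < k)%N by [].
have re : r ^+ gcdn k n \in F.
  have [u v uvE _] := egcdnP n k0.
  have -> : r ^+ gcdn k n = (r ^+ k) ^+ u / (r ^+ n) ^+ v.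
    apply: (canRL (mulfK _)); first by rewrite !expf_neq0.
    by rewrite -!exprM -exprD (mulnC k) uvE addnC (mulnC n).
  rewrite rn; apply: rpred_div; apply: rpredX; last exact: rpred_int.
  exact: radical_degree_in_F.
have en : (gcdn k n %| n)%N := dvdn_gcdr k n.
have e0 : (0 < gcdn k n)%N by rewrite gcdn_gt0 k0.
have Ne : (N %| gcdn k n)%N.
  have /dvdnP[l lE] : (n %/ gcdn k n %| Dn)%N.
    apply: radical_index_dvd; first by apply/dvdnP; exists (gcdn k n); rewrite mulnC divnK.
    by rewrite divnA // mulKn.
  apply/dvdnP; exists l; apply/eqP.
  have e'0 : (0 < n %/ gcdn k n)%N by rewrite divn_gt0 // dvdn_leq.
  rewrite -(eqn_pmul2l e'0) divnK // mulnA (mulnC _ l) -lE mulnC divnK //.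
  exact: kum_index_dvd.
have Nk : (N <= k)%N by apply: dvdn_leq => //; apply: dvdn_trans Ne (dvdn_gcdl _ _).
have P0 : 'X^N - (r ^+ N)%:P != 0 :> {poly L} by rewrite monic_neq0 ?monicXnsubC.
have kN : (k <= N)%N.
  by have := dvdp_leq P0 dv; rewrite size_minPoly size_XnsubC.
have kE : k = N by apply/eqP; rewrite eqn_leq kN.
split=> //; apply/eqP; rewrite -eqp_monic ?monic_minPoly ?monicXnsubC //.
by rewrite -dvdp_size_eqp // size_minPoly size_XnsubC // -/k kE.
Qed.

Lemma zf_in_F : zf \in F.
Proof. by apply: (@unity_in_F _ f); rewrite ?dvdn_lcml ?(prim_expr_order pf). Qed.

Lemma radical_generates : <<F; r>>%VS = fullv.
Proof.
apply/eqP; rewrite eqEsubv subvf -genL; apply/Fadjoin_seqP; split; first exact: sub1v.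
move=> x; rewrite !inE => /or3P[] /eqP->; last exact: memv_adjoin.
  by rewrite subvP_adjoin // zf_in_F.
by rewrite subvP_adjoin.
Qed.

Lemma kummer_dim : \dim {:L} = (n %/ Dn * totient m)%N.
Proof.
rewrite -radical_generates dim_Fadjoin minPoly_radical.2.
by rewrite dim_Fadjoin (dim_cyclotomic emb pz) dimv1 muln1.
Qed.

End Kummer.

(** * The restriction of sigma_a to the intersection *)

Lemma kHom_horner1 (L : fieldExtType rat) (E : {subfield L}) (s : 'End(L)) (p : {poly rat}) x :
  kHom 1 E s -> x \in E ->
  s (map_poly (GRing.in_alg L) p).[x] = (map_poly (GRing.in_alg L) p).[s x].
Proof.
move=> hs xE; have p1 : map_poly (GRing.in_alg L) p \is a polyOver 1%VS by apply/polyOver1P; exists p.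
by rewrite (kHom_horner hs) ?(kHom_poly_id hs p1) // (polyOverSv (sub1v _)).
Qed.

Lemma kHom_exp1 (L : fieldExtType rat) (E : {subfield L}) (s : 'End(L)) x k :
  kHom 1 E s -> x \in E -> s (x ^+ k) = s x ^+ k.
Proof.
move=> hs xE; have := kHom_horner1 'X^k hs xE.
by rewrite map_polyXn !hornerXn.
Qed.

Lemma emb_horner (L : fieldExtType rat) (emb : {rmorphism L -> algC}) (p : {poly rat}) x :
  emb (map_poly (GRing.in_alg L) p).[x] = (map_poly ratr p).[emb x].
Proof.
rewrite -horner_map -map_poly_comp; congr (_.[_]).
by apply: eq_map_poly => k /=; rewrite rmorphZ_num rmorph1 mulr1.
Qed.

Section KummerAction.
Variables (L : fieldExtType rat) (emb : {rmorphism L -> algC}).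
Variables (f n h : nat) (zf zn r z : L) (g D : int).
Hypotheses (pf : f.-primitive_root zf) (pn : n.-primitive_root zn).
Hypotheses (rn : r ^+ n = g%:~R) (genL : <<1 & [:: zf; zn; r]>>%VS = fullv).
Hypotheses (sn : sqfree n) (g0 : g != 0) (h0 : (0 < h)%N) (oh : odd h).
Hypotheses (hpow : exists x : int, g = x ^+ h).
Hypotheses (hmax : forall k : nat, (exists x : int, g = x ^+ k) -> (k <= h)%N).
Hypotheses (fD : fund_disc D).
Hypotheses (gD : exists s t : int, [/\ s != 0, t != 0 & g * s ^+ 2 = D * t ^+ 2]).
Local Notation m := (lcmn f n).
Hypothesis pz : m.-primitive_root z.
Local Notation F := <<1; z>>%AS.
Local Notation d := (gcdn n h).
Local Notation Dn := (kum_index f n h D).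

Variables (a : nat) (gam : int).
Hypotheses (a_gt0 : (0 < a)%N) (caf : coprime a f).
Hypothesis gam_spec : kum_eps f n D = 2%N -> exists B,
  [/\ fund_disc gam, (`|gam| %| f)%N, odd B /\ sqfree B, (B %| n)%N & D = gam * star B].

Let n0 : (0 < n)%N. Proof. exact: prim_order_gt0 pn. Qed.
Let f0 : (0 < f)%N. Proof. exact: prim_order_gt0 pf. Qed.
Let pZ : m.-primitive_root (emb z). Proof. by rewrite fmorph_primitive_root. Qed.
Let pZf : f.-primitive_root (emb zf). Proof. by rewrite fmorph_primitive_root. Qed.
Let pZn : n.-primitive_root (emb zn). Proof. by rewrite fmorph_primitive_root. Qed.

Lemma fund_disc_neq0 G : fund_disc G -> G != 0.
Proof.
case=> c [M [cin _ /sqfree_gt0 M0 ->]]; rewrite -absz_gt0 abszM absz_star muln_gt0 M0 andbT.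
by move: cin; rewrite !inE => /or4P[] /eqP->.
Qed.

Lemma gam_act nu (G : algC) : kum_eps f n D = 2%N -> acts_as nu f a -> G ^+ 2 = gam%:~R ->
  nu G = (kronecker gam a%:Z)%:~R * G.
Proof.
move=> /gam_spec[B [fg gf _ _ _]] act GE.
apply: kronecker_act => //; last exact: acts_as_dvd gf act.
exact: coprime_dvdr gf caf.
Qed.

Lemma eps2_dvd : kum_eps f n D = 2%N -> (2 %| n)%N.
Proof. by rewrite /kum_eps; case: ifP => // /andP[]. Qed.

(** The intersection contains the roots of unity of order (f, n). When e = 2 it also contains the
    square root of gam: it lies in Q(zeta_f) because |gam| divides f, and it is the quotient of the
    square root of D, a rational multiple of r^(n/2), by that of B*, which lies in Q(zeta_n). *)
Lemma sigma_necessary (s : 'End(L)) :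
  kHom 1 <<1; zf>>%VS s -> s zf = zf ^+ a ->
  {in (<<1; zf>> :&: <<1 & [:: zn; r]>>)%VS, forall x, s x = x} ->
  a = 1 %[mod gcdn f n] /\ (kum_eps f n D = 2%N -> kronecker gam a%:Z = 1).
Proof.
move=> hs szf sfix.
have zfC : zf \in <<1; zf>>%AS := memv_adjoin _ _.
have znR : zn \in <<1 & [:: zn; r]>>%AS by apply: seqv_sub_adjoin; rewrite inE eqxx.
have rR : r \in <<1 & [:: zn; r]>>%AS by apply: seqv_sub_adjoin; rewrite !inE eqxx orbT.
split.
  set gg := gcdn f n; have pg := dvdn_prim_root pf (dvdn_gcdl f n).
  have zgn : (zf ^+ (f %/ gg)) ^+ n = 1.
    have /dvdnP[k kE] : (gg %| n)%N := dvdn_gcdr f n.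
    by rewrite kE mulnC exprM (prim_expr_order pg) expr1n.
  have zgR : zf ^+ (f %/ gg) \in <<1 & [:: zn; r]>>%AS.
    by have [i ->] := prim_rootP pn zgn; rewrite rpredX.
  have : s (zf ^+ (f %/ gg)) = zf ^+ (f %/ gg).
    by apply: sfix; rewrite memv_cap zgR andbT (rpredX _ zfC).
  rewrite (kHom_exp1 _ hs zfC) szf exprAC => /eqP.
  by rewrite -[X in _ == X]expr1 (eq_prim_root_expr pg) => /eqP.
move=> e2; have [B [fg gf [oB sB] Bn DE]] := gam_spec e2.
have [G GE] := sqrtC_exists gam; have [Y YE] := sqrtC_exists (star B).
have G0 : G != 0 by rewrite -sqrf_eq0 GE intr_eq0 fund_disc_neq0.
have Y0 : Y != 0 by rewrite -sqrf_eq0 YE intr_eq0 -absz_gt0 absz_star sqfree_gt0.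
have QG : Qpoly_at (emb zf) G.
  exact: Qpoly_trans (Qpoly_exp _ _) (Zpoly_Qpoly (fund_disc_sqrt fg (dvdn_prim_root pZf gf) GE)).
have QY : Qpoly_at (emb zn) Y.
  exact: Qpoly_trans (Qpoly_exp _ _) (Zpoly_Qpoly (sqrt_star oB sB (dvdn_prim_root pZn Bn) YE)).
have [x xC xE] := Qpoly_iota QG; have [y yC yE] := Qpoly_iota QY.
have yR : y \in <<1 & [:: zn; r]>>%AS.
  by apply: subvP yC; apply/FadjoinP; split; first exact: sub1v.
have [S [c [SD c0 SE]]] := emb_sqrt emb rn gD (eps2_dvd e2).
have /orP SGY : (S == G * Y) || (S == - (G * Y)).
  by rewrite -eqf_sqr SD exprMn GE YE DE rmorphM.
have cC : ratr c != 0 :> algC by rewrite fmorph_eq0.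
pose x' := r ^+ (n %/ 2) / (c%:A * y).
have x'R : x' \in <<1 & [:: zn; r]>>%AS.
  by apply: rpred_div; [apply: rpredX | apply: rpredM => //; rewrite rpredZ ?rpred1].
have x'E : emb x' = S / Y.
  rewrite fmorph_div SE rmorphM rmorphZ_num rmorph1 mulr1 yE.
  by rewrite invfM mulrA -(mulrA S) divff // mulr1.
have xR : x \in <<1 & [:: zn; r]>>%AS.
  case: SGY => /eqP E.
    have -> : x = x' by apply: (fmorph_inj emb); rewrite x'E E mulfK.
    exact: x'R.
  have -> : x = - x' by apply: (fmorph_inj emb); rewrite rmorphN x'E E mulNr opprK mulfK.
  by rewrite rpredN x'R.
have sx : s x = x by apply: sfix; rewrite memv_cap xC.
(* On Q(zeta_f), [nu] is the transport of [s] to [algC]. *)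
have [nu act] := Qn_aut_exists caf.
have nuG := gam_act e2 act GE.
have : emb (s x) = nu G.
  case/Fadjoin1_polyP: xC xE => p -> <-.
  rewrite (kHom_horner1 _ hs zfC) !emb_horner rmorph_Qpoly szf rmorphXn act //.
  exact: prim_expr_order pZf.
rewrite sx xE nuG => /esym E; apply/eqP; rewrite -(eqr_int algC); apply/eqP/(mulIf G0).
by rewrite E mul1r.
Qed.

(** This is the compatibility that allows an automorphism of F to be extended by r -> r. For e = 2
    it depends on the square root of D = gam B*, whose second factor is always fixed. *)
Lemma nu_fixes_radical nu u : acts_as nu m u -> u = a %[mod f] -> u = 1 %[mod n] ->
  (kum_eps f n D = 2%N -> kronecker gam a%:Z = 1) ->
  nu (emb (r ^+ (n %/ Dn))) = emb (r ^+ (n %/ Dn)).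
Proof.
move=> act uf un kr1.
have actf : acts_as nu f a by apply: acts_as_mod uf (acts_as_dvd (dvdn_lcml f n) act).
have actn : acts_as nu n 1 by apply: acts_as_mod un (acts_as_dvd (dvdn_lcmr f n) act).
have rd : nu (emb (r ^+ (n %/ d))) = emb (r ^+ (n %/ d)).
  have [y [w [wd ->]]] := radical_gcd emb rn g0 h0 hpow.
  rewrite !rmorphM !rmorph_int actn ?expr1 //.
  have /dvdnP[k kE] : (d %| n)%N := dvdn_gcdl n h.
  by rewrite {1}kE mulnC exprM -rmorphXn wd rmorph1 expr1n.
have [e2|e1] := eqVneq (kum_eps f n D) 2%N; last first.
  rewrite /kum_index; have -> : kum_eps f n D = 1%N; last by rewrite muln1.
  by move: e1; rewrite /kum_eps; case: ifP.
rewrite (radical_half emb pf pn rn g0 h0 oh pz e2).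
move: (r ^+ (n %/ d)) rd => t rd.
rewrite !fmorph_div [emb (t ^+ _)]rmorphXn [nu (emb t ^+ _)]rmorphXn rd; congr (_ / _).
have [B [fg gf [oB sB] Bn DE]] := gam_spec e2.
have [G GE] := sqrtC_exists gam; have [Y YE] := sqrtC_exists (star B).
have [S [c [SD c0 SE]]] := emb_sqrt emb rn gD (eps2_dvd e2).
have nuY : nu Y = Y.
  apply: rmorph_Qpoly_fix (Zpoly_Qpoly (sqrt_star oB sB (dvdn_prim_root pZn Bn) YE)) _.
  by rewrite rmorphXn actn ?expr1 // (prim_expr_order pZn).
have nuS : nu S = 1 * S.
  apply: (@act_sqrt _ _ _ (G * Y)); first by rewrite SD exprMn GE YE DE rmorphM.
  by rewrite rmorphM nuY (gam_act e2 actf GE) kr1 // !mul1r.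
by rewrite SE rmorphM nuS mul1r fmorph_rat.
Qed.

(** Take u congruent to a modulo f and to 1 modulo n. The map z -> z^u on F fixes the constant term
    of the minimal polynomial of r, so it extends by r -> r; the extension fixes zn and r, hence all
    of Q(zn, r). *)
Lemma sigma_sufficient :
  a = 1 %[mod gcdn f n] -> (kum_eps f n D = 2%N -> kronecker gam a%:Z = 1) ->
  exists2 s : 'End(L), kAut 1 <<1; zf>>%VS s /\ s zf = zf ^+ a &
    {in (<<1; zf>> :&: <<1 & [:: zn; r]>>)%VS, forall x, s x = x}.
Proof.
move=> amod kr1.
have [|u [cu uf un]] := crt_gcd f0 n0 a_gt0 caf.
  by rewrite -subn1 -eqn_mod_dvd // amod.
have [nu act] := Qn_aut_exists cu.
have zF : z \in F := memv_adjoin _ _.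
have root0 : root (map_poly \1%VF (minPoly 1 z)) (z ^+ u).
  rewrite lfun1_poly; have /polyOver1P[p pE] := minPolyOver 1 z.
  rewrite pE /root -(fmorph_eq0 emb) emb_horner rmorphXn -(act _ (prim_expr_order pZ)).
  by rewrite -rmorph_Qpoly fmorph_eq0 -emb_horner fmorph_eq0 -pE minPolyxx.
pose s0 := kHomExtend 1 \1%VF z (z ^+ u).
have hs0 : kHom 1 F s0 by apply: kHomExtendP root0; rewrite ?kHom1.
have s0z : s0 z = z ^+ u := kHomExtend_val (kHom1 1%AS 1%AS) root0.
have emb_s0 x : x \in F -> emb (s0 x) = nu (emb x).
  case/Fadjoin1_polyP => p ->; rewrite (kHom_horner1 _ hs0 zF) !emb_horner rmorph_Qpoly.
  by rewrite s0z rmorphXn act // (prim_expr_order pZ).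
have [mE _] := minPoly_radical emb pf pn rn sn g0 h0 oh hpow hmax fD gD pz.
have NF := radical_in_F emb pf pn rn g0 h0 oh hpow fD gD pz.
have s0N : s0 (r ^+ (n %/ Dn)) = r ^+ (n %/ Dn).
  by apply: (fmorph_inj emb); rewrite emb_s0 // (nu_fixes_radical act).
have root1 : root (map_poly s0 (minPoly F r)) r.
  rewrite mE raddfB /= map_polyC /= s0N (kHom_poly_id hs0) ?rpredX ?polyOverX //.
  by rewrite /root !hornerE subrr.
pose s := kHomExtend F s0 r r.
have hs : kHom 1 fullv s.
  rewrite -(radical_generates pf pn genL pz).
  by apply: kHomExtendP root1; rewrite ?sub1v.
have sr : s r = r by apply: kHomExtend_val root1; exact: hs0.
have sF x : x \in F -> s x = s0 x by apply: kHomExtend_id.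
have s_unity x k : (k %| m)%N -> x ^+ k = 1 -> s x = x ^+ u.
  move=> km xk; have xF : x \in F := unity_in_F pz km xk.
  apply: (fmorph_inj emb); rewrite sF // emb_s0 // rmorphXn act //.
  by case/dvdnP: km => l ->; rewrite mulnC exprM -rmorphXn xk rmorph1 expr1n.
have szf : s zf = zf ^+ a.
  rewrite (s_unity _ f) ?dvdn_lcml ?(prim_expr_order pf) //.
  by rewrite -(prim_expr_mod pf) uf (prim_expr_mod pf).
have szn : s zn = zn.
  rewrite (s_unity _ n) ?dvdn_lcmr ?(prim_expr_order pn) //.
  by rewrite -(prim_expr_mod pn) un (prim_expr_mod pn) expr1.
exists s.
  split=> //; rewrite kAutE (kHomSr (subvf _) hs) /=.
  apply/subvP => _ /memv_imgP[x /Fadjoin1_polyP[p ->] ->].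
  rewrite (kHom_horner1 _ hs (memvf _)) szf; apply: rpred_horner.
    by apply/(polyOverSv (sub1v <<1; zf>>%AS))/polyOver1P; exists p.
  by rewrite rpredX // memv_adjoin.
move=> x; rewrite memv_cap => /andP[_]; rewrite adjoin_cons adjoin_seq1.
have hs1 : kHom <<1; zn>> fullv s.
  have [sM _] := kHomP hs; apply/kHomP; split=> // y /Fadjoin1_polyP[p ->].
  by rewrite (kHom_horner1 _ hs (memvf _)) szn.
case/Fadjoin_polyP => p pE ->.
have -> : s p.[r] = (map_poly s p).[s r].
  by apply: (kHom_horner hs1); [apply: polyOverSv (subvf _) _ pE | rewrite memvf].
by rewrite (kHom_poly_id hs1 pE) sr.
Qed.

End KummerAction.

(** * Euler products over squarefree numbers *)

(** The squarefree numbers whose primes are all below N, listed as in the expansion of a finite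
    Euler product. *)
Fixpoint sqfree_below (N : nat) : seq nat :=
  if N is N'.+1 then
    let s := sqfree_below N' in
    if prime N' then s ++ [seq (N' * n)%N | n <- s] else s
  else [:: 1%N].

Lemma sqfree_mul_prime p n : prime p -> sqfree n -> ~~ (p %| n)%N -> sqfree (p * n).
Proof.
move=> pp sn npn q pq; have [->|qp] := eqVneq q p.
  by rewrite dvdn_pmul2l ?prime_gt0.
rewrite Gauss_dvdr ?sn // coprimeMl andbb prime_coprime //.
by rewrite dvdn_prime2.
Qed.

Lemma sqfree_belowP N n : reflect (sqfree n /\ forall p, prime p -> (p %| n)%N -> (p < N)%N)
  (n \in sqfree_below N).
Proof.
apply: (iffP idP); elim: N n => [|N IH] n /=.
- rewrite inE => /eqP->; split=> p pp; rewrite ?dvdn1 ?muln_eq1; first by case: p pp => [|[|]].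
  by move/eqP => p1; move: pp; rewrite p1.
- case: ifP => pN; last by move/IH => [sn H]; split => // p pp pn; apply: ltnW; rewrite ltnS H.
  rewrite mem_cat => /orP[/IH[sn H]|/mapP[k /IH[sk H] ->]].
    by split => // p pp pn; apply: ltnW; rewrite ltnS H.
  have npk : ~~ (N %| k)%N by apply/negP => /(H _ pN); rewrite ltnn.
  split; first exact: sqfree_mul_prime.
  move=> p pp; rewrite Euclid_dvdM // => /orP[|/(H _ pp)/ltnW//].
  by rewrite dvdn_prime2 // => /eqP->.
- case=> sn H; rewrite inE; apply/negPn/negP => n1.
  have n2 : (1 < n)%N by rewrite ltn_neqAle eq_sym n1 sqfree_gt0.
  by have := H _ (pdiv_prime n2) (pdiv_dvd n).
case=> sn H; case: ifP => pN; last first.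
  apply: IH; split => // p pp pn; have := H p pp pn; rewrite ltnS leq_eqVlt => /orP[/eqP E|//].
  by move: pp; rewrite E pN.
rewrite mem_cat; have [/dvdnP[k kE]|Nn] := boolP (N %| n)%N; last first.
  apply/orP; left; apply: IH; split => // p pp pn; have := H p pp pn.
  by rewrite ltnS leq_eqVlt => /orP[/eqP E|//]; rewrite E (negPf Nn) in pn.
apply/orP; right; apply/mapP; exists k; last by rewrite kE mulnC.
have nNk : ~~ (N %| k)%N.
  apply/negP => /dvdnP[l lE]; have := sn N pN; rewrite kE lE -mulnA.
  by rewrite dvdn_mull.
apply: IH; split; first by apply: sqfree_dvd sn; rewrite kE dvdn_mulr.
move=> p pp pk; have := H p pp; rewrite kE dvdn_mulr // ltnS leq_eqVlt => /(_ isT)/orP[/eqP E|//].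
by rewrite E (negPf nNk) in pk.
Qed.

Lemma sqfree_below_uniq N : uniq (sqfree_below N).
Proof.
elim: N => //= N IH; case: ifP => // pN; rewrite cat_uniq IH /= map_inj_in_uniq ?IH ?andbT.
  apply/hasPn => n /mapP[k _ ->]; apply/negP => /sqfree_belowP[_ H].
  by have := H N pN; rewrite dvdn_mulr // ltnn => /(_ isT).
by move=> x y _ _ /eqP; rewrite eqn_pmul2l ?prime_gt0 // => /eqP.
Qed.

(** The general term [al p] in place of 1 permits a restriction to the multiples of a number, by
    letting it vanish at the primes of that number. *)
Lemma sum_sqfree_below (K : comNzRingType) (v al : nat -> K) N :
  \sum_(n <- sqfree_below N) \prod_(0 <= p < N | prime p) (if (p %| n)%N then v p else al p) =
  \prod_(0 <= p < N | prime p) (al p + v p).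
Proof.
elim: N => [|N IH]; first by rewrite /= big_seq1 !big_geq.
rewrite [RHS]big_mkcond big_nat_recr //= -big_mkcond /= -IH.
case: ifP => pN; last first.
  rewrite mulr1; apply: eq_bigr => n _.
  by rewrite [LHS]big_mkcond big_nat_recr //= pN mulr1 -big_mkcond.
rewrite big_cat big_map /= mulrDr !mulr_suml; congr (_ + _).
  apply: eq_big_seq => n /sqfree_belowP[_ H].
  rewrite [LHS]big_mkcond big_nat_recr //= pN -big_mkcond /=; congr (_ * _).
  by case: ifP => // /(H _ pN); rewrite ltnn.
apply: eq_big_seq => n /sqfree_belowP[_ H].
rewrite [LHS]big_mkcond big_nat_recr //= pN -big_mkcond dvdn_mulr //=; congr (_ * _).
rewrite big_nat_cond [RHS]big_nat_cond; apply: eq_bigr => p /andP[/andP[_ pN'] pp].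
by rewrite Euclid_dvdM // dvdn_prime2 // (ltn_eqF pN').
Qed.

Definition sqf_mul (K : comNzRingType) (v : nat -> K) (n : nat) : K :=
  if `[< sqfree n >] then \prod_(p <- primes n) v p else 0.

(** A prime of B not dividing n contributes a factor 0, so only multiples of B survive. *)
Lemma sqf_mul_below (K : fieldType) (v : nat -> K) (B N n : nat) :
  sqfree B -> (B < N)%N -> n \in sqfree_below N ->
  \prod_(0 <= p < N | prime p) (if (p %| n)%N then v p else (~~ (p %| B)%N)%:R) =
  (B %| n)%N%:R * sqf_mul v n.
Proof.
move=> sB BN /sqfree_belowP[sn H]; rewrite /sqf_mul asboolT //.
have n0 := sqfree_gt0 sn; have B0 := sqfree_gt0 sB.
have pB p : (p %| B)%N -> (p < N)%N by move=> pB; apply: leq_ltn_trans BN; apply: dvdn_leq.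
rewrite (bigID (fun p => p %| n)%N) /= mulrC; congr (_ * _).
  have [Bn|nBn] := boolP (B %| n)%N.
    rewrite big1 // => p /andP[pp npn]; rewrite (negPf npn).
    by have -> : (p %| B)%N = false by apply: contraNF npn => /dvdn_trans->.
  have [p /and3P[pp pB' npn]] : exists p, [&& prime p, (p %| B)%N & ~~ (p %| n)%N].
    apply: contrapT => nex; case/negP: nBn; apply: sqfree_dvdn => // p pp pB'.
    by apply/negPn/negP => npn; apply: nex; exists p; rewrite pp pB'.
  apply/eqP; rewrite prodf_seq_eq0; apply/hasP; exists p.
    by rewrite mem_index_iota pB.
  by rewrite pp npn (negPf npn) pB' /=.
rewrite (eq_bigr v) => [|p /andP[_ ->] //]; rewrite -big_filter; apply: perm_big.
apply: uniq_perm; rewrite ?primes_uniq ?filter_uniq ?iota_uniq //.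
move=> p; rewrite mem_filter mem_index_iota mem_primes n0 /=.
by case pp: (prime p); case pn: (p %| n)%N; rewrite //= H.
Qed.

Section EulerProduct.
Local Open Scope classical_set_scope.
Variables (R : realType) (v : nat -> R) (C : R).
Hypothesis C0 : 0 <= C.
Hypothesis vC : forall p, prime p -> `|v p| <= C / (p%:R * (p%:R - 1)).

(** The sum is enlarged to all integers from 2 on, where 1/(p(p-1)) = 1/(p-1) - 1/p telescopes. *)
Lemma sum_inv_telescope N :
  \sum_(0 <= p < N | prime p) C / (p%:R * (p%:R - 1)) <= C.
Proof.
have H M : \sum_(0 <= p < M.+2 | prime p) C / (p%:R * (p%:R - 1)) <= C * (1 - M.+1%:R^-1).
  elim: M => [|M IH]; first by rewrite big_mkcond !big_nat_recr //= big_geq // !addr0 invr1 subrr mulr0.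
  rewrite big_mkcond big_nat_recr //= -big_mkcond /=.
  apply: le_trans (lerD IH (_ : _ <= C * (M.+1%:R^-1 - M.+2%:R^-1))) _; last by rewrite -mulrDr addrA subrK.
  have M1 : M.+1%:R != 0 :> R by rewrite pnatr_eq0.
  have M2 : M.+2%:R != 0 :> R by rewrite pnatr_eq0.
  have ge0 : 0 <= M.+1%:R^-1 - M.+2%:R^-1 :> R.
    by rewrite subr_ge0 lef_pV2 ?posrE ?ltr0n // ler_nat.
  case: ifP => _; last by rewrite mulr_ge0.
  rewrite le_eqVlt; apply/orP; left; apply/eqP.
  have E : M.+2%:R - 1 = M.+1%:R :> R by rewrite -[M.+2%:R]natr1 addrK.
  have E2 : M.+2%:R = M.+1%:R + 1 :> R by rewrite natr1.
  rewrite E; move: M1 M2; rewrite E2; move: (M.+1%:R) => x x0 x1.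
  by field; rewrite x0 x1.
case: N => [|[|N]]; first by rewrite big_geq.
  by rewrite big_mkcond big_nat_recr //= big_geq // addr0.
by apply: le_trans (H N) _; rewrite ler_piMr // gerBl invr_ge0 ler0n.
Qed.

Lemma prod_le_expR N : \prod_(0 <= p < N | prime p) (1 + `|v p|) <= expR C.
Proof.
apply: (@le_trans _ _ (expR (\sum_(0 <= p < N | prime p) C / (p%:R * (p%:R - 1))))); last first.
  by rewrite ler_expR sum_inv_telescope.
rewrite expR_sum; apply: ler_prod => p pp; rewrite addr_ge0 //=.
by apply: le_trans (expR_ge1Dx _); rewrite lerD2l vC.
Qed.

Lemma sqf_mul_norm n : `|sqf_mul v n| = sqf_mul (fun p => `|v p|) n.
Proof. by rewrite /sqf_mul; case: asboolP => _; rewrite ?normr0 // normr_prod. Qed.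

Variable B : nat.
Hypothesis sB : sqfree B.

Definition euler_term n : R := (B %| n)%N%:R * sqf_mul v n.

Definition norm_series : nat -> R := series (fun n => `|euler_term n|).

Lemma euler_term_norm n : `|euler_term n| <= sqf_mul (fun p => `|v p|) n.
Proof.
rewrite /euler_term normrM sqf_mul_norm normr_nat; case: (B %| n)%N; rewrite ?mul1r // mul0r.
by rewrite -sqf_mul_norm.
Qed.

(** A squarefree number below N has all its primes below N, so the partial sum is part of the
    expansion of the finite product. *)
Lemma norm_series_le N : norm_series N <= expR C.
Proof.
rewrite /norm_series /series /=; apply: le_trans (prod_le_expR N).
rewrite -(sum_sqfree_below (fun p => `|v p|) (fun=> 1) N).
have -> : \sum_(n <- sqfree_below N) \prod_(0 <= p < N | prime p) (if (p %| n)%N then `|v p| else 1) =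
    \sum_(n <- sqfree_below N) sqf_mul (fun p => `|v p|) n.
  apply: eq_big_seq => n nN; case/sqfree_belowP: (nN) => sn H; have n0 := sqfree_gt0 sn.
  rewrite /sqf_mul asboolT // -big_mkcondr -big_filter; apply: perm_big.
  apply: uniq_perm; rewrite ?primes_uniq ?filter_uniq ?iota_uniq //.
  move=> p; rewrite mem_filter mem_index_iota mem_primes n0 /=.
  by case pp: (prime p); case pn: (p %| n)%N; rewrite //= H.
apply: le_trans (ler_sum _ (fun n _ => euler_term_norm n)) _.
rewrite (bigID (fun n => n \in sqfree_below N)) /= [X in _ + X]big1_seq ?addr0; last first.
  move=> n /andP[nN]; rewrite mem_index_iota => /andP[_ nlt]; rewrite /sqf_mul.
  case: asboolP => // sn; case/negP: nN; apply/sqfree_belowP; split => // p pp pn.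
  by apply: leq_ltn_trans nlt; apply: dvdn_leq pn; apply: sqfree_gt0.
rewrite -big_filter.
rewrite [X in _ <= X](bigID (fun n => (n < N)%N)) /= -[X in _ <= X + _]big_filter.
have -> : \sum_(i <- [seq i <- index_iota 0 N | i \in sqfree_below N]) sqf_mul (fun p => `|v p|) i =
   \sum_(i <- [seq i <- sqfree_below N | (i < N)%N]) sqf_mul (fun p => `|v p|) i.
  apply: perm_big; apply: uniq_perm; rewrite ?filter_uniq ?iota_uniq ?sqfree_below_uniq //.
  by move=> n; rewrite !mem_filter mem_index_iota /= andbC.
by rewrite lerDl sumr_ge0 // => n _; rewrite -sqf_mul_norm.
Qed.

Lemma norm_series_nd : nondecreasing_seq norm_series.
Proof.
by apply/nondecreasing_seqP => n; rewrite /norm_series -subr_ge0 seriesSB.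
Qed.

Lemma norm_series_cvg : cvgn norm_series.
Proof.
apply: nondecreasing_is_cvgn; first exact: norm_series_nd.
by exists (expR C) => _ [N _ <-]; apply: norm_series_le.
Qed.

Lemma sum_seq_le_tail (s : seq nat) N : uniq s -> {in s, forall n, (N <= n)%N} ->
  \sum_(n <- s) `|euler_term n| <= limn norm_series - norm_series N.
Proof.
(* This sum is merely a bound exceeding every element of s. *)
move=> us sN; pose M := (N + \sum_(n <- s) n.+1)%N.
have sM n : n \in s -> (n < M)%N.
  by move=> ns; rewrite /M (big_rem n) //=; lia.
have := nondecreasing_cvgn_le norm_series_nd norm_series_cvg M.
rewrite -(lerD2r (- norm_series N)); apply: le_trans.
rewrite /norm_series /series /= (@big_cat_nat _ _ _ N 0 M) ?leq_addr //= addrAC subrr add0r.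
rewrite [X in _ <= X](bigID (fun n => n \in s)) /= -[X in _ <= X + _]big_filter.
rewrite -[X in X <= _]addr0 lerD ?sumr_ge0 //.
rewrite le_eqVlt; apply/orP; left; apply/eqP; apply: perm_big; apply: uniq_perm => //.
  by rewrite filter_uniq // iota_uniq.
move=> n; rewrite mem_filter mem_index_iota; case ns : (n \in s) => //=.
by rewrite sN // sM.
Qed.

(** The expanded product contains all nonzero terms of index below N; the surplus consists of
    distinct terms of index at least N. *)
Lemma euler_product_diff N : (B < N)%N ->
  `|\prod_(0 <= p < N | prime p) ((~~ (p %| B)%N)%:R + v p) - series euler_term N| <=
  limn norm_series - norm_series N.
Proof.
move=> BN; rewrite -sum_sqfree_below.
rewrite (eq_big_seq euler_term); last by move=> n nN; rewrite sqf_mul_below.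
rewrite (bigID (fun n => (n < N)%N)) /=.
have -> : series euler_term N = \sum_(n <- sqfree_below N | (n < N)%N) euler_term n.
  rewrite /series /= (bigID (fun n => n \in sqfree_below N)) /= [X in _ + X]big1_seq ?addr0; last first.
    move=> n /andP[nN]; rewrite mem_index_iota => /andP[_ nlt]; rewrite /euler_term /sqf_mul.
    case: asboolP => [sn|_]; last by rewrite mulr0.
    case/negP: nN; apply/sqfree_belowP; split => // p pp pn.
    by apply: leq_ltn_trans nlt; apply: dvdn_leq pn; apply: sqfree_gt0.
  rewrite -big_filter -[RHS]big_filter; apply: perm_big; apply: uniq_perm; rewrite ?filter_uniq ?iota_uniq ?sqfree_below_uniq //.
  by move=> n; rewrite !mem_filter mem_index_iota /= andbC.
rewrite addrC addrK -big_filter; apply: le_trans (ler_norm_sum _ _ _) _.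
apply: sum_seq_le_tail; first by rewrite filter_uniq // sqfree_below_uniq.
by move=> n; rewrite mem_filter -leqNgt => /andP[].
Qed.

Lemma euler_product_cvg (l : R) :
  \prod_(0 <= p < N | prime p) ((~~ (p %| B)%N)%:R + v p) @[N --> \oo] --> l ->
  series euler_term @ \oo --> l.
Proof.
move=> Pl.
have D0 : (limn norm_series - norm_series N) @[N --> \oo] --> (0 : R).
  rewrite -(subrr (limn norm_series)).
  by apply: cvgB; [exact: cvg_cst | exact: norm_series_cvg].
have E0 : (\prod_(0 <= p < N | prime p) ((~~ (p %| B)%N)%:R + v p) - series euler_term N) @[N --> \oo] --> (0 : R).
  apply/cvgr0Pnorm_le => e e0; move/cvgr0Pnorm_le : D0 => /(_ e e0) D0.
  near=> N; apply: le_trans (euler_product_diff _) _; first by near: N; exists B.+1.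
  by apply: le_trans (ler_norm _) _; near: N.
have := cvgB Pl E0; rewrite subr0.
have E : series euler_term = (fun N => \prod_(0 <= p < N | prime p) ((~~ (p %| B)%N)%:R + v p)) \-
   (fun N => \prod_(0 <= p < N | prime p) ((~~ (p %| B)%N)%:R + v p) - series euler_term N).
  by apply/funext => N /=; rewrite opprB addrC subrK.
move=> H; rewrite E; exact: (H _).
Unshelve. all: by end_near. Qed.

End EulerProduct.

(** * The terms of the series *)

Lemma gcdn_mul_coprime f m n : coprime m n -> gcdn f (m * n) = (gcdn f m * gcdn f n)%N.
Proof.
move=> cmn; apply/eqP; rewrite eqn_dvd; apply/andP; split.
  rewrite muln_gcdr !muln_gcdl !dvdn_gcd.
  by rewrite !(dvdn_mulr _ (dvdn_gcdl _ _)) !(dvdn_mull _ (dvdn_gcdl _ _)) dvdn_gcdr.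
rewrite Gauss_dvd; last first.
  by apply: coprime_dvdl (dvdn_gcdr _ _) _; apply: coprime_dvdr (dvdn_gcdr _ _) _.
by rewrite !dvdn_gcd !dvdn_gcdl (dvdn_mulr _ (dvdn_gcdr _ _)) (dvdn_mull _ (dvdn_gcdr _ _)).
Qed.

(** For squarefree n, the cofactor n / (f, n) is prime to f, so that lcm and n both split into
    coprime factors. *)
Lemma totient_lcm_gcd f n : (0 < f)%N -> sqfree n ->
  (totient (lcmn f n) * totient (gcdn f n) = totient f * totient n)%N.
Proof.
move=> f0 sn; have n0 := sqfree_gt0 sn; set k := (n %/ gcdn f n)%N.
have nE : n = (gcdn f n * k)%N by rewrite mulnC divnK ?dvdn_gcdr.
have gk : coprime (gcdn f n) k by apply: sqfree_coprime; rewrite -nE.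
have fk : coprime f k.
  rewrite /coprime -dvdn1 -(eqP gk) dvdn_gcd dvdn_gcdr andbT dvdn_gcd dvdn_gcdl.
  by apply: dvdn_trans (dvdn_gcdr _ _) _; rewrite [X in (_ %| X)%N]nE dvdn_mull.
have lE : lcmn f n = (f * k)%N.
  apply/eqP; rewrite -(eqn_pmul2r (_ : 0 < gcdn f n)%N) ?gcdn_gt0 ?f0 //.
  by rewrite muln_lcm_gcd -mulnA (mulnC k) -nE.
by rewrite lE totient_coprime // [in RHS]nE (totient_coprime gk) -mulnA (mulnC (totient k)).
Qed.

Lemma logn_sqfree n p : sqfree n -> p \in primes n -> logn p n = 1%N.
Proof.
move=> sn; rewrite mem_primes => /and3P[pp n0 pn].
have := sn p pp; rewrite mulnn pfactor_dvdn // -ltnNge ltnS.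
have l0 : (0 < logn p n)%N by rewrite logn_gt0 mem_primes pp n0.
by move=> l1; apply/eqP; rewrite eqn_leq l1.
Qed.

Lemma mobius_sqfree n : sqfree n -> mobius n = (-1) ^+ size (primes n).
Proof.
move=> sn; rewrite /mobius sqfree_gt0 //=; case: allP => // H; case: H => p pn /=.
by rewrite (logn_sqfree sn pn).
Qed.

Lemma mobius_nsqfree n : ~ sqfree n -> mobius n = 0.
Proof.
case/not_sqfreeP => p pp pn; rewrite /mobius; case: posnP => //= n0.
case: allP => // /(_ p); rewrite mem_primes pp n0 (dvdn_trans (dvdn_mulr p (dvdnn p)) pn).
by move=> /(_ isT) /= /eqP l1; move: pn; rewrite mulnn pfactor_dvdn // l1.
Qed.

Lemma sqfree_mulP p n : prime p -> sqfree (p * n) -> [/\ sqfree n, ~~ (p %| n)%N & coprime p n].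
Proof.
move=> pp s; have c := sqfree_coprime s; split => //; last by rewrite -prime_coprime.
by apply: sqfree_dvd s; rewrite dvdn_mull.
Qed.

Lemma primes_mul_prime p n : prime p -> sqfree (p * n) ->
  perm_eq (primes (p * n)) (p :: primes n).
Proof.
move=> pp s; have [sn npn _] := sqfree_mulP pp s; have n0 := sqfree_gt0 sn.
apply: uniq_perm; rewrite ?primes_uniq //= ?primes_uniq ?mem_primes ?(negPf npn) ?andbF //.
move=> q; rewrite inE !mem_primes muln_gt0 n0 prime_gt0 //=.
case pq : (prime q) => /=; last by case: eqP => // E; move: pq; rewrite E pp.
by rewrite Euclid_dvdM // dvdn_prime2.
Qed.

Lemma mobius_mul_prime p n : prime p -> sqfree (p * n) -> mobius (p * n) = - mobius n.
Proof.
move=> pp s; have [sn _ _] := sqfree_mulP pp s.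
rewrite !mobius_sqfree // (perm_size (primes_mul_prime pp s)).
by rewrite /= exprS mulN1r.
Qed.

Lemma totient_leq n : (totient n <= n)%N.
Proof.
rewrite totient_count_coprime.
apply: (@leq_trans (\sum_(0 <= i < n) 1)%N); first by apply: leq_sum => i _; apply: leq_b1.
by rewrite sum_nat_const_nat subn0 muln1.
Qed.

Section LocalFactor.
Variables (R : realType) (a f h : nat).
Hypothesis f0 : (0 < f)%N.

(** The function w of the overview: phi(f) times the n-th term as it would be for e = 1, with
    phi(lcm(f, n)) rewritten through phi((f, n)). *)
Definition local_weight (n : nat) : R :=
  (mobius n)%:~R * (a == 1 %[mod gcdn f n])%N%:R * (gcdn n h)%:R *
  (totient (gcdn f n))%:R / (n%:R * (totient n)%:R).

Lemma local_weight_mul p n : prime p -> sqfree (p * n) ->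
  local_weight (p * n) = local_weight p * local_weight n.
Proof.
move=> pp s; have [sn npn cpn] := sqfree_mulP pp s.
have cg : coprime (gcdn f p) (gcdn f n).
  by apply: coprime_dvdl (dvdn_gcdr _ _) _; apply: coprime_dvdr (dvdn_gcdr _ _) _.
rewrite /local_weight mobius_mul_prime // gcdn_mul_coprime // chinese_remainder //.
rewrite ![gcdn _ h]gcdnC gcdn_mul_coprime // !totient_coprime // (mobius_sqfree (sqfree_prime pp)).
rewrite (primes_prime pp) expr1 !mulrNz mulr1z !natrM -mulnb !natrM invfM.
rewrite !invfM; move: (mobius n)%:~R (p%:R^-1) (n%:R^-1) => x1 x2 x3.
by ring.
Qed.

Lemma local_weight_prod n : (0 < n)%N -> local_weight n = sqf_mul local_weight n.
Proof.
rewrite /sqf_mul; case: asboolP => [sn _|ns _]; last first.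
  by rewrite /local_weight mobius_nsqfree // !mul0r.
rewrite (eq_big_seq (fun p => local_weight p ^+ logn p n)); last first.
  by move=> p pn; rewrite (logn_sqfree sn pn) expr1.
have n0 := sqfree_gt0 sn; move: n n0 sn; apply: prime_mul_ind => [_|p n pp n0 IH s].
  by rewrite big_nil /local_weight gcdn1 gcd1n !modn1 eqxx mobius_sqfree ?expr0 ?(mulr1, invr1) // => q; case: q => [|[|]].
rewrite prod_primes_logn ?(prime_gt0 pp) // local_weight_mul // IH; last by case: (sqfree_mulP pp s).
by rewrite (primes_prime pp) big_seq1 (logn_prime p pp) eqxx expr1.
Qed.

Lemma local_weight_prime p : prime p -> local_weight p =
  - ((a == 1 %[mod gcdn f p])%N%:R * (gcdn p h)%:R * (totient (gcdn f p))%:R / (p%:R * (p%:R - 1))).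
Proof.
move=> pp; rewrite /local_weight (mobius_sqfree (sqfree_prime pp)).
rewrite (primes_prime pp) expr1 rmorphN1 !mulNr mul1r (totient_prime pp).
by have -> : (p.-1)%:R = p%:R - 1 :> R by rewrite -subn1 natrB ?prime_gt0.
Qed.

Lemma local_weight_bound p : (0 < h)%N -> prime p ->
  `|local_weight p| <= (h * f)%:R / (p%:R * (p%:R - 1)).
Proof.
move=> h0 pp; have p1 : 0 <= p%:R - 1 :> R by rewrite subr_ge0 ler1n prime_gt0.
rewrite local_weight_prime // normrN normrM [X in _ * X]ger0_norm; last first.
  by rewrite invr_ge0 mulr_ge0 ?ler0n.
apply: ler_wpM2r; first by rewrite invr_ge0 mulr_ge0 ?ler0n.
rewrite -!natrM normr_nat ler_nat leq_mul //.
  rewrite -[X in (_ <= X)%N]mul1n leq_mul ?leq_b1 //; exact: dvdn_leq (dvdn_gcdr _ _).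
apply: leq_trans (dvdn_leq f0 (dvdn_gcdl f p)).
exact: totient_leq.
Qed.
End LocalFactor.

(** * Splitting of the discriminant with respect to f *)

Lemma star_odd (b : int) : odd `|b|%N -> star `|b|%N = (-1) ^ ((b - 1) %/ 2)%Z * b.
Proof.
move=> ob; rewrite /star expN1r -signr_odd.
by case E: (odd _); rewrite ?expr1 ?expr0 ?mulN1r ?mul1r; case: ifP; lia.
Qed.

Lemma b_gcd f D : D = b_ f D * (gcdn f `|D|)%:Z.
Proof. by rewrite /b_ divzK // dvdz_gcdr. Qed.

Lemma absz_b_gcd f D : `|D|%N = (`|b_ f D| * gcdn f `|D|)%N.
Proof. by rewrite {1}(b_gcd f D) abszM. Qed.

(** When b is odd, the 2-part c divides G = (f, |D|) entirely, so b and G / |c| are complementary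
    factors of the squarefree M. This makes b prime to G, hence to f, and gamma equal to c times the
    star of G / |c|. *)
Lemma disc_split f D : (0 < f)%N -> fund_disc D -> odd `|b_ f D|%N ->
  [/\ fund_disc (gamma_ f D), (`|gamma_ f D| %| f)%N, sqfree `|b_ f D|%N,
      coprime `|b_ f D|%N f & D = gamma_ f D * star `|b_ f D|%N].
Proof.
move=> f0 [c [M [cin oM sM DE]]] oB.
have DB := b_gcd f D; have aDB := absz_b_gcd f D.
have c0 : (0 < `|c|)%N by move: cin; rewrite !inE => /or4P[] /eqP->.
set G := gcdn f `|D|%N in DB aDB; set b := b_ f D in DB aDB oB *.
have aD : `|D|%N = (`|c| * M)%N by rewrite DE abszM absz_star.
have ccB := coprime_two_disc cin oB.
have /dvdnP[G' GE] : (`|c| %| G)%N by rewrite -(Gauss_dvdr _ ccB) -aDB aD dvdn_mulr.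
have ME : M = (`|b| * G')%N.
  by apply/eqP; rewrite -(eqn_pmul2l c0) -aD aDB GE; apply/eqP; ring.
have cBG' : coprime `|b|%N G' by apply: sqfree_coprime; rewrite -ME.
have sB : sqfree `|b|%N by apply: sqfree_dvd sM; rewrite ME dvdn_mulr.
have sG' : sqfree G' by apply: sqfree_dvd sM; rewrite ME dvdn_mull.
have oG' : odd G' by move: oM; rewrite ME oddM => /andP[].
have cBG : coprime `|b|%N G by rewrite GE coprimeMr cBG' coprime_sym.
have gE : gamma_ f D = (-1) ^ ((b - 1) %/ 2)%Z * G%:Z.
  by rewrite /gamma_ dvdzE dvdn2 oB.
have gB : D = gamma_ f D * star `|b|%N.
  rewrite gE (star_odd oB) expN1r -signr_odd {1}DB.
  by case: (odd _); rewrite ?expr1 ?expr0; ring.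
have sB0 : star `|b|%N != 0 by rewrite -absz_gt0 absz_star sqfree_gt0.
have gE' : gamma_ f D = c * star G'.
  by apply: (mulIf sB0); rewrite -gB DE ME mulnC starM // mulrA.
split=> //.
- by exists c, G'.
- rewrite gE expN1r abszM abszX abszN1 exp1n mul1n absz_nat; exact: dvdn_gcdl.
rewrite /coprime -dvdn1 -(eqP cBG) dvdn_gcd dvdn_gcdl dvdn_gcd dvdn_gcdr /=.
by rewrite aDB; apply: dvdn_mulr; apply: dvdn_gcdl.
Qed.

(** The lcm can be divisible by 4 or 8 only through f, as n is squarefree. So |D| dividing it forces
    c to divide f, which makes b odd; b is then prime to f and must divide n. *)
Lemma kum_epsE f n D : (0 < f)%N -> fund_disc D -> sqfree n ->
  kum_eps f n D = if odd `|b_ f D|%N && (2 * `|b_ f D| %| n)%N then 2 else 1.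
Proof.
move=> f0 fD sn; have n0 := sqfree_gt0 sn; have aDB := absz_b_gcd f D.
rewrite /kum_eps; suff -> : (2 %| n)%N && (`|D| %| lcmn f n)%N = odd `|b_ f D|%N && (2 * `|b_ f D| %| n)%N by [].
apply/idP/idP => [/andP[n2 Dm]|/andP[oB Bn]].
  have oB : odd `|b_ f D|%N.
    have [c [M [cin oM sM DE]]] := fD.
    have aD : `|D|%N = (`|c| * M)%N by rewrite DE abszM absz_star.
    have cm : (`|c| %| lcmn f n)%N by apply: dvdn_trans Dm; rewrite aD dvdn_mulr.
    have ln : (logn 2 n <= 1)%N by have := sn 2%N isT; rewrite mulnn pfactor_dvdn // -ltnNge ltnS.
    have lm0 : (0 < lcmn f n)%N by rewrite lcmn_gt0 f0.
    have pw j : (1 < j)%N -> (2 ^ j %| lcmn f n)%N -> (2 ^ j %| f)%N.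
      by move=> j1; rewrite !pfactor_dvdn // logn_lcm // leq_max => /orP[//|]; lia.
    have cf : (`|c| %| f)%N.
      move: cin cm; rewrite !inE => /or4P[] /eqP->; first by rewrite dvd1n.
      - exact: (pw 2%N).
      - exact: (pw 3%N).
      exact: (pw 3%N).
    have c0 : (0 < `|c|)%N by move: cin; rewrite !inE => /or4P[] /eqP->.
    have /dvdnP[G' GE] : (`|c| %| gcdn f `|D|)%N by rewrite dvdn_gcd cf aD dvdn_mulr.
    have ME : M = (`|b_ f D| * G')%N.
      by apply/eqP; rewrite -(eqn_pmul2l c0) -aD aDB GE; apply/eqP; ring.
    by move: oM; rewrite ME oddM => /andP[].
  have [_ _ _ cBf _] := disc_split f0 fD oB.
  rewrite oB Gauss_dvd ?coprime2n // n2 /= -(Gauss_dvdr _ cBf).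
  apply: dvdn_trans (_ : _ %| lcmn f n)%N _; last by rewrite -(muln_lcm_gcd f n) dvdn_mulr.
  by apply: dvdn_trans Dm; rewrite aDB dvdn_mulr.
have [_ _ _ cBf _] := disc_split f0 fD oB.
move: Bn; rewrite Gauss_dvd ?coprime2n // => /andP[-> Bn] /=.
rewrite aDB Gauss_dvd.
  rewrite (dvdn_trans Bn (dvdn_lcmr _ _)) /=.
  exact: dvdn_trans (dvdn_gcdl _ _) (dvdn_lcml _ _).
exact: coprime_dvdr (dvdn_gcdl _ _) cBf.
Qed.

(** * The n-th term in closed form *)

Section DeltaTerm.
Variables (R : realType) (g Delta : int) (h a f : nat).
Hypotheses (g0 : g != 0) (h0 : (0 < h)%N) (oh : odd h).
Hypotheses (hpow : exists x : int, g = x ^+ h).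
Hypotheses (hmax : forall k : nat, (exists x : int, g = x ^+ k) -> (k <= h)%N).
Hypotheses (fD : fund_disc Delta).
Hypotheses (gD : exists s t : int, [/\ s != 0, t != 0 & g * s ^+ 2 = Delta * t ^+ 2]).
Hypotheses (f0 : (0 < f)%N) (a0 : (0 < a)%N) (caf : coprime a f).
Local Notation B := `|b_ f Delta|%N.
Local Notation gam := (gamma_ f Delta).
Local Notation kr := (kronecker gam a%:Z).

Lemma kummer_invariants n : sqfree n ->
  \dim {:kummer f n g} = (n %/ kum_index f n h Delta * totient (lcmn f n))%N /\
  c_ f n g a = (a == 1 %[mod gcdn f n])%N && ((kum_eps f n Delta == 2%N) ==> (kr == 1)).
Proof.
move=> sn; have n0 := sqfree_gt0 sn.
pose w := projT2 (num_field_exists (kummer_gens f n g)).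
pose emb : {rmorphism kummer f n g -> algC} := projT1 w.
have mapE : map emb (Qgens (kummer_gens f n g)) = kummer_gens f n g := s2valP (projT2 w).
have genE : <<1 & Qgens (kummer_gens f n g)>>%VS = fullv := s2valP' (projT2 w).
have size3 : size (Qgens (kummer_gens f n g)) = 3%N by have := congr1 size mapE; rewrite size_map.
have gensE : Qgens (kummer_gens f n g) = [:: zeta_f_in f n g; zeta_n_in f n g; root_in f n g].
  rewrite /zeta_f_in /zeta_n_in /root_in.
  by move: (Qgens _) size3 => [|x [|y [|t [|]]]].
move: mapE; rewrite gensE /= => -[zfE znE rE]; rewrite gensE in genE.
have pf : f.-primitive_root (zeta_f_in f n g).
  by rewrite -(fmorph_primitive_root emb) zfE zeta_prim.
have pn : n.-primitive_root (zeta_n_in f n g).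
  by rewrite -(fmorph_primitive_root emb) znE zeta_prim.
have rn : root_in f n g ^+ n = g%:~R.
  by apply: (fmorph_inj emb); rewrite rmorphXn rE rootCK // rmorph_int.
have [z pz] := prim_lcm emb pf pn.
have gspec : kum_eps f n Delta = 2%N -> exists B,
  [/\ fund_disc gam, (`|gam| %| f)%N, odd B /\ sqfree B, (B %| n)%N & Delta = gam * star B].
  rewrite kum_epsE //; case: ifP => // /andP[oB Bn] _.
  have [fg gf sB _ DE] := disc_split f0 fD oB; exists B; split => //.
  by apply: dvdn_trans Bn; rewrite dvdn_mull.
split; first exact: (kummer_dim emb pf pn rn genE sn g0 h0 oh hpow hmax fD gD pz).
rewrite /c_; apply/asboolP/idP.
  case=> s [/andP[hs _] sE] sfix.
  have [amod kr1] := sigma_necessary emb pf pn rn gD a0 caf gspec hs sE sfix.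
  by apply/andP; split; [apply/eqP | apply/implyP => /eqP/kr1 ->].
case/andP => /eqP amod /implyP kr1.
apply: (sigma_sufficient emb pf pn rn genE sn g0 h0 oh hpow hmax fD gD pz a0 caf gspec amod).
by move=> /eqP/kr1/eqP.
Qed.

(** The factor e lost in the degree and the condition (gamma / a) = 1 combine: for e = 2 and a
    symbol equal to 1 or -1, twice the indicator of the value 1 is 1 plus the symbol. *)
Lemma delta_term_sqfree n : (0 < n)%N -> delta_term R a f g n =
  (totient f)%:R^-1 * (euler_term (local_weight R a f h) 1 n +
    (odd B)%:R * kr%:~R * euler_term (local_weight R a f h) (2 * B) n).
Proof.
move=> n0; rewrite /euler_term -local_weight_prod // dvd1n mul1r.
have [sn|ns] := pselect (sqfree n); last first.
  by rewrite /delta_term /local_weight mobius_nsqfree // !mul0r !mulr0 addr0 mulr0.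
have [dimE cE] := kummer_invariants sn.
rewrite /delta_term dimE cE -mulnb natrM.
have epsE := kum_epsE f0 fD sn.
have idv := kum_index_dvd f n Delta oh : (kum_index f n h Delta %| n)%N.
have i0 : (0 < kum_index f n h Delta)%N := dvdn_gt0 n0 idv.
have nE : n%:R = (n %/ kum_index f n h Delta)%:R * (gcdn n h)%:R * (kum_eps f n Delta)%:R :> R.
  by rewrite -!natrM -mulnA divnK.
have krE : (kum_eps f n Delta)%:R * ((kum_eps f n Delta == 2%N) ==> (kr == 1))%:R =
    1 + (odd B)%:R * kr%:~R * (2 * B %| n)%N%:R :> R.
  rewrite epsE; case oB: (odd B) => /=; last by rewrite !mul0r addr0 mulr1.
  case Bn: (2 * B %| n)%N => /=; last by rewrite !mulr0 addr0 mulr1.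
  have [fg gf sB _ DE] := disc_split f0 fD oB.
  (* The symbol is a sign because it describes the action on a square root of gamma. *)
  have [G GE] := sqrtC_exists gam; have [nu act] := Qn_aut_exists caf.
  have act' : acts_as nu `|gam|%N a := acts_as_dvd gf act.
  have := kronecker_act fg a0 (coprime_dvdr gf caf) act' GE.
  have G0 : G != 0 by rewrite -sqrf_eq0 GE intr_eq0 fund_disc_neq0.
  case: (sqrt_int_act nu GE) => -> E.
    have -> : kr = 1 by apply/eqP; rewrite -(eqr_int algC); apply/eqP/(mulIf G0); rewrite -E mul1r.
    by rewrite eqxx ?mulr1 ?mul1r ?mulr1.
  have -> : kr = -1 by apply/eqP; rewrite -(eqr_int algC); apply/eqP/(mulIf G0); rewrite -E mulN1r.
  by rewrite -[(-1 == 1 :> int)]/false mulr0 ?mulr1 ?mul1r mulrNz subrr.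
have tE := totient_lcm_gcd f0 sn; have tE' : (totient (lcmn f n))%:R * (totient (gcdn f n))%:R = (totient f)%:R * (totient n)%:R :> R by rewrite -!natrM tE.
have nz k : (0 < k)%N -> k%:R != 0 :> R by rewrite pnatr_eq0 -lt0n.
have l0 : (0 < lcmn f n)%N by rewrite lcmn_gt0 f0.
have g_0 : (0 < gcdn f n)%N by rewrite gcdn_gt0 f0.
have e0 : (0 < kum_eps f n Delta)%N by rewrite epsE; case: ifP.
have q0 : (0 < n %/ kum_index f n h Delta)%N by rewrite divn_gt0 // dvdn_leq.
have d0 : (0 < gcdn n h)%N by rewrite gcdn_gt0 n0.
have := nz _ n0; have := nz _ e0; have := nz _ q0; have := nz _ d0.
have := nz (totient (lcmn f n)); have := nz (totient (gcdn f n)).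
have := nz (totient f); have := nz (totient n); rewrite !totient_gt0 n0 f0 l0 g_0.
move=> /(_ isT) x1 /(_ isT) x2 /(_ isT) x3 /(_ isT) x4 x5 x6 x7 x8.
rewrite /local_weight; set I := (a == 1 %[mod gcdn f n])%N%:R.
set J := ((kum_eps f n Delta == 2%N) ==> (kr == 1))%:R in krE *.
have fE : (totient f)%:R = (totient (lcmn f n))%:R * (totient (gcdn f n))%:R / (totient n)%:R :> R.
  by rewrite tE' mulfK.
have WE (W : R) : W + (odd B)%:R * kr%:~R * ((2 * B %| n)%N%:R * W) = W * ((kum_eps f n Delta)%:R * J).
  by rewrite krE; ring.
rewrite WE natrM fE nE; move: (mobius n)%:~R => mu.
move: x1 x2 x3 x4 x5 x6 x7 x8; rewrite nE.
move: (totient n)%:R (totient f)%:R (totient (gcdn f n))%:R (totient (lcmn f n))%:R.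
move: (gcdn n h)%:R (n %/ kum_index f n h Delta)%:R (kum_eps f n Delta)%:R => d q e t1 t2 t3 t4.
move=> y1 y2 y3 y4 y5 y6 y7 y8.
by field; rewrite y1 y3 y4 y5 y6 y7.
Qed.

End DeltaTerm.

(** * Evaluation of the two series *)

Section Limits.
Local Open Scope classical_set_scope.
Variables (R : realType) (a f h : nat).
Hypotheses (f0 : (0 < f)%N) (a0 : (0 < a)%N) (h0 : (0 < h)%N) (oh : odd h) (caf : coprime a f).
Local Notation v := (local_weight R a f h).

Lemma prime_natr_gt1 p : prime p -> 1 < p%:R :> R.
Proof. by move=> /prime_gt1; rewrite ltr1n. Qed.

Lemma mod1_dvd p : (a == 1 %[mod p])%N = (p %| a - 1)%N.
Proof. by rewrite eqn_mod_dvd. Qed.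

Lemma local_weight_dvd p : prime p -> (p %| f)%N ->
  v p = - ((p %| a - 1)%N%:R * (gcdn p h)%:R / p%:R).
Proof.
move=> pp pf; rewrite local_weight_prime //.
have -> : gcdn f p = p by apply/gcdn_idPr.
rewrite mod1_dvd (totient_prime pp) -subn1 natrB ?prime_gt0 //.
have p1 := prime_natr_gt1 pp; have p0 : p%:R != 0 :> R by rewrite gt_eqF // (lt_trans ltr01).
have p1' : p%:R - 1 != 0 :> R by rewrite subr_eq0 gt_eqF.
by congr (- _); field; rewrite p0 p1'.
Qed.

Lemma local_weight_ndvd p : prime p -> ~~ (p %| f)%N ->
  v p = - ((gcdn p h)%:R / (p%:R * (p%:R - 1))).
Proof.
move=> pp pf; rewrite local_weight_prime //.
have -> : gcdn f p = 1%N by apply/eqP; rewrite -/(coprime f p) coprime_sym prime_coprime.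
by rewrite !modn1 eqxx mul1r mulr1.
Qed.

Lemma gcdn_prime_l p k : prime p -> gcdn p k = if (p %| k)%N then p else 1%N.
Proof.
move=> pp; case: ifP => [pk|npk]; first exact/gcdn_idPl.
by apply/eqP; rewrite -/(coprime p k) prime_coprime // npk.
Qed.

(** The finite factors of [A_]; for N > f + h they split off from the partial Euler product
    exactly. *)
Definition A_const : R :=
  if gcdn (gcdn (a - 1) f) h == 1%N then
    (\prod_(p <- primes (gcdn (a - 1) f)) (1 - p%:R^-1)) *
    (\prod_(p <- primes h | ~~ (p %| f)%N) (1 - (p%:R - 1)^-1))
  else 0.

Lemma prod_primes_nat (F : nat -> R) n N : (0 < n)%N -> (n < N)%N ->
  \prod_(0 <= p < N | prime p && (p %| n)%N) F p = \prod_(p <- primes n) F p.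
Proof.
move=> n0 nN; rewrite -big_filter; apply: perm_big; apply: uniq_perm; rewrite ?primes_uniq ?filter_uniq ?iota_uniq //.
move=> p; rewrite mem_filter mem_index_iota mem_primes n0 /=.
case pp: (prime p) => //=; case pn: (p %| n)%N => //=.
by apply: leq_ltn_trans nN; apply: dvdn_leq.
Qed.

Lemma prod_local_weight N : (f + h < N)%N ->
  \prod_(0 <= p < N | prime p) (1 + v p) = A_const * euler_partial R f h N.
Proof.
move=> fhN; have fN : (f < N)%N by lia. have hN : (h < N)%N by lia.
rewrite (bigID (fun p => p %| f)%N) /=.
rewrite [X in _ * X](bigID (fun p => p %| h)%N) /= mulrA; congr (_ * _); last first.
  rewrite /euler_partial; under eq_bigl do rewrite -andbA.
  apply: eq_bigr => p /and3P[pp pf ph].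
  by rewrite local_weight_ndvd // gcdn_prime_l // (negPf ph) div1r.
rewrite prod_primes_nat //.
have -> : \prod_(0 <= p < N | prime p && ~~ (p %| f)%N && (p %| h)%N) (1 + v p) =
   \prod_(p <- primes h | ~~ (p %| f)%N) (1 - (p%:R - 1)^-1).
  rewrite -[RHS]big_filter -[LHS]big_filter.
  rewrite (perm_big [seq p <- primes h | ~~ (p %| f)%N]) /=; last first.
    apply: uniq_perm; rewrite ?filter_uniq ?primes_uniq ?iota_uniq //.
    move=> p; rewrite !mem_filter mem_index_iota mem_primes h0 /=.
    case pp: (prime p); case pf: (p %| f)%N; case ph: (p %| h)%N => //=.
    by apply: leq_ltn_trans hN; apply: dvdn_leq.
  apply: eq_big_seq => p; rewrite mem_filter mem_primes => /and4P[pf pp _ ph].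
  have p1 := prime_natr_gt1 pp; have p0 : p%:R != 0 :> R by rewrite gt_eqF // (lt_trans ltr01).
  have p1' : p%:R - 1 != 0 :> R by rewrite subr_eq0 gt_eqF.
  rewrite local_weight_ndvd // gcdn_prime_l // ph; congr (1 - _).
  by field; rewrite p0 p1'.
have gf0 : (0 < gcdn (a - 1) f)%N by rewrite gcdn_gt0 f0 orbT.
rewrite /A_const; case: ifP => [/eqP cop|/eqP ncop].
  congr (_ * _); rewrite (bigID (fun p => p %| a - 1)%N) /= [X in _ * X]big1_seq ?mulr1; last first.
    move=> p /andP[pa]; rewrite mem_primes => /and3P[pp _ pf].
    by rewrite local_weight_dvd // (negPf pa) !mul0r oppr0 addr0.
  rewrite -big_filter (perm_big (primes (gcdn (a - 1) f))) /=; last first.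
    apply: uniq_perm; rewrite ?filter_uniq ?primes_uniq //.
    move=> p; rewrite mem_filter !mem_primes f0 gf0 dvdn_gcd /=.
    by case: (prime p); case: (p %| a - 1)%N.
  apply: eq_big_seq => p; rewrite mem_primes dvdn_gcd => /and4P[pp _ pa pf].
  rewrite local_weight_dvd // gcdn_prime_l // pa mul1r.
  have -> : (p %| h)%N = false; last by rewrite div1r.
  apply/negP => ph; have : (p %| 1)%N by rewrite -cop !dvdn_gcd pa pf ph.
  by rewrite dvdn1 => /eqP p1; move: pp; rewrite p1.
(* At a common prime p of a - 1, f and h the weight is -1, so the factor 1 + v p vanishes, in
   accordance with the value 0 of [A_]. *)
apply/eqP; rewrite mulf_eq0; apply/orP; left; rewrite prodf_seq_eq0; apply/hasP.
have g1 : (1 < gcdn (gcdn (a - 1) f) h)%N.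
  by rewrite ltn_neqAle eq_sym (introN eqP ncop) gcdn_gt0 h0 orbT.
set g1' := gcdn (gcdn (a - 1) f) h in g1.
have pp := pdiv_prime g1; have := pdiv_dvd g1'; rewrite !dvdn_gcd => /andP[/andP[pa pf] ph].
exists (pdiv g1'); first by rewrite mem_primes pp f0.
rewrite local_weight_dvd // gcdn_prime_l // ph pa mul1r divff ?subrr ?eqxx //.
by rewrite pnatr_eq0 -lt0n prime_gt0.
Qed.

(** All factors lie between 0 and 1, so the partial products decrease and stay nonnegative. *)
Lemma euler_partial_cvg : cvgn (euler_partial R f h).
Proof.
have F01 p : prime p -> 0 <= 1 - ((p%:R : R) * (p%:R - 1))^-1 <= 1.
  move=> pp; have p2 : 2 <= p%:R :> R by rewrite (ler_nat _ 2) prime_gt1.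
  have H : 1 <= p%:R * (p%:R - 1) :> R by move: (p%:R : R) p2 => x x2; nra.
  by rewrite subr_ge0 gerBl invr_ge0 invf_le1 ?H ?(lt_le_trans ltr01 H) ?(le_trans ler01 H).
have P0 N : 0 <= euler_partial R f h N.
  by rewrite /euler_partial prodr_ge0 // => p /andP[pp _]; case/andP: (F01 p pp).
apply: nonincreasing_is_cvgn.
  apply/nonincreasing_seqP => N; rewrite /euler_partial big_mkcond big_nat_recr //= -big_mkcond /=.
  case: ifP => [/and3P[pp _ _]|_]; last by rewrite mulr1.
  by rewrite ler_piMr //; [exact: P0 | case/andP: (F01 N pp)].
by exists 0 => _ [N _ <-].
Qed.

Lemma A_constE : A_ R a f h = A_const * limn (euler_partial R f h).
Proof. by rewrite /A_ /A_const; case: ifP => _; rewrite ?mul0r. Qed.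

Lemma prod_weight_cvg : \prod_(0 <= p < N | prime p) (1 + v p) @[N --> \oo] --> A_ R a f h.
Proof.
rewrite A_constE.
have : (fun N => A_const * euler_partial R f h N) @ \oo --> A_const * limn (euler_partial R f h).
  by apply: cvgMr; exact: euler_partial_cvg.
apply: cvg_trans; apply: near_eq_cvg; near=> N.
by rewrite prod_local_weight //; near: N; exists (f + h).+1.
Unshelve. all: by end_near. Qed.

Lemma weight_series_cvg1 : series (euler_term v 1) @ \oo --> A_ R a f h.
Proof.
apply: (@euler_product_cvg _ _ (h * f)%:R) => //.
- by move=> p pp; apply: local_weight_bound.
- by move=> q pq; rewrite dvdn1 muln_eq1 andbb; case: q pq => [|[|]].
apply: cvg_trans prod_weight_cvg; apply: near_eq_cvg; near=> N.
apply: eq_bigr => p pp; rewrite dvdn1; case: eqP => // p1.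
by move: pp; rewrite p1.
Unshelve. all: by end_near. Qed.

Variable B : int.
Hypotheses (oB : odd `|B|%N) (sB : sqfree `|B|%N) (cBf : coprime `|B|%N f).

Definition b_factor (p : nat) : R :=
  if (p %| h)%N then p%:R - 2 else p%:R ^+ 2 - p%:R - 1.

(** The two cases agree: if 2 divides f, then a is odd and the congruence holds; h is odd in any
    case. *)
Lemma weight_two : v 2%N = - (1 / 2).
Proof.
have gh : gcdn 2 h = 1%N by apply/eqP; rewrite -/(coprime 2 h) coprime2n.
have [f2|nf2] := boolP (2 %| f)%N.
  have a2 : (2 %| a - 1)%N.
    have : coprime a 2 by apply: coprime_dvdr f2 caf.
    by rewrite coprimen2 dvdn2 oddB // => ->.
  rewrite (local_weight_dvd (isT : prime 2) f2) a2 gh.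
  by rewrite mulr1.
rewrite (local_weight_ndvd (isT : prime 2) nf2) gh.
by have -> : 2%:R * (2%:R - 1) = 2 :> R by ring.
Qed.

(** Primes of B are odd and prime to f; p - 2 and p^2 - p - 1 are the numerators of 1 + v p, nonzero
    because p >= 3. *)
Lemma weight_ratio_prime p : prime p -> (p %| `|B|)%N ->
  1 + v p != 0 /\ v p / (1 + v p) = - (b_factor p)^-1.
Proof.
move=> pp pB; have op : odd p by apply: dvdn_odd pB oB.
have npf : ~~ (p %| f)%N by rewrite -prime_coprime //; apply: coprime_dvdl pB cBf.
have p3 : 3 <= p%:R :> R by rewrite (ler_nat _ 3) odd_prime_gt2.
rewrite local_weight_ndvd // gcdn_prime_l // /b_factor; move: p3.
case: ifP => _; move: (p%:R : R) => x x3.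
  have x0 : x != 0 by lra.
  have x1 : x - 1 != 0 by lra.
  have x2 : x - 2 != 0 by lra.
  have -> : 1 - x / (x * (x - 1)) = (x - 2) / (x - 1) by field; rewrite x0 x1.
  split; first by rewrite mulf_neq0 ?invr_eq0.
  by field; rewrite x0 x1 x2.
have x0 : x != 0 by lra.
have x1 : x - 1 != 0 by lra.
have x2 : x ^+ 2 - x - 1 != 0.
  have : 0 <= (x - 3) * (x - 1) by rewrite mulr_ge0; lra.
  by move=> H; apply/eqP => E; nra.
have -> : 1 - 1%:R / (x * (x - 1)) = (x ^+ 2 - x - 1) / (x * (x - 1)) by field; rewrite x0 x1.
split; first by rewrite mulf_neq0 ?invr_eq0 ?mulf_neq0.
by field; rewrite x0 x1 x2.
Qed.

Lemma weight_neq0 p : prime p -> (p %| 2 * `|B|)%N -> 1 + v p != 0.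
Proof.
move=> pp; rewrite Euclid_dvdM // => /orP[|/(weight_ratio_prime pp)[]//].
rewrite dvdn_prime2 // => /eqP->; rewrite weight_two.
have -> : 1 - 1 / 2 = 1 / 2 :> R by field.
by rewrite mulf_neq0 ?invr_eq0 ?oner_eq0 ?pnatr_eq0.
Qed.

(** The prime 2 contributes exactly -1 and every other prime a minus sign, which together give the
    Moebius value. *)
Lemma weight_ratio : \prod_(p <- primes (2 * `|B|)) (v p / (1 + v p)) =
  (mobius (2 * `|B|)%N)%:~R / b_denom R B h.
Proof.
have s2B : sqfree (2 * `|B|) by apply: sqfree_mul_prime => //; rewrite dvdn2 oB.
rewrite (perm_big _ (primes_mul_prime (isT : prime 2) s2B)) big_cons /=.
rewrite (mobius_mul_prime (isT : prime 2) s2B) (mobius_sqfree sB) weight_two.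
have -> : - (1 / 2) / (1 - 1 / 2) = -1 :> R by field.
rewrite (eq_big_seq (fun p => - (b_factor p)^-1)); last first.
  by move=> p; rewrite mem_primes => /and3P[pp _ /(weight_ratio_prime pp)[]].
rewrite mulrNz rmorph_sign !mulNr mul1r; congr (- _).
have -> : b_denom R B h = \prod_(p <- primes `|B|) b_factor p.
  rewrite /b_denom [RHS](bigID (fun p => p %| h)%N) /=; congr (_ * _).
    by apply: eq_bigr => p ph; rewrite /b_factor ph.
  by apply: eq_bigr => p ph; rewrite /b_factor (negPf ph).
elim: (primes `|B|) => [|p s IH]; first by rewrite !big_nil expr0 invr1 mulr1.
by rewrite !big_cons IH /= exprS invfM !mulNr mul1r mulrCA.
Qed.

(** Restricting to multiples of 2|B| replaces the factor 1 + v p by v p at the primes of 2|B|. Only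
    these nonzero factors are divided by, so the argument covers a vanishing [A_]. *)
Lemma weight_series_cvg2 : series (euler_term v (2 * `|B|)) @ \oo -->
  A_ R a f h * ((mobius (2 * `|B|)%N)%:~R / b_denom R B h).
Proof.
have s2B : sqfree (2 * `|B|).
  by apply: sqfree_mul_prime => //; rewrite dvdn2 oB.
have B0 := sqfree_gt0 s2B.
apply: (@euler_product_cvg _ _ (h * f)%:R) => //.
  by move=> p pp; apply: local_weight_bound.
rewrite -weight_ratio.
have : (fun N => \prod_(0 <= p < N | prime p) (1 + v p) * \prod_(p <- primes (2 * `|B|)) (v p / (1 + v p))) @ \oo
   --> A_ R a f h * \prod_(p <- primes (2 * `|B|)) (v p / (1 + v p)).
  by apply: cvgMl; exact: prod_weight_cvg.
apply: cvg_trans; apply: near_eq_cvg; near=> N.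
have BN : (2 * `|B| < N)%N by near: N; exists (2 * `|B|).+1.
rewrite -(prod_primes_nat _ B0 BN) (bigID (fun p => p %| 2 * `|B|)%N) /=.
rewrite [RHS](bigID (fun p => p %| 2 * `|B|)%N) /= mulrAC -big_split /=; congr (_ * _).
  apply: eq_bigr => p /andP[pp pB]; rewrite pB add0r mulrC divfK //.
  exact: weight_neq0.
by apply: eq_bigr => p /andP[pp ->].
Unshelve. all: by end_near. Qed.

End Limits.

(** [delta_sum] starts at index 1 but [series] at 0, hence the vanishing at 0. *)
Lemma delta_sumE (R : realType) a f g (u1 u2 : nat -> R) (c d : R) :
  (forall n, (0 < n)%N -> delta_term R a f g n = c * (u1 n + d * u2 n)) ->
  u1 0%N = 0 -> u2 0%N = 0 ->
  delta_sum R a f g = (fun N => c * (series u1 N + d * series u2 N)).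
Proof.
move=> H u10 u20; apply/funext => -[|N].
  by rewrite /delta_sum /series /= !big_geq // mulr0 addr0 mulr0.
rewrite /delta_sum /series /= [\sum_(0 <= i < N.+1) u1 i]big_ltn //.
rewrite [\sum_(0 <= i < N.+1) u2 i]big_ltn // u10 u20 !add0r mulr_sumr -big_split mulr_sumr /=.
by apply: eq_big_nat => n /andP[n0 _]; rewrite H.
Qed.

Theorem theorem2 (R : realType) (g : int) (h : nat) (Delta : int) (a f : nat)
  (g_neqN1 : g <> -1)
  (g_nonsquare : ~ exists x : int, g = x ^+ 2)
  (h_ge1 : (1 <= h)%N)
  (g_hpower : exists x : int, g = x ^+ h)
  (h_max : forall k : nat, (exists x : int, g = x ^+ k) -> (k <= h)%N)
  (Delta_disc : is_discriminant (quad_field g) Delta)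
  (f_ge1 : (1 <= f)%N)
  (a_range : (1 <= a <= f)%N)
  (coprime_af : coprime a f) :
  cvgn (delta_sum R a f g) /\
  delta R a f g =
    A_ R a f h / (totient f)%:R *
    (1 + (kronecker (gamma_ f Delta) a%:Z)%:~R *
         ((mobius (2 * `|b_ f Delta|)%N)%:~R / b_denom R (b_ f Delta) h)).
Proof.
have [a0 _] := andP a_range.
have g0 : g != 0 by apply/eqP => g0; apply: g_nonsquare; exists 0; rewrite g0 expr0n.
(* An even h would make g a square. *)
have oh : odd h.
  apply: contraT => eh; case: g_nonsquare; have [x xE] := g_hpower.
  exists (x ^+ h./2); rewrite -exprM muln2 xE.
  by congr (_ ^+ _); rewrite -[LHS]odd_double_half (negPf eh).
have [fD gD] := quad_field_disc g_nonsquare Delta_disc.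
have term0 v B : euler_term v B 0 = 0 :> R.
  by rewrite /euler_term /sqf_mul; case: asboolP => [/sqfree_gt0//|_]; rewrite mulr0.
set l := (X in _ = X).
suff H : (delta_sum R a f g @ \oo --> l)%classic.
  by split; [apply/cvg_ex; exists l | apply/cvg_lim].
have tE := delta_term_sqfree R g0 h_ge1 oh g_hpower h_max fD gD f_ge1 a0 coprime_af.
rewrite (delta_sumE tE) ?term0 //.
have c1 : (series (euler_term (local_weight R a f h) 1) @ \oo --> A_ R a f h)%classic.
  exact: weight_series_cvg1.
(* For even b the indicator vanishes on one side and, as 4 divides 2|b|, the Moebius value on the
   other. *)
have lE : l = (totient f)%:R^-1 * (A_ R a f h + (odd `|b_ f Delta|%N)%:R *
    (kronecker (gamma_ f Delta) a%:Z)%:~R *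
    (A_ R a f h * ((mobius (2 * `|b_ f Delta|)%N)%:~R / b_denom R (b_ f Delta) h))).
  rewrite /l; case oB: (odd _); first by rewrite [true%:R * _]mul1r; move: (_ / b_denom _ _ _) => x; ring.
  rewrite mobius_nsqfree ?mul0r ?mulr0 ?mul0r ?addr0 ?mulr1 1?mulrC //.
  by move=> /(_ 2%N isT); rewrite dvdn_pmul2l // dvdn2 oB.
rewrite lE; apply: cvgMr; apply: cvgD => //.
case oB: (odd `|b_ f Delta|%N).
  have [_ _ sB cBf _] := disc_split f_ge1 fD oB.
  by apply: cvgMr; apply: weight_series_cvg2.
(* For even b the coefficient is cancelled before passing to the limit, so the second summand is the
   constant sequence 0. *)
rewrite !mul0r; under eq_fun do rewrite !mul0r.
exact: cvg_cst.
Qed.
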